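(* Let $W=\{W_z: z\in\mathbb{R}^2\}$ be an irreducible Weyl system acting on a Hilbert space $H$. Then there is a unique CP semigroup $\phi=\{\phi_t: t\ge 0\}$ on $\mathcal{B}(H)$ satisfying $$\phi_t(W_z)=e^{-t|z|^2}W_z,\qquad z\in\mathbb{R}^2,\ t\ge 0.$$ The only bounded normal linear functional $\rho$ on $\mathcal{B}(H)$ for which $\rho\circ\phi_t=\rho$ for all $t\ge0$ is $\rho=0$. In particular, there is no normal state of $\mathcal{B}(H)$ which is invariant under $\phi$.
   Context: Let $\omega$ be the symplectic form on $\mathbb{R}^2$ given by $\omega((x,y),(x',y'))=\frac12(x'y-xy')$, and let $|z|^2=x^2+y^2$ for $z=(x,y)\in\mathbb{R}^2$. A Weyl system on a Hilbert space $H$ is a strongly continuous map $z\in\mathbb{R}^2\mapsto W_z\in\mathcal{B}(H)$ into the unitary operators satisfying $W_{z_1}W_{z_2}=e^{i\omega(z_1,z_2)}W_{z_1+z_2}$ for all $z_1,z_2\in\mathbb{R}^2$; it is irreducible if the only bounded operators commuting with all $W_z$ are scalars (with $H\neq0$; such an $H$ is automatically separable). A CP semigroup on $\mathcal{B}(H)$ ($H$ a separable Hilbert space) is a semigroup $\phi=\{\phi_t:t\ge0\}$ (that is, $\phi_0=\mathrm{id}$ and $\phi_{s+t}=\phi_s\circ\phi_t$) of normal (i.e. weak$^*$-continuous) completely positive linear maps on $\mathcal{B}(H)$ with $\phi_t(\mathbf{1})=\mathbf{1}$ for all $t$, and such that $t\mapsto\langle\phi_t(A)\xi,\eta\rangle$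 is continuous for all $\xi,\eta\in H$, $A\in\mathcal{B}(H)$. A functional $\rho$ is invariant under $\phi$ if $\rho\circ\phi_t=\rho$ for all $t\ge0$. *)

(* Defs.v *)
From HB Require Import structures.
From mathcomp Require Import all_boot all_order all_algebra.
From mathcomp Require Import all_classical all_reals all_analysis.
From mathcomp Require Import complex.

Set Implicit Arguments.
Unset Strict Implicit.
Unset Printing Implicit Defensive.

Import Order.TTheory GRing.Theory Num.Theory numFieldNormedType.Exports.

Local Open Scope classical_set_scope.
Local Open Scope ring_scope.
Local Open Scope complex_scope.

(* A Hilbert space is a complete normed space over R[i] whose norm comes from
   an inner product (linear on the left, conjugate-linear on the right).
   R[i]^o is R[i] seen as a normed space over itself; the bare type R[i] has no
   topology in the library. *)
Definition inner_product_of (R : realType) (H : completeNormedModType R[i])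
    (dot : {dot H for Num.conj}) : Prop :=
  forall x : H, `|x| ^+ 2 = dot x x.

Definition separable (T : topologicalType) : Prop :=
  exists D : set T, countable D /\ dense D.

Section BoundedOperators.
Variables (R : realType) (H : completeNormedModType R[i]).

Definition is_bounded_op (f : H -> H) : bool := `[< linear f /\ continuous f >].

Record bounded_op := BoundedOp {
  bounded_op_fun :> H -> H;
  bounded_opP : is_bounded_op bounded_op_fun }.

HB.instance Definition _ := [isSub for bounded_op_fun].
HB.instance Definition _ := [Choice of bounded_op by <:].

Lemma is_bounded_op_submod : submod_closed is_bounded_op.
Proof.
split=> [|c f g /asboolP[lf cf] /asboolP[lg cg]]; apply/asboolP; split.
- by move=> c x y; rewrite -[RHS]/(c *: 0 + 0) scaler0 addr0.
- exact: cst_continuous.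
- by move=> a x y; rewrite !fctE lf lg !scalerDr !scalerA addrACA (mulrC c).
- move=> x; apply: cvgD; last exact: cg.
  exact: continuousZl_tmp (cf x).
Qed.

HB.instance Definition _ :=
  GRing.isSubmodClosed.Build R[i] (H -> H) is_bounded_op is_bounded_op_submod.
HB.instance Definition _ :=
  [SubChoice_isSubLmodule of bounded_op by <:].

Lemma is_bounded_op_id : is_bounded_op (@id H).
Proof. by apply/asboolP; split=> // x; apply: cvg_id. Qed.

Definition one_op : bounded_op := BoundedOp is_bounded_op_id.

End BoundedOperators.

Arguments one_op {R H}.
Notation "''B' ( H )" := (bounded_op H) (at level 8, format "''B' ( H )").

Definition op_norm (R : realType) (H : completeNormedModType R[i])
    (A : 'B(H)) : R :=
  sup [set complex.Re `|A x| | x in [set x : H | `|x| <= 1]].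

Section Normality.
Variables (R : realType) (H : completeNormedModType R[i]).
Variable dot : {dot H for Num.conj}.

Definition square_summable (xi : nat -> H) : Prop :=
  cvgn (series (fun n => `|xi n| ^+ 2 : R[i]^o)).

Definition predual_index : Type :=
  {p : (nat -> H) * (nat -> H) | square_summable p.1 /\ square_summable p.2}.

(* The elements of the predual of B(H), the trace-class operators acting by the
   trace, are the functionals A |-> \sum_n <A xi_n, eta_n> with xi and eta
   square-summable. *)
Definition predual_pairing (A : 'B(H)) (p : predual_index) : R[i]^o :=
  limn (series (fun n => dot (A ((sval p).1 n)) ((sval p).2 n) : R[i]^o)).

(* B(H) with its weak* (that is, ultraweak) topology. *)
Definition weak_star : topologicalType :=
  initial_topology (predual_pairing : 'B(H) -> {ptws predual_index -> R[i]^o}).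

Definition normal_map (phi : 'B(H) -> 'B(H)) : Prop :=
  continuous (phi : weak_star -> weak_star).

Definition normal_functional (rho : 'B(H) -> R[i]) : Prop :=
  continuous (rho : weak_star -> R[i]^o).

Definition bounded_functional (rho : 'B(H) -> R[i]) : Prop :=
  exists M : R, forall A : 'B(H), `|rho A| <= (M * op_norm A)%:C.

End Normality.

Section Positivity.
Variables (R : realType) (H : completeNormedModType R[i]).
Variable dot : {dot H for Num.conj}.

(* In R[i], 0 <= c means that c is a nonnegative real number. *)
Definition positive_op (A : 'B(H)) : Prop := forall x : H, 0 <= dot (A x) x.

(* Positivity of [A i j], an element of M_n(B(H)), as an operator on H^n. *)
Definition positive_op_matrix n (A : 'M['B(H)]_n) : Prop :=
  forall xi : 'I_n -> H, 0 <= \sum_(i < n) \sum_(j < n) dot (A i j (xi j)) (xi i).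

Definition completely_positive (phi : 'B(H) -> 'B(H)) : Prop :=
  forall n (A : 'M['B(H)]_n),
    positive_op_matrix A -> positive_op_matrix (map_mx phi A).

Record normal_state (rho : 'B(H) -> R[i]) : Prop := NormalState {
  normal_state_linear : linear (rho : 'B(H) -> R[i]^o);
  normal_state_ge0 : forall A, positive_op A -> 0 <= rho A;
  normal_state1 : rho one_op = 1;
  normal_state_normal : normal_functional dot rho }.

(* Only the values phi t with 0 <= t are constrained. *)
Record cp_semigroup (phi : R -> 'B(H) -> 'B(H)) : Prop := CPSemigroup {
  cp_semigroup_separable : separable H;
  cp_semigroup0 : forall A, phi 0 A = A;
  cp_semigroupD : forall s t, 0 <= s -> 0 <= t ->
    forall A, phi (s + t) A = phi s (phi t A);
  cp_semigroup_linear : forall t, 0 <= t -> linear (phi t);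
  cp_semigroup_normal : forall t, 0 <= t -> normal_map dot (phi t);
  cp_semigroup_cp : forall t, 0 <= t -> completely_positive (phi t);
  cp_semigroup1 : forall t, 0 <= t -> phi t one_op = one_op;
  cp_semigroup_continuous : forall (A : 'B(H)) (xi eta : H),
    {within `[0, +oo[, continuous (fun t => dot (phi t A xi) eta : R[i]^o)} }.

End Positivity.

Definition invariant_functional (R : realType) (H : completeNormedModType R[i])
    (phi : R -> 'B(H) -> 'B(H)) (rho : 'B(H) -> R[i]) : Prop :=
  forall t, 0 <= t -> forall A, rho (phi t A) = rho A.

Definition symplectic (R : realType) (z z' : R * R) : R :=
  2^-1 * (z'.1 * z.2 - z.1 * z'.2).

Definition sqnorm2 (R : realType) (z : R * R) : R := z.1 ^+ 2 + z.2 ^+ 2.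

Definition expi (R : realType) (t : R) : R[i] := cos t +i* sin t.

Section WeylSystems.
Variables (R : realType) (H : completeNormedModType R[i]).
Variable dot : {dot H for Num.conj}.

Definition unitary_op (U : 'B(H)) : Prop :=
  exists V : 'B(H), [/\ forall x y, dot (U x) y = dot x (V y),
    forall x, V (U x) = x & forall x, U (V x) = x].

Record weyl_system (W : R * R -> 'B(H)) : Prop := WeylSystem {
  weyl_unitary : forall z, unitary_op (W z);
  weyl_continuous : forall xi : H, continuous (fun z => W z xi);
  weyl_mul : forall z1 z2 xi,
    W z1 (W z2 xi) = expi (symplectic z1 z2) *: W (z1 + z2) xi }.

Definition irreducible_family (W : R * R -> 'B(H)) : Prop :=
  (exists xi : H, xi != 0) /\
  forall T : 'B(H), (forall z xi, T (W z xi) = W z (T xi)) ->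
    exists c : R[i], T = c *: one_op.

End WeylSystems.

(* Main.v *)
From HB Require Import structures.
Require Import Defs.
From mathcomp Require Import all_boot all_order all_algebra.
From mathcomp Require Import all_classical all_reals all_analysis.
From mathcomp Require Import measurable_realfun complex.
From mathcomp Require Import ring lra.

Set Implicit Arguments.
Unset Strict Implicit.
Unset Printing Implicit Defensive.

Import Order.TTheory GRing.Theory Num.Theory numFieldNormedType.Exports.

Local Open Scope classical_set_scope.
Local Open Scope ring_scope.
Local Open Scope complex_scope.

(** Conjugating a Weyl operator by another multiplies it by a phase: with
    V = W_(-u) one has V* W_z V = e^(i (z_1 u_2 - u_1 z_2)) W_z.  Averaging over
    a random u turns the phase into the characteristic function of u, and
    e^(-t |z|^2) is the characteristic function of a centred Gaussian vector of
    the plane with independent coordinates of variance 2t.  Therefore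

      phi_t A = E [V* A V],   V = W_(-u),   u Gaussian of variance 2t,

    has the required effect on the W_z, and it is unital and completely
    positive because every A |-> V* A V is ([average_cp]).  The expectation is
    taken in one coordinate after the other, each time against the standard
    normal law rescaled by sqrt (2t); the one-dimensional characteristic
    function is [normal_prob_cos] and [normal_prob_sin].

    The analytic core is about normal maps.  A linear functional on B(H) is
    normal exactly when it is bounded by an ultrastrong seminorm
    A |-> (\sum_n |A zeta_n|^2)^(1/2) with zeta square-summable
    ([normal_ultrastrongly_bounded], [ultrastrongly_bounded_pairing]).  For phi_t
    this requires E |A V xi|^2 to be at most some \sum_n |A Z_n|^2.  The operator
    E [|V xi><V xi|] would provide Z; a direct construction replaces it: V xi is
    the sum of countably valued random vectors with geometrically small terms,
    and the values weighted by the square roots of their probabilities serve as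
    Z ([discretisation], [average_normal]).

    The linear span of the W_z is a unital algebra closed under adjoints, with
    trivial commutant by irreducibility.  The argument of the double commutant
    theorem, carried out on the space of square-summable sequences in H, shows
    that it is ultrastrongly dense ([ultrastrong_density]), so normal linear
    functionals that agree on all W_z are equal ([normal_functional_ext]).  This
    gives the uniqueness of phi, and also phi_(s+t) = phi_s phi_t, since both
    sides are normal and agree on the W_z.  The same density shows that H is
    separable.

    If rho is normal and invariant then rho (W_z) = e^(-|z|^2) rho (W_z), whence
    rho (W_z) = 0 for z <> 0.  By the strong continuity of W and the ultrastrong
    bound on rho this extends to z = 0, and density gives rho = 0
    ([heat_invariant_functional_eq0]).  A state takes the value 1 at the
    identity, so no normal state is invariant. *)

(** * Complex numbers by real and imaginary parts *)

Section ComplexParts.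
Variable R : realType.
Implicit Types (z w : R[i]) (r : R).

Local Notation Re := complex.Re.
Local Notation Im := complex.Im.

(** The squared modulus, kept as a real number so that estimates are polynomial
    inequalities in real and imaginary parts. *)
Definition normsq z : R := Re z ^+ 2 + Im z ^+ 2.

Lemma complex_eq z w : Re z = Re w -> Im z = Im w -> z = w.
Proof. by case: z w => [a b] [c d] /= -> ->. Qed.

Lemma cReD z w : Re (z + w) = Re z + Re w. Proof. by case: z w => [a b] [c d]. Qed.
Lemma cImD z w : Im (z + w) = Im z + Im w. Proof. by case: z w => [a b] [c d]. Qed.
Lemma cReN z : Re (- z) = - Re z. Proof. by case: z. Qed.
Lemma cImN z : Im (- z) = - Im z. Proof. by case: z. Qed.
Lemma cReB z w : Re (z - w) = Re z - Re w. Proof. by rewrite cReD cReN. Qed.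
Lemma cImB z w : Im (z - w) = Im z - Im w. Proof. by rewrite cImD cImN. Qed.
Lemma cReM z w : Re (z * w) = Re z * Re w - Im z * Im w.
Proof. by case: z w => [a b] [c d]. Qed.
Lemma cImM z w : Im (z * w) = Re z * Im w + Im z * Re w.
Proof. by case: z w => [a b] [c d]. Qed.
Lemma cReJ z : Re (Num.conj z) = Re z. Proof. by case: z. Qed.
Lemma cImJ z : Im (Num.conj z) = - Im z. Proof. by case: z. Qed.
Lemma cRe_sum (I : Type) (s : seq I) (P : pred I) (F : I -> R[i]) :
  Re (\sum_(i <- s | P i) F i) = \sum_(i <- s | P i) Re (F i).
Proof. by apply: (big_morph _ cReD). Qed.
Lemma cIm_sum (I : Type) (s : seq I) (P : pred I) (F : I -> R[i]) :
  Im (\sum_(i <- s | P i) F i) = \sum_(i <- s | P i) Im (F i).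
Proof. by apply: (big_morph _ cImD). Qed.

Definition complexP := (cReD, cImD, cReN, cImN, cReM, cImM, cReJ, cImJ).

Lemma normsq_ge0 z : 0 <= normsq z.
Proof. by rewrite addr_ge0 ?sqr_ge0. Qed.

Lemma cnormE z : `|z| = (Num.sqrt (normsq z))%:C.
Proof. by rewrite normc_def. Qed.

Lemma normr_lt_sq z (r : R) : 0 < r -> normsq z < r ^+ 2 -> `|z| < r%:C.
Proof.
move=> r0 h; rewrite cnormE ltcR -(ger0_norm (ltW r0)) -sqrtr_sqr ltr_sqrt //.
by rewrite exprn_gt0.
Qed.

Lemma normsq_lt z (r : R) : `|z| < r%:C -> normsq z < r ^+ 2.
Proof.
rewrite cnormE ltcR => h; rewrite -(sqr_sqrtr (normsq_ge0 z)).
by rewrite ltr_pXn2r // ?nnegrE ?sqrtr_ge0 // (le_trans _ (ltW h)) ?sqrtr_ge0.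
Qed.

Lemma normsq_le z (r : R) : `|z| <= r%:C -> normsq z <= r ^+ 2.
Proof.
rewrite cnormE lecR => h; rewrite -(sqr_sqrtr (normsq_ge0 z)).
by rewrite ler_pXn2r // ?nnegrE ?sqrtr_ge0 // (le_trans _ h) ?sqrtr_ge0.
Qed.

Lemma gt0_realE (e : R[i]) : 0 < e -> e = (Re e)%:C /\ 0 < Re e.
Proof. by case: e => a b; rewrite ltcE /= => /andP[/eqP -> a0]. Qed.

Lemma cRe_ge0 z : 0 <= z -> 0 <= Re z.
Proof. by case: z => a b; rewrite lecE /= => /andP[]. Qed.

Lemma normsqM z w : normsq (z * w) = normsq z * normsq w.
Proof. by rewrite /normsq !complexP; ring. Qed.

Lemma normsq_conj z : normsq (Num.conj z) = normsq z.
Proof. by rewrite /normsq !complexP sqrrN. Qed.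

Lemma normsqN z : normsq (- z) = normsq z.
Proof. by rewrite /normsq cReN cImN !sqrrN. Qed.

Lemma normsq_real r : normsq r%:C = r ^+ 2.
Proof. by rewrite /normsq /= expr0n addr0. Qed.

Lemma normsq_eq0 z : normsq z = 0 -> z = 0.
Proof.
move/eqP; rewrite paddr_eq0 ?sqr_ge0 // !sqrf_eq0 => /andP[/eqP a /eqP b].
exact: complex_eq.
Qed.

End ComplexParts.

(** * Inner products on complex vector spaces *)

Section InnerProduct.
Variables (R : realType) (V : lmodType R[i]) (dot : {dot V for Num.conj}).
Implicit Types x y z : V.
Local Notation Re := complex.Re.
Local Notation Im := complex.Im.

(** The squared norm, kept in the real field for the same reason; it makes sense
    on any vector space with an inner product, in particular before any
    topology is put on it. *)
Definition sqnorm x : R := Re (dot x x).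
Local Notation sq := sqnorm.

Lemma dotDl x y z : dot (x + y) z = dot x z + dot y z.
Proof. exact: linearDl. Qed.
Lemma dotDr x y z : dot z (x + y) = dot z x + dot z y.
Proof. exact: linearDr. Qed.
Lemma dotBl x y z : dot (x - y) z = dot x z - dot y z.
Proof. exact: linearBl. Qed.
Lemma dotBr x y z : dot z (x - y) = dot z x - dot z y.
Proof. exact: linearBr. Qed.
Lemma dotZl a x z : dot (a *: x) z = a * dot x z.
Proof. exact: linearZl_LR. Qed.
Lemma dotZr a x z : dot z (a *: x) = Num.conj a * dot z x.
Proof. exact: linearZr_LR. Qed.
Lemma dotC x y : dot x y = Num.conj (dot y x).
Proof. by rewrite hermC expr0 mul1r. Qed.
Lemma dot0l x : dot 0 x = 0. Proof. exact: linear0l. Qed.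
Lemma dot0r x : dot x 0 = 0. Proof. exact: linear0r. Qed.

Lemma sqE x : dot x x = (sq x)%:C.
Proof.
have : 0 <= dot x x by exact: dnorm_ge0.
by rewrite /sqnorm; case: (dot x x) => a b; rewrite lecE /= => /andP[/eqP -> _].
Qed.

Lemma sq_ge0 x : 0 <= sq x.
Proof. by rewrite -ler0c -sqE; exact: dnorm_ge0. Qed.

Lemma sq0 : sq 0 = 0. Proof. by rewrite /sqnorm dot0l. Qed.

Lemma sq_eq0 x : sq x = 0 -> x = 0.
Proof. by move=> h; apply/eqP; rewrite -(dnorm_eq0 dot) sqE h. Qed.

Lemma sqD x y : sq (x + y) = sq x + sq y + 2 * Re (dot x y).
Proof. by rewrite /sqnorm !dotDl !dotDr (dotC y x) !complexP; ring. Qed.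

Lemma sqZ a x : sq (a *: x) = normsq a * sq x.
Proof. by rewrite /sqnorm dotZl dotZr sqE /normsq !complexP /=; ring. Qed.

Lemma sqN x : sq (- x) = sq x.
Proof. by rewrite -scaleN1r sqZ /normsq !complexP /= oppr0; ring. Qed.

Lemma sqB x y : sq (x - y) = sq x + sq y - 2 * Re (dot x y).
Proof. by rewrite sqD sqN -scaleN1r dotZr !complexP /=; ring. Qed.

Lemma sqBC x y : sq (x - y) = sq (y - x).
Proof. by rewrite -sqN opprB. Qed.

Lemma sqD_le x y : sq (x + y) <= 2 * sq x + 2 * sq y.
Proof. by have := sq_ge0 (x - y); rewrite sqB sqD; lra. Qed.

Lemma sqB_le x y : sq (x - y) <= 2 * sq x + 2 * sq y.
Proof. by rewrite (le_trans (sqD_le _ _)) // sqN. Qed.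

(** Positivity of the squared norm of |y|^2 x - <x,y> y, which needs no division. *)
Lemma cauchy_schwarz x y : normsq (dot x y) <= sq x * sq y.
Proof.
have [/sq_eq0 ->|y0] := eqVneq (sq y) 0.
  by rewrite dot0r sq0 mulr0 /normsq /= expr0n addr0.
have yp : 0 < sq y by rewrite lt_def y0 sq_ge0.
have := sq_ge0 ((sq y)%:C *: x - dot x y *: y).
have -> : sq ((sq y)%:C *: x - dot x y *: y)
    = sq y * (sq x * sq y - normsq (dot x y)).
  by rewrite sqB !sqZ dotZl dotZr !complexP /= normsq_real /normsq; ring.
by rewrite pmulr_rge0 // subr_ge0.
Qed.

Lemma Re_dot_le x y : Re (dot x y) <= (sq x + sq y) / 2.
Proof. by have := sq_ge0 (x - y); rewrite sqB; lra. Qed.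

Lemma norm_Re_dot_le x y : `|Re (dot x y)| <= (sq x + sq y) / 2.
Proof.
have := Re_dot_le x y; have := Re_dot_le (- x) y.
by rewrite sqN -scaleN1r dotZl !complexP /= ler_norml => ? ?; apply/andP; split; lra.
Qed.

Lemma Im_dotE x y : Im (dot x y) = Re (dot x ('i *: y)).
Proof. by rewrite dotZr !complexP /=; ring. Qed.

Lemma norm_Im_dot_le x y : `|Im (dot x y)| <= (sq x + sq y) / 2.
Proof.
rewrite Im_dotE; apply: (le_trans (norm_Re_dot_le _ _)).
by rewrite sqZ /normsq /= expr0n expr1n add0r mul1r.
Qed.

Lemma dot_sep x : (forall y, dot y x = 0) -> x = 0.
Proof. by move=> /(_ x) h; apply: sq_eq0; rewrite /sqnorm h. Qed.

Lemma dot_inj x y : (forall z, dot z x = dot z y) -> x = y.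
Proof.
move=> h; apply/eqP; rewrite -subr_eq0; apply/eqP/dot_sep => z.
by rewrite dotBr h subrr.
Qed.

(** Convergence and completeness in terms of the inner product alone: the space
    of square-summable sequences will carry no topology of its own. *)
Definition dot_cvg (u : nat -> V) (l : V) : Prop :=
  forall e : R, 0 < e -> exists N : nat, forall n, (N <= n)%N -> sq (u n - l) < e.

Definition dot_complete : Prop := forall u : nat -> V,
  (forall e : R, 0 < e -> exists N : nat, forall m n, (N <= m)%N -> (N <= n)%N ->
     sq (u m - u n) < e) ->
  exists l, dot_cvg u l.

End InnerProduct.

(** * Riesz representation on the range of a linear map *)

Section Riesz.
Variables (R : realType) (V : lmodType R[i]) (dot : {dot V for Num.conj}).
Variables (E : lmodType R[i]) (S : set E) (T : E -> V) (f : E -> R[i]) (C : R).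
Hypothesis Vcomplete : dot_complete dot.
Hypothesis S0 : S 0.
Hypothesis SL : forall a x y, S x -> S y -> S (a *: x + y).
Hypothesis TL : linear T.
Hypothesis fL : linear (f : E -> R[i]^o).
Hypothesis fT : forall e, S e -> normsq (f e) <= C * sqnorm dot (T e).
Local Notation Re := complex.Re.
Local Notation sq := (sqnorm dot).

Let J e : R := sq (T e) - 2 * Re (f e).

Let fP a x y : f (a *: x + y) = a * f x + f y.
Proof. exact: fL. Qed.

Let J_ge e : S e -> - (`|C| + 1) <= J e.
Proof.
move=> Se; rewrite /J; have := fT Se; have := sq_ge0 dot (T e).
have C0 := normr_ge0 C; have CC := ler_norm C.
rewrite /normsq; set q := sq _; set a := Re _; set b := complex.Im _ => q0 h.
have {}h : a ^+ 2 <= (`|C| + 1) * q.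
  have := sqr_ge0 b; have : C * q <= `|C| * q by rewrite ler_wpM2r.
  lra.
rewrite leNgt; apply/negP => neg.
have : (q + (`|C| + 1)) ^+ 2 < (2 * a) ^+ 2.
  by rewrite ltr_pXn2r // ?nnegrE; lra.
by have := sqr_ge0 (q - (`|C| + 1)); rewrite !expr2 in h *; lra.
Qed.

Let range : set R := [set J e | e in S].
Let hasinf : has_inf range.
Proof.
split; first by exists (J 0), 0.
by exists (- (`|C| + 1)) => _ [e Se <-]; exact: J_ge.
Qed.
Let j := inf range.

Let J_ge_inf e : S e -> j <= J e.
Proof. by move=> Se; apply: ge_inf; [exact: hasinf.2|exists e]. Qed.

Let T0 : T 0 = 0.
Proof. by have := TL (-1) 0 0; rewrite scaler0 addr0 scaleN1r addNr. Qed.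

Let f0 : f 0 = 0.
Proof. by have := fP (-1) 0 0; rewrite scaler0 addr0 mulN1r addNr. Qed.

Let J_mid x y : S x -> S y -> sq (T x - T y) <= 2 * (J x + J y) - 4 * j.
Proof.
move=> Sx Sy; pose m := 2^-1%:C *: x + (2^-1%:C *: y + 0).
have Sm : S m by apply: SL => //; exact: SL.
have := J_ge_inf Sm.
rewrite /J /m !fP f0 TL TL T0 addr0 -scalerDr sqZ normsq_real sqB sqD !complexP /=.
set p := sq _; set q := sq _; set c := Re _; set fx := Re _; set fy := Re _.
move: (complex.Im _) (complex.Im _) => u v.
have -> : (2^-1 : R) ^+ 2 = 4^-1 by field.
lra.
Qed.

(** A functional f on S that is bounded by |T e| factors through T, and is then
    the inner product with a vector of the closure of T(S).  That vector is
    the limit of T along a minimising sequence for |T e|^2 - 2 Re f(e), which is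
    Cauchy by the parallelogram law.  Three instances serve below: Riesz
    representation (T the identity), projection onto the closure of T(S), and
    normal functionals (T A the sequence of the A zeta_n). *)
Theorem riesz_range : exists w : V,
  (forall e, S e -> f e = dot (T e) w) /\
  (forall eps : R, 0 < eps -> exists2 e, S e & sq (T e - w) < eps).
Proof.
have /choice[u uP] n : exists e, S e /\ J e < j + n.+1%:R^-1.
  have n0 : 0 < n.+1%:R^-1 :> R by [].
  have [_ [e Se <-] h] := inf_adherent n0 hasinf.
  by exists e.
have small (e : R) : 0 < e -> exists N : nat, forall n, (N <= n)%N -> n.+1%:R^-1 < e.
  move=> e0; have [N _ NP] := near_infty_natSinv_lt (PosNum e0).
  by exists N => n Nn; exact: NP.
have [w wP] : exists w, dot_cvg dot (T \o u) w.
  apply: Vcomplete => e e0; have [|N NP] := small (e / 4); first by rewrite divr_gt0.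
  exists N => m n Nm Nn /=.
  apply: le_lt_trans (J_mid (uP m).1 (uP n).1) _.
  have := (uP m).2; have := (uP n).2; have := NP _ Nm; have := NP _ Nn.
  by move: n.+1%:R^-1 m.+1%:R^-1 (J _) (J _) => ? ? ? ?; lra.
exists w; split=> [e Se|eps e0]; last first.
  have [N NP] := wP eps e0; exists (u N); first exact: (uP N).1.
  exact: NP.
(* first variation of the functional at the minimiser, in every direction t e *)
have var t : 0 <= 2 * Re (t * (dot (T e) w - f e)) + normsq t * sq (T e).
  rewrite leNgt; apply/negP => neg.
  set d := - (2 * Re (t * (dot (T e) w - f e)) + normsq t * sq (T e)).
  have d0 : 0 < d by rewrite /d; lra.
  pose K := normsq t * sq (T e) + 1.
  have K0 : 0 < K by rewrite /K ltr_wpDl // mulr_ge0 ?normsq_ge0 ?sq_ge0.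
  have [|N1 N1P] := small (d / 2); first by rewrite divr_gt0.
  have [|N2 N2P] := wP ((d / 4) ^+ 2 / K).
    by rewrite divr_gt0 // exprn_gt0 // divr_gt0.
  pose n := maxn N1 N2.
  have := N1P n (leq_maxl _ _); have /= := N2P n (leq_maxr _ _).
  set r := sq _ => hr hn.
  have := J_ge_inf (SL t Se (uP n).1); have := (uP n).2.
  rewrite /J fP TL sqD sqZ dotZl.
  rewrite -[X in dot (T e) X](subrK w) [T (u n) - w + w]addrC.
  have cs := cauchy_schwarz dot (t *: T e) (T (u n) - w).
  rewrite sqZ -/r dotZl in cs.
  rewrite dotDr.
  set q := dot (T e) (_ - w) in cs *.
  have qle : Re (t * q) <= d / 4.
    rewrite leNgt; apply/negP => hq.
    have : (d / 4) ^+ 2 < normsq (t * q).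
      rewrite /normsq; have := sqr_ge0 (complex.Im (t * q)).
      have d4 : 0 < d / 4 by rewrite divr_gt0.
      have : (d / 4) ^+ 2 < Re (t * q) ^+ 2 by rewrite !expr2; nra.
      lra.
    apply/negP; rewrite -leNgt; apply: (le_trans cs).
    rewrite ltr_pdivlMr // in hr; apply: ltW; apply: le_lt_trans hr.
    rewrite mulrC; apply: ler_wpM2l; first exact: sq_ge0.
    by rewrite /K lerDl.
  rewrite mulrDr !cReD => h1 h2.
  have : d = - (2 * (Re (t * dot (T e) w) - Re (t * f e)) + normsq t * sq (T e)).
    by rewrite /d mulrBr cReB.
  by clearbody d; move: n.+1%:R^-1 hn h1 => v hn h1; lra.
apply/eqP; rewrite eq_sym -subr_eq0; apply/eqP.
set z := dot (T e) w - f e in var *; apply: normsq_eq0.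
apply/eqP; rewrite eq_le normsq_ge0 andbT leNgt; apply/negP => z0.
pose s := (sq (T e) + 1)^-1.
have q0 := sq_ge0 dot (T e).
have s0 : 0 < s by rewrite invr_gt0; lra.
have := var (- s%:C * Num.conj z).
rewrite normsqM normsq_conj -[_ * Num.conj z * z]mulrA.
have -> : normsq (- s%:C) = s ^+ 2 by rewrite /normsq !complexP /= oppr0; ring.
have -> : Re (- s%:C * (Num.conj z * z)) = - s * normsq z.
  by rewrite /normsq !complexP /=; ring.
have s1 : s * sq (T e) < 1.
  by rewrite mulrC ltr_pdivrMr ?mul1r; lra.
have : s * normsq z > 0 by rewrite mulr_gt0.
set p := s * normsq z => p0.
have -> : 2 * (- s * normsq z) + s ^+ 2 * normsq z * sq (T e)
  = p * (s * sq (T e) - 2) by rewrite /p; ring.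
by rewrite leNgt => /negP; apply; rewrite pmulr_rlt0 //; lra.
Qed.

End Riesz.

(** * Complex limits and nonnegative series *)

Section ComplexLimits.
Variable R : realType.
Local Notation Re := (@complex.Re R).
Local Notation Im := (@complex.Im R).

Let sqr_normr (x : R) : `|x| ^+ 2 = x ^+ 2.
Proof. by rewrite real_normK ?num_real. Qed.

Lemma cvgC (T : Type) (F : set_system T) (FF : Filter F) (f : T -> R[i]) (l : R[i]) :
  Re (f x) @[x --> F] --> Re l -> Im (f x) @[x --> F] --> Im l ->
  (f x : R[i]^o) @[x --> F] --> (l : R[i]^o).
Proof.
move=> /cvgrPdist_lt hr /cvgrPdist_lt hi; apply/cvgrPdist_lt => e /gt0_realE[].
move: (Re e) => r -> {e} r0; have r2 : 0 < r / 2 by rewrite divr_gt0.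
near=> x; apply: normr_lt_sq => //.
have h1 : `|Re l - Re (f x)| < r / 2 by near: x; exact: hr.
have h2 : `|Im l - Im (f x)| < r / 2 by near: x; exact: hi.
rewrite /normsq cReB cImB -(sqr_normr (Re l - _)) -(sqr_normr (Im l - _)).
have lt2 p : 0 <= p -> p < r / 2 -> p ^+ 2 < (r / 2) ^+ 2.
  by move=> p0 h; rewrite ltr_pXn2r // nnegrE ltW.
have := lt2 _ (normr_ge0 _) h1; have := lt2 _ (normr_ge0 _) h2.
by have := exprn_gt0 2 r0; lra.
Unshelve. all: by end_near. Qed.

Lemma cvgC_parts (T : Type) (F : set_system T) (FF : Filter F) (f : T -> R[i]) (l : R[i]) :
  (f x : R[i]^o) @[x --> F] --> (l : R[i]^o) ->
  (Re (f x) @[x --> F] --> Re l) /\ (Im (f x) @[x --> F] --> Im l).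
Proof.
move=> /cvgrPdist_lt h; split; apply/cvgrPdist_lt => e e0.
  have := h e%:C; rewrite ltcR => /(_ e0); apply: filterS => x /normsq_lt.
  rewrite /normsq -cReB => hx; rewrite -(ltr_pXn2r (n := 2)) ?nnegrE ?normr_ge0 ?ltW //.
  by rewrite sqr_normr; have := sqr_ge0 (Im (l - f x)); lra.
have := h e%:C; rewrite ltcR => /(_ e0); apply: filterS => x /normsq_lt.
rewrite /normsq -cImB => hx; rewrite -(ltr_pXn2r (n := 2)) ?nnegrE ?normr_ge0 ?ltW //.
by rewrite sqr_normr; have := sqr_ge0 (Re (l - f x)); lra.
Qed.

Lemma limC_eq (u : nat -> R[i]^o) (l : R[i]) : u @ \oo --> (l : R[i]^o) -> limn u = l.
Proof. exact: (@cvg_lim R[i]^o (@norm_hausdorff _ R[i]^o)). Qed.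

Lemma series_re (u : nat -> R[i]) n : Re (series u n) = series (Re \o u) n.
Proof. by rewrite /series /= cRe_sum. Qed.
Lemma series_im (u : nat -> R[i]) n : Im (series u n) = series (Im \o u) n.
Proof. by rewrite /series /= cIm_sum. Qed.

Lemma cvgC_series (u : nat -> R[i]) :
  cvgn (series (Re \o u)) -> cvgn (series (Im \o u)) ->
  cvgn (series (u : nat -> R[i]^o)).
Proof.
move=> hr hi; apply: (cvgP ((limn (series (Re \o u)) +i* limn (series (Im \o u))) : R[i]^o)).
apply: cvgC => /=.
  by under eq_fun do rewrite series_re.
by under eq_fun do rewrite series_im.
Qed.

Lemma cvgC_series_dom (u : nat -> R[i]) (a : nat -> R) :
  (forall n, `|Re (u n)| <= a n) -> (forall n, `|Im (u n)| <= a n) ->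
  cvgn (series a) -> cvgn (series (u : nat -> R[i]^o)).
Proof.
move=> h1 h2 ca.
have a0 n : 0 <= a n by apply: le_trans (h1 n).
by apply: cvgC_series; apply: normed_cvg;
  apply: (@series_le_cvg _ _ a) => //= n; exact: normr_ge0.
Qed.

End ComplexLimits.

Section NonnegativeSeries.
Variables (R : realType) (a : nat -> R).
Hypothesis a0 : forall n, 0 <= a n.

Let aE0 n : (0 <= (a n)%:E)%E. Proof. by rewrite lee_fin. Qed.

Lemma nneseries_leP (M : R) :
  (\sum_(n <oo) (a n)%:E <= M%:E)%E <-> forall N, \sum_(0 <= n < N) a n <= M.
Proof.
split=> [h N|h].
  rewrite -lee_fin -sumEFin; apply: le_trans h.
  by apply: nneseries_lim_ge => n _ _; exact: aE0.
apply: lime_le; first by apply: is_cvg_nneseries => n _ _; exact: aE0.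
by apply: nearW => N; rewrite sumEFin lee_fin.
Qed.

Lemma nneseries_fin_ex :
  (\sum_(n <oo) (a n)%:E < +oo)%E -> exists M : R, (\sum_(n <oo) (a n)%:E = M%:E)%E.
Proof.
move=> h; exists (fine (\sum_(n <oo) (a n)%:E)%E); rewrite fineK // ge0_fin_numE //.
by apply: nneseries_ge0 => n _ _; exact: aE0.
Qed.

Lemma nneseries_finP :
  (\sum_(n <oo) (a n)%:E < +oo)%E <-> cvgn (series a).
Proof.
split=> [/nneseries_fin_ex[M hM]|/cvg_seq_bounded/bounded_fun_has_ubound[M hM]].
  have {}hM : (\sum_(n <oo) (a n)%:E <= M%:E)%E by rewrite hM.
  apply: nondecreasing_is_cvgn; first exact: nondecreasing_series.
  by exists M => _ [n _ <-]; exact: (nneseries_leP M).1.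
apply: (@le_lt_trans _ _ M%:E); last exact: ltry.
by apply/nneseries_leP => N; apply: hM; exists N.
Qed.

Lemma nneseries_limE : cvgn (series a) ->
  (\sum_(n <oo) (a n)%:E)%E = (limn (series a))%:E.
Proof.
move=> ca; rewrite -EFin_lim //; apply: congr_lim; apply/funext => n /=.
by rewrite sumEFin.
Qed.

End NonnegativeSeries.

(** * Square-summable sequences of vectors *)

Section SquareSum.
Variables (R : realType) (V : lmodType R[i]) (dot : {dot V for Num.conj}).
Implicit Types x y : nat -> V.
Local Notation Re := (@complex.Re R).
Local Notation Im := (@complex.Im R).

(** The squared l^2 norm, with values in the extended reals so that
    square-summability is finiteness and no convergence has to be assumed. *)
Definition sqnorm_sum x : \bar R := (\sum_(n <oo) (sqnorm dot (x n))%:E)%E.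
Local Notation nsq := sqnorm_sum.

Lemma nsq_ge0 x : (0 <= nsq x)%E.
Proof. by apply: nneseries_ge0 => n _ _; rewrite lee_fin sq_ge0. Qed.

Lemma nsq_leP x (M : R) :
  (nsq x <= M%:E)%E <-> forall N, \sum_(0 <= n < N) sqnorm dot (x n) <= M.
Proof. by apply: nneseries_leP => n; exact: sq_ge0. Qed.

Lemma nsq_fin_ex x : (nsq x < +oo)%E -> exists M : R, nsq x = M%:E.
Proof. by apply: nneseries_fin_ex => n; exact: sq_ge0. Qed.

Lemma sq_le_nsq x n : ((sqnorm dot (x n))%:E <= nsq x)%E.
Proof.
apply: le_trans (@nneseries_lim_ge _ _ xpredT 0%N n.+1 _); last first.
  by move=> k _ _; rewrite lee_fin sq_ge0.
by rewrite sumEFin big_nat_recr //= lee_fin lerDr sumr_ge0 // => k _; exact: sq_ge0.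
Qed.

Lemma nsq_le_sq x y (c : R) : 0 <= c ->
  (forall n, sqnorm dot (x n) <= c * sqnorm dot (y n)) -> (nsq x <= c%:E * nsq y)%E.
Proof.
move=> c0 h; rewrite /sqnorm_sum -nneseriesZl; last by move=> n _; rewrite lee_fin sq_ge0.
apply: lee_nneseries => n _; first by rewrite lee_fin sq_ge0.
by rewrite -EFinM lee_fin.
Qed.

Lemma nsqD x y : (nsq (x \+ y)%R <= 2%:E * nsq x + 2%:E * nsq y)%E.
Proof.
have s0 z n : (0 <= (sqnorm dot (z n))%:E)%E by rewrite lee_fin sq_ge0.
rewrite /sqnorm_sum -!nneseriesZl //.
rewrite -nneseriesD => [|n _ _|n _ _]; [|exact: mule_ge0..].
apply: lee_nneseries => n _; first exact: s0.
by rewrite -!EFinM -EFinD lee_fin; exact: sqD_le.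
Qed.

Lemma nsqD_fin x y : (nsq x < +oo -> nsq y < +oo -> nsq (x \+ y)%R < +oo)%E.
Proof.
move=> hx hy; apply: le_lt_trans (nsqD x y) _.
by rewrite lte_add_pinfty // lte_mul_pinfty.
Qed.

Lemma nsqZ (c : R[i]) x : nsq (fun n => c *: x n) = ((normsq c)%:E * nsq x)%E.
Proof.
rewrite /sqnorm_sum -nneseriesZl; last by move=> n _; rewrite lee_fin sq_ge0.
by apply: eq_eseriesr => n _; rewrite sqZ EFinM.
Qed.

Lemma nsqZ_fin (c : R[i]) x : (nsq x < +oo -> nsq (fun n => c *: x n) < +oo)%E.
Proof. by move=> hx; rewrite nsqZ lte_mul_pinfty // lee_fin normsq_ge0. Qed.

Lemma nsq0 : nsq (fun=> 0) = 0%E.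
Proof. by apply: eseries0 => n _ _; rewrite sq0. Qed.

Lemma nsq_single (v : V) : nsq (fun n => if n is 0%N then v else 0) = (sqnorm dot v)%:E.
Proof.
rewrite /sqnorm_sum nneseries_recl //; last by move=> n; rewrite lee_fin sq_ge0.
rewrite eseries0 ?adde0 // => -[|n] // _ _.
by rewrite sq0.
Qed.

Lemma cvg_pairing x y : (nsq x < +oo -> nsq y < +oo ->
  cvgn (series (fun n => dot (x n) (y n) : R[i]^o)))%E.
Proof.
move=> hx hy.
apply: (@cvgC_series_dom _ _ (fun n => sqnorm dot (x n) + sqnorm dot (y n))) => [n|n|].
- apply: le_trans (norm_Re_dot_le _ _ _) _.
  by have := sq_ge0 dot (x n); have := sq_ge0 dot (y n); lra.
- apply: le_trans (norm_Im_dot_le _ _ _) _.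
  by have := sq_ge0 dot (x n); have := sq_ge0 dot (y n); lra.
rewrite [X in series X](_ : _ = (sqnorm dot \o x) \+ (sqnorm dot \o y)) //.
by apply: is_cvg_seriesD; apply/nneseries_finP => // n; exact: sq_ge0.
Qed.

Definition pairing x y : R[i] := limn (series (fun n => dot (x n) (y n) : R[i]^o)).

Lemma pairing0l y : pairing (fun=> 0) y = 0.
Proof.
apply: limC_eq; rewrite (_ : series _ = cst 0); first exact: cvg_cst.
by apply/funext => n; rewrite /series /= big1 // => k _; rewrite dot0l.
Qed.

Lemma pairing_sq x : (nsq x < +oo)%E -> pairing x x = (fine (nsq x))%:C.
Proof.
move=> hx; have c : cvgn (series (sqnorm dot \o x)).
  by apply/nneseries_finP => // n; exact: sq_ge0.
rewrite /sqnorm_sum (nneseries_limE c) /pairing /=.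
apply: limC_eq.
apply: cvgC => /=.
  by under eq_fun do rewrite series_re.
rewrite [X in X @ _ --> _](_ : _ = cst 0); first exact: cvg_cst.
apply/funext => n; rewrite series_im /series /= big1 // => k _.
by rewrite /= sqE.
Qed.

Lemma pairingDl x x' y : (nsq x < +oo)%E -> (nsq x' < +oo)%E -> (nsq y < +oo)%E ->
  pairing (x \+ x') y = pairing x y + pairing x' y.
Proof.
move=> hx hx' hy; apply: limC_eq.
set u : nat -> R[i]^o := series _.
rewrite (_ : u = series (fun n => dot (x n) (y n) : R[i]^o)
              + series (fun n => dot (x' n) (y n) : R[i]^o)).
  by apply: cvgD; exact: cvg_pairing.
apply/funext => n; rewrite !fctE /u /series /= -big_split /=.
by apply: eq_bigr => i _; rewrite dotDl.
Qed.

Lemma pairingZl c x y : (nsq x < +oo)%E -> (nsq y < +oo)%E ->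
  pairing (fun n => c *: x n) y = c * pairing x y.
Proof.
move=> hx hy; apply: limC_eq.
set u : nat -> R[i]^o := series _.
rewrite (_ : u = c *: series (fun n => dot (x n) (y n) : R[i]^o)).
  by apply: cvgZl_tmp; exact: cvg_pairing.
apply/funext => n; rewrite fctE /u /series /= scaler_sumr.
by apply: eq_bigr => i _; rewrite dotZl.
Qed.

Lemma pairingC x y : (nsq x < +oo)%E -> (nsq y < +oo)%E ->
  pairing x y = Num.conj (pairing y x).
Proof.
move=> hx hy; have /cvgC_parts := cvg_pairing hy hx.
rewrite -/(pairing y x); move: (pairing y x) => l [hr hi].
rewrite (_ : Num.conj l = Re l +i* - Im l); last by case: (l).
apply: limC_eq; apply: cvgC => /=.
  rewrite [X in X @ _ --> _](_ : _ = fun n => Re (series (fun k => dot (y k) (x k)) n)).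
    exact: hr.
  apply/funext => n; rewrite !series_re /series /=.
  by apply: eq_bigr => i _; rewrite dotC cReJ.
rewrite [X in X @ _ --> _](_ : _ = fun n => - Im (series (fun k => dot (y k) (x k)) n)).
  exact: cvgN hi.
apply/funext => n; rewrite !series_im /series /= -sumrN.
by apply: eq_bigr => i _; rewrite /= dotC cImJ.
Qed.

End SquareSum.

(** * The Hilbert space of square-summable sequences *)

Section SquareSummableSpace.
Variables (R : realType) (V : lmodType R[i]) (dot : {dot V for Num.conj}).
Local Notation Re := (@complex.Re R).
Local Notation nsq := (sqnorm_sum dot).

(** Square-summable sequences form a vector space with an inner product, so that
    [riesz_range] applies to it. *)
Definition is_l2 (x : nat -> V) : bool := `[< (nsq x < +oo)%E >].

Record l2 := L2 { l2_fun :> nat -> V; l2P : is_l2 l2_fun }.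

HB.instance Definition _ := [isSub for l2_fun].
HB.instance Definition _ := [Choice of l2 by <:].

Lemma is_l2_submod : submod_closed is_l2.
Proof.
split=> [|c x y /asboolP hx /asboolP hy]; apply/asboolP.
  by rewrite [X in nsq X](_ : _ = fun=> 0) ?nsq0.
by have := nsqD_fin (nsqZ_fin c hx) hy.
Qed.

HB.instance Definition _ :=
  GRing.isSubmodClosed.Build R[i] (nat -> V) is_l2 is_l2_submod.
HB.instance Definition _ := [SubChoice_isSubLmodule of l2 by <:].

Lemma l2_fin (x : l2) : (nsq x < +oo)%E.
Proof. by apply/asboolP; exact: l2P. Qed.

Lemma l2_eq (x y : l2) : (forall n, x n = y n) -> x = y.
Proof. by move=> h; apply: val_inj; apply/funext. Qed.

Definition l2_dot (x y : l2) : R[i] := pairing dot x y.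

Lemma l2_dotC x y : l2_dot x y = Num.conj (l2_dot y x).
Proof. by apply: pairingC; exact: l2_fin. Qed.

Lemma l2_dotPl (a : R[i]) (x y z : l2) :
  l2_dot (a *: x + y) z = a * l2_dot x z + l2_dot y z.
Proof.
have hx := l2_fin x; have hy := l2_fin y; have hz := l2_fin z.
rewrite /l2_dot -(pairingZl a hx hz) -(pairingDl (nsqZ_fin a hx) hy hz).
by [].
Qed.

Lemma l2_dot_bilinear :
  bilinear_for ( *%R : GRing.Scale.law _ _) (Num.conj \; *%R : GRing.Scale.law _ _) l2_dot.
Proof.
split=> [z a x y|z a x y]; first exact: l2_dotPl.
rewrite l2_dotC l2_dotPl rmorphD rmorphM /= -(l2_dotC z y).
by congr (_ * _ + _); rewrite -l2_dotC.
Qed.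

HB.instance Definition _ :=
  bilinear_isBilinear.Build R[i] l2 l2 R[i] _ _ l2_dot l2_dot_bilinear.

Lemma l2_dot_hermitian x y : l2_dot x y = (-1) ^+ false * Num.conj (l2_dot y x).
Proof. by rewrite expr0 mul1r; exact: l2_dotC. Qed.

HB.instance Definition _ :=
  isHermitianSesquilinear.Build R[i] l2 false Num.conj l2_dot l2_dot_hermitian.

Lemma l2_dot_gt0 x : x != 0 -> 0 < l2_dot x x.
Proof.
move=> x0; rewrite /l2_dot pairing_sq ?l2_fin // ltcR.
rewrite lt_def fine_ge0 ?nsq_ge0 // andbT; apply: contra_neq x0 => h.
apply: l2_eq => n; apply: (@sq_eq0 _ _ dot); apply/eqP.
rewrite eq_le sq_ge0 andbT -lee_fin; apply: le_trans (sq_le_nsq _ _ _) _.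
have [M hM] := nsq_fin_ex (l2_fin x).
by move: h; rewrite hM /= => ->.
Qed.

HB.instance Definition _ := isDotProduct.Build R[i] l2 l2_dot l2_dot_gt0.

Definition l2_form : {dot l2 for Num.conj} := l2_dot.

Lemma l2_formE (x y : l2) : l2_form x y = pairing dot x y. Proof. by []. Qed.

Lemma sq_l2 (x : l2) : (sqnorm l2_form x)%:E = nsq x.
Proof.
rewrite -[sqnorm _ _]/(Re (pairing dot x x)) pairing_sq ?l2_fin //=.
by have [M ->] := nsq_fin_ex (l2_fin x).
Qed.

Lemma sq_l2_leP (x : l2) (M : R) :
  sqnorm l2_form x <= M <-> forall N, \sum_(0 <= n < N) sqnorm dot (x n) <= M.
Proof. by rewrite -nsq_leP -lee_fin sq_l2. Qed.

Lemma sq_le_l2 (x : l2) n : sqnorm dot (x n) <= sqnorm l2_form x.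
Proof. by rewrite -lee_fin sq_l2; exact: sq_le_nsq. Qed.

Definition l2_of (x : nat -> V) (hx : (nsq x < +oo)%E) : l2 :=
  L2 (asboolT hx).

Hypothesis Vcomplete : dot_complete dot.

(** The limit is taken entrywise; finitely many entries at a time pass to the
    limit in the Cauchy estimate, and the bound does not depend on how many. *)
Theorem l2_complete : dot_complete l2_form.
Proof.
move=> u uC.
have /choice[l lP] k : exists l, dot_cvg dot (fun n => u n k) l.
  apply: Vcomplete => e e0; have [N NP] := uC e e0; exists N => m n Nm Nn.
  exact: le_lt_trans (sq_le_l2 (u m - u n) k) (NP m n Nm Nn).
have fin (K : nat) (e : R) : 0 < e -> exists N : nat, forall n, (N <= n)%N ->
    \sum_(0 <= k < K) sqnorm dot (u n k - l k) <= e.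
  move=> e0; elim: K => [|K IH] in e e0 *.
    by exists 0%N => n _; rewrite big_geq // ltW.
  have [|N NP] := IH (e / 2); first by rewrite divr_gt0.
  have [|N' N'P] := lP K (e / 2); first by rewrite divr_gt0.
  exists (maxn N N') => n; rewrite geq_max => /andP[/NP h1 /N'P h2].
  by rewrite big_nat_recr //=; lra.
have key (e : R) : 0 < e -> exists N : nat, forall n, (N <= n)%N -> forall K,
    \sum_(0 <= k < K) sqnorm dot (u n k - l k) <= e.
  move=> e0; have [|N NP] := uC (e / 4); first by rewrite divr_gt0.
  exists N => n Nn K; have [|N' N'P] := fin K (e / 4); first by rewrite divr_gt0.
  pose m := maxn N N'.
  have h1 := N'P m (leq_maxr _ _); have h2 := NP n m Nn (leq_maxl _ _).
  have h3 := (sq_l2_leP (u n - u m) _).1 (ltW h2) K.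
  apply: (@le_trans _ _ (\sum_(0 <= k < K) (2 * sqnorm dot ((u n - u m) k)
     + 2 * sqnorm dot (u m k - l k)))).
    apply: ler_sum => k _; rewrite -(subrK (u m k) (u n k)) -addrA.
    exact: sqD_le.
  by rewrite big_split /= -!mulr_sumr; lra.
have [N0 N0P] := key 1 ltr01.
have hl : (nsq (fun k => (u N0 k - l k)%R) < +oo)%E.
  by apply: (@le_lt_trans _ _ 1%:E); rewrite ?ltry //; apply/nsq_leP => K; exact: N0P.
pose d := l2_of hl; exists (u N0 - d) => e e0.
have [|N NP] := key (e / 2); first by rewrite divr_gt0.
exists N => n Nn; apply: (@le_lt_trans _ _ (e / 2)); last by lra.
apply/sq_l2_leP => K; have := NP n Nn K; congr (_ <= _).
apply: eq_bigr => k _; congr (sqnorm _ _).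
by rewrite /= !fctE subKr.
Qed.

End SquareSummableSpace.

(** * Bounded operators on a Hilbert space *)

Section HilbertSpace.
Variables (R : realType) (H : completeNormedModType R[i]) (dot : {dot H for Num.conj}).
Hypothesis inner : inner_product_of dot.
Local Notation sq := (sqnorm dot).
Implicit Types (x y : H) (A B : 'B(H)).

Lemma norm_sq x : `|x| = (Num.sqrt (sq x))%:C.
Proof.
have h : `|x| ^+ 2 = ((Num.sqrt (sq x))%:C) ^+ 2.
  by rewrite inner sqE -rmorphXn /= sqr_sqrtr ?sq_ge0.
apply/eqP; rewrite -(eqrXn2 (n := 2)) ?h //.
by rewrite ler0c sqrtr_ge0.
Qed.

Lemma norm_lt_sq x (r : R) : 0 < r -> (`|x| < r%:C) = (sq x < r ^+ 2).
Proof.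
move=> r0; rewrite norm_sq ltcR -[in LHS](ger0_norm (ltW r0)) -sqrtr_sqr.
by rewrite ltr_sqrt // exprn_gt0.
Qed.

Lemma cvg_sqP (T : Type) (F : set_system T) (FF : Filter F) (f : T -> H) (l : H) :
  (f x @[x --> F] --> l) <-> (sq (f x - l) @[x --> F] --> (0 : R)).
Proof.
split=> [/cvgrPdist_lt h|/cvgrPdist_lt h]; apply/cvgrPdist_lt => e.
  move=> e0; have se : 0 < Num.sqrt e by rewrite sqrtr_gt0.
  have := h (Num.sqrt e)%:C; rewrite ltcR => /(_ se); apply: filterS => x.
  rewrite norm_lt_sq // sqr_sqrtr ?ltW // => hx.
  by rewrite sub0r normrN ger0_norm ?sq_ge0 // sqBC.
move=> /gt0_realE[]; move: (complex.Re e) => r -> {e} r0.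
have := h (r ^+ 2) (exprn_gt0 2 r0); apply: filterS => x.
by rewrite sub0r normrN ger0_norm ?sq_ge0 // norm_lt_sq // sqBC.
Qed.

Lemma hilbert_complete : dot_complete dot.
Proof.
move=> u uC.
have : cvg (u @ \oo).
  apply: cauchy_cvg; apply: cauchy_exP => e /gt0_realE[].
  move: (complex.Re e) => r -> {e} r0.
  have [N NP] := uC (r ^+ 2) (exprn_gt0 2 r0).
  exists (u N); exists N => // n /= Nn.
  by rewrite -ball_normE /= norm_lt_sq //; exact: NP.
move=> /cvg_ex[l /cvg_sqP/cvgrPdist_lt ul]; exists l => e e0.
have [N _ NP] := ul e e0; exists N => n Nn.
by have := NP n Nn; rewrite sub0r normrN ger0_norm ?sq_ge0.
Qed.

Lemma op_linear A : linear A.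
Proof. by have /asboolP[] := bounded_opP A. Qed.
Lemma op_continuous A : continuous A.
Proof. by have /asboolP[] := bounded_opP A. Qed.
Lemma op0 A : A 0 = 0.
Proof. by have := op_linear A (-1) 0 0; rewrite scaler0 addr0 scaleN1r addNr. Qed.
Lemma opD A x y : A (x + y) = A x + A y.
Proof. by have := op_linear A 1 x y; rewrite !scale1r. Qed.
Lemma opZ A c x : A (c *: x) = c *: A x.
Proof. by have := op_linear A c x 0; rewrite !addr0 op0 addr0. Qed.
Lemma opN A x : A (- x) = - A x.
Proof. by rewrite -scaleN1r opZ scaleN1r. Qed.
Lemma opB A x y : A (x - y) = A x - A y.
Proof. by rewrite opD opN. Qed.
Lemma op_sum A (I : Type) (s : seq I) (P : pred I) (F : I -> H) :
  A (\sum_(i <- s | P i) F i) = \sum_(i <- s | P i) A (F i).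
Proof. exact: (big_morph _ (opD A) (op0 A)). Qed.

Lemma op_eq A B : (forall x, A x = B x) -> A = B.
Proof. by move=> h; apply: val_inj; apply/funext. Qed.
Lemma op_addE A B x : (A + B) x = A x + B x. Proof. by []. Qed.
Lemma op_subE A B x : (A - B) x = A x - B x. Proof. by []. Qed.
Lemma op_scaleE c A x : (c *: A) x = c *: A x. Proof. by []. Qed.

(** Continuity at 0 gives a bound on a ball, and homogeneity spreads it. *)
Lemma op_bound A : exists2 M : R, 0 < M & forall x, sq (A x) <= M * sq x.
Proof.
have /cvg_sqP/cvgrPdist_lt/(_ 1 ltr01) := @op_continuous A 0.
rewrite nearE => /nbhs_ballP[e /gt0_realE[]].
move: (complex.Re e) => r -> {e} r0 hb.
have hr x : sq x < r ^+ 2 -> sq (A x) < 1.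
  move=> hx; have := hb x; rewrite -ball_normE /= sub0r normrN norm_lt_sq //.
  by move=> /(_ hx); rewrite op0 subr0 sub0r normrN ger0_norm ?sq_ge0.
have r2 := exprn_gt0 2 r0.
exists (2 / r ^+ 2) => [|x]; first by rewrite divr_gt0.
have [/sq_eq0 ->|x0] := eqVneq (sq x) 0; first by rewrite op0 sq0 mulr0.
have xp : 0 < sq x by rewrite lt_def x0 sq_ge0.
pose c := Num.sqrt (r ^+ 2 / 2 / sq x).
have c2 : c ^+ 2 = r ^+ 2 / 2 / sq x by rewrite sqr_sqrtr // !divr_ge0 // ltW.
have := hr (c%:C *: x); rewrite opZ !sqZ normsq_real c2.
rewrite divfK //; have -> : r ^+ 2 / 2 < r ^+ 2 by lra.
move=> /(_ isT) h; rewrite -subr_ge0 -(pmulr_rge0 _ (_ : 0 < r ^+ 2 / 2 / sq x)).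
  rewrite mulrBr subr_ge0; apply: ltW; apply: lt_le_trans h _.
  rewrite le_eqVlt; apply/orP; left; apply/eqP; field.
  by rewrite x0 gt_eqF.
by rewrite !divr_gt0.
Qed.

Lemma op_of (f : H -> H) (M : R) : linear f -> (forall x, sq (f x) <= M * sq x) ->
  exists A : 'B(H), forall x, A x = f x.
Proof.
move=> fL fM; suff fP : is_bounded_op f by exists (BoundedOp fP).
apply/asboolP; split=> // x; apply/cvg_sqP.
have fB y : f y - f x = f (y - x).
  by have := fL (-1) x y; rewrite !scaleN1r ![- _ + _]addrC.
have h : sq (y - x) @[y --> x] --> (0 : R) by apply/cvg_sqP; exact: cvg_id.
apply: (@squeeze_cvgr _ _ _ _ (fun=> 0) (fun y => M * sq (y - x))).
- by near=> y; rewrite sq_ge0 fB fM.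
- exact: cvg_cst.
- by rewrite -[X in _ --> X](mulr0 M); apply: cvgM => //; exact: cvg_cst.
Unshelve. all: by end_near. Qed.

Lemma op_comp_ex A B : exists C : 'B(H), forall x, C x = A (B x).
Proof.
have [M M0 hM] := op_bound A; have [N N0 hN] := op_bound B.
apply: (@op_of (A \o B) (M * N)) => [c x y|x] /=; first by rewrite !(opD, opZ).
rewrite -mulrA; apply: le_trans (hM _) _.
by rewrite ler_wpM2l // ltW.
Qed.

Lemma nsq_op A (xi : nat -> H) : (sqnorm_sum dot xi < +oo)%E ->
  (sqnorm_sum dot (fun n => A (xi n)) < +oo)%E.
Proof.
move=> h; have [M M0 hM] := op_bound A.
apply: (@le_lt_trans _ _ (M%:E * sqnorm_sum dot xi)%E).
  by apply: nsq_le_sq => [|n]; [exact: ltW|exact: hM].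
by rewrite lte_mul_pinfty // lee_fin ltW.
Qed.

(** Riesz representation in the second variable; the resulting map is linear
    and bounded. *)
Lemma op_of_form (g : H -> H -> R[i]) (K : R) :
  (forall a x y z, g (a *: x + y) z = a * g x z + g y z) ->
  (forall a x y z, g z (a *: x + y) = Num.conj a * g z x + g z y) ->
  (forall x y, normsq (g x y) <= K * (sq x * sq y)) ->
  exists A : 'B(H), forall x y, dot (A x) y = g x y.
Proof.
move=> gl gr gK.
have /choice[f fP] x : exists w, forall y, dot w y = g x y.
  have [||| c u v|y _|w [hw _]] := @riesz_range R H dot H setT id
    (fun y => Num.conj (g x y)) (K * sq x) hilbert_complete.
  - by [].
  - by [].
  - by [].
  - by rewrite gr rmorphD rmorphM /= conjCK.
  - by rewrite normsq_conj -mulrA; exact: gK.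
  by exists w => y; rewrite dotC -(hw y I) conjCK.
have fL : linear f.
  move=> a x y; apply: (dot_inj (dot := dot)) => z.
  by rewrite dotC [RHS]dotC dotDl dotZl !fP gl.
have [A hA] : exists A : 'B(H), forall x, A x = f x.
  apply: (@op_of f (`|K| + 1)) => // x.
  have := gK x (f x); rewrite -fP sqE normsq_real expr2 mulrCA mulrA.
  have [->|n0] := eqVneq (sq (f x)) 0.
    by rewrite mulr_ge0 ?sq_ge0 // addr_ge0.
  rewrite ler_pM2r ?lt_def ?n0 ?sq_ge0 // => h; apply: le_trans h _.
  rewrite mulrC ler_wpM2r ?sq_ge0 //; have := ler_norm K; lra.
by exists A => x y; rewrite hA fP.
Qed.

(** The Cauchy-Schwarz inequality of the space of square-summable sequences. *)
Lemma pairing_norm_le (xi eta : nat -> H) :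
  (sqnorm_sum dot xi < +oo)%E -> (sqnorm_sum dot eta < +oo)%E ->
  ((normsq (pairing dot xi eta))%:E <= sqnorm_sum dot xi * sqnorm_sum dot eta)%E.
Proof.
move=> h1 h2; have := cauchy_schwarz (l2_form dot) (l2_of h1) (l2_of h2).
by rewrite -lee_fin EFinM !sq_l2.
Qed.

End HilbertSpace.

(** * Ultrastrong density of self-adjoint algebras with trivial commutant *)

Section Density.
Variables (R : realType) (H : completeNormedModType R[i]) (dot : {dot H for Num.conj}).
Hypothesis inner : inner_product_of dot.
Local Notation L := (l2 dot).
Local Notation l2d := (l2_form dot).
Local Notation sqL := (sqnorm l2d).
Local Notation sq := (sqnorm dot).
Local Notation nsq := (sqnorm_sum dot).

(** The diagonal action of A on sequences: an approximation of A on the single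
    vector Xi for this action is an approximation on all the Xi_n at once. *)
Definition amplify (A : 'B(H)) (x : L) : L := l2_of (nsq_op inner A (l2_fin x)).

Lemma amplifyE A x n : amplify A x n = A (x n). Proof. by []. Qed.

Lemma amplify_linear A : linear (amplify A).
Proof. by move=> a x y; apply: l2_eq => n; rewrite /= !fctE op_linear. Qed.

Lemma amplifyB A x y : amplify A (x - y) = amplify A x - amplify A y.
Proof. by apply: l2_eq => n; rewrite /= !fctE opB. Qed.

Lemma amplify_bound A : exists2 M : R, 0 < M & forall x, sqL (amplify A x) <= M * sqL x.
Proof.
have [M M0 hM] := op_bound inner A; exists M => // x.
rewrite -lee_fin EFinM !sq_l2.
by apply: nsq_le_sq => [|n]; [exact: ltW|exact: hM].
Qed.

Lemma amplify_adj (A A' : 'B(H)) : (forall x y, dot (A x) y = dot x (A' y)) ->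
  forall x y, l2d (amplify A x) y = l2d x (amplify A' y).
Proof.
move=> h x y; rewrite !l2_formE /pairing.
rewrite (_ : (fun n => dot (amplify A x n) (y n)) = (fun n => dot (x n) (amplify A' y n))) //.
by apply/funext => n; exact: h.
Qed.

Lemma at_fin (j : nat) (v : H) : (nsq (fun n => if n == j then v else 0%R) <= (sq v)%:E)%E.
Proof.
apply/nsq_leP => N; have [jN|Nj] := ltnP j N; last first.
  rewrite big_nat big1 ?sq_ge0 // => n /andP[_ nN].
  by rewrite ltn_eqF ?sq0 // (leq_trans nN).
rewrite (bigD1_seq j) //= ?mem_index_iota ?iota_uniq // eqxx big1 ?addr0 //.
by move=> n /negbTE ->; rewrite sq0.
Qed.

Definition at_index (j : nat) (v : H) : L :=
  l2_of (le_lt_trans (at_fin j v) (ltry _)).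

Lemma sq_at_index j v : sqL (at_index j v) <= sq v.
Proof. by rewrite -lee_fin sq_l2; exact: at_fin. Qed.

Lemma at_index_linear j : linear (at_index j).
Proof.
move=> a x y; apply: l2_eq => n; rewrite /= !fctE /=.
by case: (n == j) => //; rewrite scaler0 addr0.
Qed.

Lemma tail_fin (N : nat) (x : L) : (nsq (fun n => if (n < N)%N then 0%R else x n) < +oo)%E.
Proof.
apply: le_lt_trans (l2_fin x); apply: lee_nneseries => n _; rewrite ?lee_fin ?sq_ge0 //.
by case: ifP; rewrite ?sq0 ?sq_ge0.
Qed.

Definition tail (N : nat) (x : L) : L := l2_of (tail_fin N x).

Lemma tail_cvg (x : L) (e : R) : 0 < e -> exists N, sqL (tail N x) < e.
Proof.
move=> e0; have s0 n : (0 <= (sq (x n))%:E)%E by rewrite lee_fin sq_ge0.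
have /fine_cvgP[_ /cvgrPdist_lt/(_ e e0)[N _ /(_ N (leqnn N))]] :=
  nneseries_tail_cvg (P := xpredT) (l2_fin x) (fun n _ => s0 n).
rewrite /= sub0r normrN => h; exists N.
rewrite -lte_fin sq_l2.
have -> : nsq (tail N x) = (\sum_(N <= n <oo) (sq (x n))%:E)%E.
  rewrite /sqnorm_sum (@nneseries_split _ _ 0%N N) => [|k _]; last by rewrite lee_fin sq_ge0.
  rewrite add0n big_nat big1 => [|k /andP[_ kN]]; last by rewrite /= kN sq0.
  rewrite add0e eseries_cond [RHS]eseries_cond; apply: eq_eseriesr => k /andP[_].
  by rewrite /= ltnNge => ->.
have t0 : (0 <= \sum_(N <= n <oo) (sq (x n))%:E)%E by apply: nneseries_ge0.
have tf : (\sum_(N <= n <oo) (sq (x n))%:E < +oo)%E.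
  apply: le_lt_trans (l2_fin x).
  rewrite /sqnorm_sum (@nneseries_split _ _ 0%N N) // add0n leeDr //.
  by apply: sume_ge0.
rewrite ger0_norm ?fine_ge0 // in h.
by rewrite -(@fineK _ (\sum_(N <= n <oo) _)%E) ?lte_fin // ge0_fin_numE.
Qed.

Lemma tail0 x : tail 0 x = x.
Proof. exact: l2_eq. Qed.

Lemma tail_step N x : tail N x = at_index N (x N) + tail N.+1 x.
Proof.
apply: l2_eq => n; rewrite /= !fctE /= ltnS.
by case: ltngtP => [nN|nN|->]; rewrite ?add0r ?addr0.
Qed.

Section Projection.
Variables (S : set 'B(H)) (Xi : L).
Hypothesis S1 : S one_op.
Hypothesis SL : forall a A B, S A -> S B -> S (a *: A + B).
Hypothesis SM : forall A B C : 'B(H), S A -> S B -> (forall x, C x = A (B x)) -> S C.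
Hypothesis Sadj : forall A, S A ->
  exists2 A' : 'B(H), S A' & forall x y, dot (A x) y = dot x (A' y).
Hypothesis Sirr : forall T : 'B(H), (forall A, S A -> forall x, T (A x) = A (T x)) ->
  exists c : R[i], T = c *: one_op.

(** The closure of the cyclic subspace S Xi; orth is its complement. *)
Let cl (w : L) := forall e : R, 0 < e -> exists2 B, S B & sqL (amplify B Xi - w) < e.
Let orth (d : L) := forall B, S B -> l2d (amplify B Xi) d = 0.

Let amplifyPE a A B : amplify (a *: A + B) Xi = a *: amplify A Xi + amplify B Xi.
Proof. exact: l2_eq. Qed.

Let clP a w w' : cl w -> cl w' -> cl (a *: w + w').
Proof.
move=> h h' e e0; have c0 : 0 < 2 * (normsq a + 1).
  by rewrite mulr_gt0 // ltr_wpDl ?normsq_ge0.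
have [|B SB hB] := h (e / 2 / (2 * (normsq a + 1))); first by rewrite !divr_gt0.
have [|B' SB' hB'] := h' (e / 4); first by rewrite divr_gt0.
exists (a *: B + B'); first exact: SL.
rewrite amplifyPE opprD addrACA -scalerBr; apply: le_lt_trans (sqD_le _ _ _) _.
rewrite sqZ; move: hB; rewrite ltr_pdivlMr // => hB.
have := sq_ge0 l2d (amplify B Xi - w); have := normsq_ge0 a.
by move: (sqL _) (normsq a) hB hB' => p q hB hB' q0 p0; nra.
Qed.

Let orth_cl d w : orth d -> cl w -> l2d w d = 0.
Proof.
move=> od cw; apply: normsq_eq0; apply/eqP; rewrite eq_le normsq_ge0 andbT.
rewrite leNgt; apply/negP => n0.
have p0 : 0 < sqL d + 1 by rewrite ltr_wpDl ?sq_ge0.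
have [|B SB hB] := cw (normsq (l2d w d) / (sqL d + 1)); first by rewrite divr_gt0.
have := cauchy_schwarz l2d (amplify B Xi - w) d.
rewrite dotBl od // sub0r normsqN => cs.
move: hB; rewrite ltr_pdivlMr // => hB; have := sq_ge0 l2d (amplify B Xi - w).
by have := sq_ge0 l2d d; nra.
Qed.

Let orth_eq w w' : cl w -> cl w' -> orth (w - w') -> w = w'.
Proof.
move=> cw cw' o; apply/eqP; rewrite -subr_eq0; apply/eqP.
apply: (@sq_eq0 _ _ l2d); rewrite /sqnorm (orth_cl o) //.
by rewrite addrC -scaleN1r; exact: clP.
Qed.

Let projection v : exists w, cl w /\ orth (v - w).
Proof.
have [|||||w [hw cw]] := @riesz_range R L l2d 'B(H) S (fun B => amplify B Xi)
    (fun B => l2d (amplify B Xi) v) (sqL v) (l2_complete (hilbert_complete inner)).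
- by have := SL (-1) S1 S1; rewrite scaleN1r addNr.
- exact: SL.
- by move=> a A B; exact: amplifyPE.
- by move=> a A B; rewrite amplifyPE dotDl dotZl.
- by move=> B _; rewrite mulrC; exact: cauchy_schwarz.
by exists w; split=> [//|B SB]; rewrite dotBr hw // subrr.
Qed.

(** Let P be the projection onto the closure of S Xi.  This subspace and its
    complement are stable under the amplifications of S, so P commutes with
    them; the matrix entries of P then commute with S and are scalars.  Hence P
    commutes with the amplification of every A, and A Xi = A P Xi = P A Xi lies
    in the closure of S Xi. *)
Theorem ultrastrong_density (A : 'B(H)) (e : R) : 0 < e ->
  exists2 B, S B & (nsq (fun n => (B - A)%R (Xi n)) < e%:E)%E.
Proof.
have /choice[P PP] := projection.
have Pcl v : cl (P v) by have [] := PP v.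
have Porth v : orth (v - P v) by have [] := PP v.
have Puniq v w : cl w -> orth (v - w) -> P v = w.
  move=> cw ow; apply: orth_eq => // B SB.
  have -> : P v - w = (v - w) - (v - P v) by rewrite opprB [RHS]addrC subrKA.
  by rewrite dotBr ow // Porth // subrr.
have PL a v w : P (a *: v + w) = a *: P v + P w.
  apply: Puniq => [|B SB]; first exact: clP.
  rewrite opprD addrACA -scalerBr dotDr dotZr.
  by rewrite Porth // Porth // mulr0 addr0.
have P0 : P 0 = 0.
  by have := PL (-1) 0 0; rewrite scaler0 addr0 scaleN1r addNr.
have PD v w : P (v + w) = P v + P w by have := PL 1 v w; rewrite !scale1r.
have Pcontr v : sqL (P v) <= sqL v.
  have o : l2d (P v) (v - P v) = 0 by apply: orth_cl.
  have -> : sqL v = sqL (P v) + sqL (v - P v).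
    by rewrite -[in LHS](subrK (P v) v) addrC sqD o /= mulr0 addr0.
  by rewrite lerDl sq_ge0.
have amplify_cl B w : S B -> cl w -> cl (amplify B w).
  move=> SB cw d d0; have [M M0 hM] := amplify_bound B.
  have [|C SC hC] := cw (d / M); first by rewrite divr_gt0.
  have [D hD] := op_comp_ex inner B C.
  exists D; first exact: SM SB SC hD.
  have -> : amplify D Xi = amplify B (amplify C Xi) by apply: l2_eq => n; exact: hD.
  rewrite -amplifyB; apply: le_lt_trans (hM _) _.
  by rewrite mulrC -ltr_pdivlMr.
have Pcomm B v : S B -> P (amplify B v) = amplify B (P v).
  move=> SB; apply: Puniq => [|C SC]; first exact: amplify_cl.
  have [B' SB' adj] := Sadj SB.
  have [D hD] := op_comp_ex inner B' C.
  have SD : S D by exact: SM SB' SC hD.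
  rewrite -amplifyB dotC (amplify_adj adj) -dotC -(Porth v D SD).
  by congr (l2d _ _); apply: l2_eq => n; rewrite !amplifyE hD.
(* the matrix entries of P commute with S, hence are scalars *)
have entry i j : exists c : R[i], forall x, P (at_index j x) i = c *: x.
  have [|x|T hT] := @op_of R H dot inner (fun x => P (at_index j x) i) 1.
  - by move=> a x y; rewrite at_index_linear PL.
  - rewrite mul1r; apply: le_trans (sq_le_l2 _ _) _.
    exact: le_trans (Pcontr _) (sq_at_index _ _).
  have [|c cT] := Sirr (T := T).
    move=> B SB x; rewrite !hT -amplifyE -Pcomm //; congr (P _ _).
    by apply: l2_eq => n /=; case: ifP; rewrite ?op0.
  by exists c => x; rewrite -hT cT.
have Pat j x : P (amplify A (at_index j x)) = amplify A (P (at_index j x)).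
  have -> : amplify A (at_index j x) = at_index j (A x).
    by apply: l2_eq => n /=; case: ifP; rewrite ?op0.
  apply: l2_eq => i; have [c hc] := entry i j.
  by rewrite amplifyE !hc opZ.
(* the commutator of P and A vanishes on sequences concentrated at one index,
   hence depends only on arbitrarily far tails, and these tend to 0 *)
pose D v := P (amplify A v) - amplify A (P v).
have DD v w : D (v + w) = D v + D w.
  rewrite /D -[v]scale1r amplify_linear PL PL amplify_linear !scale1r.
  by rewrite opprD addrACA.
have Dtail v N : D v = D (tail N v).
  elim: N => [|N ->]; first by rewrite tail0.
  by rewrite tail_step DD {1}/D Pat subrr add0r.
have [M M0 hM] := amplify_bound A.
have Dbound v : sqL (D v) <= 4 * M * sqL v.
  apply: le_trans (sqB_le _ _ _) _.
  have := hM (P v); have := Pcontr (amplify A v); have := hM v; have := Pcontr v.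
  by move: (sqL _) (sqL _) (sqL _) (sqL _) (sqL _) => p q r t u; nra.
have D0 v : D v = 0.
  apply: (@sq_eq0 _ _ l2d); apply/eqP; rewrite eq_le sq_ge0 andbT leNgt.
  apply/negP => n0; have M4 : 0 < 4 * M by rewrite mulr_gt0.
  have [|N hN] := @tail_cvg v (sqL (D v) / (4 * M)); first by rewrite divr_gt0.
  have := Dbound (tail N v); rewrite -Dtail leNgt => /negP; apply.
  by rewrite mulrC -ltr_pdivlMr.
move=> e0; have PXi : P Xi = Xi.
  apply: Puniq => [d d0|B SB]; last by rewrite subrr dot0r.
  exists one_op => //; have -> : amplify one_op Xi = Xi by exact: l2_eq.
  by rewrite subrr sq0.
have cA : cl (amplify A Xi).
  suff -> : amplify A Xi = P (amplify A Xi) by [].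
  by apply/esym/eqP; rewrite -subr_eq0 -{2}PXi; apply/eqP; exact: D0.
have [B SB hB] := cA e e0; exists B => //.
by move: hB; rewrite -lte_fin sq_l2.
Qed.

End Projection.
End Density.

(** * Initial and pointwise topologies *)

Section TopologyGeneration.

Lemma cvg_initial (S : choiceType) (T : topologicalType) (f : S -> T) (Z : Type)
    (F : set_system Z) (FF : Filter F) (g : Z -> S) (s : S) :
  f (g z) @[z --> F] --> f s ->
  (g z : initial_topology f) @[z --> F] --> (s : initial_topology f).
Proof.
move=> h A /=; rewrite nbhsE => -[B [[C oC <-] Cs] BA].
have FC : F (fun z => C (f (g z))) by apply: h; exact: open_nbhs_nbhs.
by apply: filterS FC => z; exact: BA.
Qed.

Lemma cvg_ptws (I : Type) (T : topologicalType) (Z : Type) (F : set_system Z)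
    (FF : Filter F) (g : Z -> {ptws I -> T}) (s : {ptws I -> T}) :
  (forall i, g z i @[z --> F] --> s i) -> g z @[z --> F] --> s.
Proof. by move=> h; apply/cvg_sup => i; apply: cvg_initial; exact: h. Qed.

Lemma ptws_eval (I : Type) (T : topologicalType) (i : I) :
  continuous (fun f : {ptws I -> T} => f i).
Proof.
move=> f A Af; have /cvg_sup/(_ i) : f --> f by exact: cvg_id.
apply; exact: (@initial_continuous _ _ (fun f : {ptws I -> T} => f i)).
Qed.

End TopologyGeneration.

(** * Normal functionals and ultrastrong seminorms *)

Section Flatten.

(** One enumeration of the pairs works for all double series, so that a family
    of sequences can be merged into one sequence before the operators that act
    on it are known. *)
Lemma nneseries_flatten (R : realType) :
  exists e : nat -> nat * nat, forall a : nat -> nat -> \bar R,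
    (forall i j, 0 <= a i j)%E ->
    (\sum_(n <oo) a (e n).1 (e n).2 = \sum_(i <oo) \sum_(j <oo) a i j)%E.
Proof.
have /card_set_bijP[e eb] : ([set: nat] #= [set: nat * nat])%card.
  by rewrite card_eq_sym; exact: card_nat2.
exists e => a a0.
rewrite nneseries_esumT // -(reindex_esum setT setT e (fun k => a k.1 k.2)) //.
have -> : [set: nat * nat] = [set: nat] `*`` (fun=> [set: nat]) by apply/seteqP; split.
rewrite -(@esum_esum _ _ _ setT (fun=> setT)) //.
rewrite nneseries_esumT; last by move=> i; exact: nneseries_ge0.
by apply: eq_esum => i _; rewrite nneseries_esumT.
Qed.

End Flatten.

Section NormalFunctionals.
Variables (R : realType) (H : completeNormedModType R[i]) (dot : {dot H for Num.conj}).
Hypothesis inner : inner_product_of dot.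
Local Notation sq := (sqnorm dot).
Local Notation nsq := (sqnorm_sum dot).

Lemma square_summableP (xi : nat -> H) : square_summable xi <-> (nsq xi < +oo)%E.
Proof.
have E n : `|xi n| ^+ 2 = (sq (xi n))%:C by rewrite inner sqE.
rewrite nneseries_finP => [|n]; last exact: sq_ge0.
rewrite /square_summable; split=> [/cvg_ex[l] /cvgC_parts[h _]|h].
  apply: (cvgP (complex.Re l)); rewrite [X in X @ _](_ : _ = (fun n =>
    complex.Re (series (fun k => `|xi k| ^+ 2) n))); first exact: h.
  by apply/funext => n; rewrite series_re /series /=; apply: eq_bigr => i _; rewrite E.
apply: cvgC_series.
  rewrite [X in series X](_ : _ = (fun n => sq (xi n))) //.
  by apply/funext => n; rewrite /= E.
rewrite [X in series X](_ : _ = (fun=> 0)).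
  rewrite [series _](_ : _ = cst 0); first exact: is_cvg_cst.
  by apply/funext => n; rewrite /series /= big1.
by apply/funext => n; rewrite /= E.
Qed.

Definition predual_pair (xi eta : nat -> H) (h : (nsq xi < +oo)%E)
    (h' : (nsq eta < +oo)%E) : predual_index H :=
  exist _ (xi, eta) (conj ((square_summableP xi).2 h) ((square_summableP eta).2 h')).

Lemma predual_pairE xi eta h h' A :
  predual_pairing dot A (@predual_pair xi eta h h') = pairing dot (fun n => A (xi n)) eta.
Proof. by []. Qed.

(** Continuity at 0 for the ultrastrong topology, defined by the seminorms
    A |-> (\sum_n |A zeta_n|^2)^(1/2); one seminorm is enough because finitely
    many are dominated by the one of the merged sequence. *)
Definition ultrastrongly_bounded (F : 'B(H) -> R[i]) :=
  exists2 zeta : nat -> H, (nsq zeta < +oo)%E &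
    forall A : 'B(H), (nsq (fun n => A (zeta n)) <= 1)%E -> normsq (F A) <= 1.

Lemma linC (F : 'B(H) -> R[i]) : linear (F : 'B(H) -> R[i]^o) ->
  forall a A B, F (a *: A + B) = a * F A + F B.
Proof. by move=> h a A B; exact: h. Qed.

Lemma linCB (F : 'B(H) -> R[i]) : linear (F : 'B(H) -> R[i]^o) ->
  forall A B, F (A - B) = F A - F B.
Proof.
move=> /linC h A B; have := h (-1) B A.
by rewrite scaleN1r addrC mulN1r [- _ + _]addrC.
Qed.

Lemma linC0 (F : 'B(H) -> R[i]) : linear (F : 'B(H) -> R[i]^o) -> F 0 = 0.
Proof. by move=> /linCB h; rewrite -(subrr 0) h subrr. Qed.

Lemma ultrastrong_bound (F : 'B(H) -> R[i]) (zeta : nat -> H) :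
  linear (F : 'B(H) -> R[i]^o) -> (nsq zeta < +oo)%E ->
  (forall A : 'B(H), (nsq (fun n => A (zeta n)) <= 1)%E -> normsq (F A) <= 1) ->
  forall A : 'B(H), ((normsq (F A))%:E <= nsq (fun n => A (zeta n)))%E.
Proof.
move=> L hz h A; have FL := linC L; have F0 := linC0 L.
have [q hq] := nsq_fin_ex (nsq_op inner A hz).
have q0 : 0 <= q by rewrite -lee_fin -hq nsq_ge0.
rewrite hq lee_fin; apply/ler_addgt0Pr => e e0.
have s0 : 0 < q + e by rewrite ltr_wpDl.
have i0 : 0 <= (q + e)^-1 by rewrite invr_ge0 ltW.
have := h ((Num.sqrt (q + e)^-1)%:C *: A).
have -> : nsq (fun n => ((Num.sqrt (q + e)^-1)%:C *: A) (zeta n)) = ((q + e)^-1 * q)%:E.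
  by rewrite nsqZ hq -EFinM normsq_real sqr_sqrtr.
rewrite lee_fin ler_pdivrMl // mulr1 lerDl ltW // => /(_ isT).
rewrite -[_ *: A]addr0 FL F0 addr0 normsqM normsq_real sqr_sqrtr //.
by rewrite ler_pdivrMl // mulr1.
Qed.

(** The functional factors through A |-> (A zeta_n)_n, so it is the inner product
    of this sequence with a square-summable one, by [riesz_range]. *)
Lemma ultrastrongly_bounded_pairing (F : 'B(H) -> R[i]) :
  linear (F : 'B(H) -> R[i]^o) -> ultrastrongly_bounded F ->
  exists p : predual_index H, forall A, F A = predual_pairing dot A p.
Proof.
move=> FL [zeta hz h]; pose Z : l2 dot := l2_of hz.
have [|||||w [hw _]] := @riesz_range R (l2 dot) (l2_form dot) 'B(H) setT
    (fun A => amplify inner A Z) F 1 (l2_complete (hilbert_complete inner)) => //.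
- by move=> a A B; apply: l2_eq.
- move=> A _; rewrite mul1r -lee_fin sq_l2; exact: ultrastrong_bound.
exists (predual_pair hz (l2_fin w)) => A.
by rewrite (hw A).
Qed.

Lemma predual_normal p : normal_functional dot (fun A => predual_pairing dot A p).
Proof.
move=> A.
have h : continuous (predual_pairing dot : weak_star dot -> {ptws predual_index H -> R[i]^o}).
  exact: initial_continuous.
exact: (continuous_comp (h A) (@ptws_eval _ _ p _)).
Qed.

Lemma cvg_weak_star (Z : Type) (F : set_system Z) (FF : Filter F) (g : Z -> 'B(H))
    (A : 'B(H)) :
  (forall p, predual_pairing dot (g z) p @[z --> F] --> predual_pairing dot A p) ->
  (g z : weak_star dot) @[z --> F] --> (A : weak_star dot).
Proof.
move=> h; apply: (@cvg_initial _ _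
  (predual_pairing dot : 'B(H) -> {ptws predual_index H -> R[i]^o})).
exact: (@cvg_ptws (predual_index H) R[i]^o Z F FF (fun z => predual_pairing dot (g z))).
Qed.

Lemma predual_linear (phi : 'B(H) -> 'B(H)) p : linear phi ->
  linear ((fun A => predual_pairing dot (phi A) p) : 'B(H) -> R[i]^o).
Proof.
move=> phiL; case: p => -[xi eta] [h1 h2] a B C; rewrite phiL /predual_pairing /=.
have f1 := (square_summableP _).1 h1; have f2 := (square_summableP _).1 h2.
have fB := nsq_op inner (phi B) f1; have fC := nsq_op inner (phi C) f1.
have := pairingDl (nsqZ_fin a fB) fC f2.
by rewrite (pairingZl a fB f2).
Qed.

(** The predual pairings of phi A are again predual pairings of A, by
    [ultrastrongly_bounded_pairing]. *)
Lemma normal_mapP (phi : 'B(H) -> 'B(H)) : linear phi ->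
  (forall p, ultrastrongly_bounded (fun A => predual_pairing dot (phi A) p)) ->
  normal_map dot phi.
Proof.
move=> phiL h A.
apply: (cvg_weak_star (F := nbhs (A : weak_star dot)) (nbhs_filter _)) => p.
have [q hq] := ultrastrongly_bounded_pairing (predual_linear p phiL) (h p).
have -> : (fun z => predual_pairing dot (phi z) p) = (fun z => predual_pairing dot z q).
  exact/funext.
by rewrite hq; exact: predual_normal.
Qed.

Lemma normal_comp (rho : 'B(H) -> R[i]) (phi : 'B(H) -> 'B(H)) :
  normal_functional dot rho -> normal_map dot phi ->
  normal_functional dot (fun A => rho (phi A)).
Proof. by move=> hr hp A; exact: (continuous_comp (hp A) (hr (phi A))). Qed.

Lemma nsq_flatten : exists e : nat -> nat * nat, forall Z : nat -> nat -> H,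
  nsq (fun n => Z (e n).1 (e n).2) = (\sum_(k <oo) nsq (Z k))%E.
Proof.
have [e he] := nneseries_flatten R; exists e => Z.
by rewrite -(he (fun k j => (sq (Z k j))%:E)) // => i j; rewrite lee_fin sq_ge0.
Qed.

Let ultrastrong_nbhs : set_system 'B(H) :=
  [set U | exists2 zeta : nat -> H, (nsq zeta < +oo)%E &
    forall A : 'B(H), (nsq (fun n => A (zeta n)) <= 1)%E -> U A].

Let ultrastrong_filter : Filter ultrastrong_nbhs.
Proof.
split.
- by exists (fun=> 0); rewrite ?nsq0.
- move=> U V [x hx hU] [y hy hV]; have [e he] := nsq_flatten.
  pose Z k : nat -> H := if k is 0%N then x else if k is 1%N then y else fun=> 0.
  have ZE (A : 'B(H)) : nsq (fun n => A (Z (e n).1 (e n).2))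
      = (nsq (fun n => A (x n)) + nsq (fun n => A (y n)))%E.
    rewrite (he (fun k j => A (Z k j))) (@nneseries_split _ _ 0%N 2%N); last first.
      by move=> k _; exact: nsq_ge0.
    rewrite add0n eseries0 => [|[|[|k]] // _ _]; last first.
      by rewrite [X in nsq X](_ : _ = fun=> 0) ?nsq0 //; apply/funext => n; rewrite op0.
    by rewrite adde0 big_nat_recr // big_nat1.
  exists (fun n => Z (e n).1 (e n).2) => [|A].
    have := ZE one_op; rewrite /= => ->.
    by rewrite lte_add_pinfty.
  rewrite ZE => hA; split; [apply: hU|apply: hV]; apply: le_trans hA.
    by rewrite leeDl // nsq_ge0.
  by rewrite leeDr // nsq_ge0.
- by move=> U V UV [x hx hU]; exists x => // A /hU; exact: UV.
Qed.

(** The filter of ultrastrong neighbourhoods of 0 converges to 0 in the weak*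
    topology, since |\sum_n <A xi_n, eta_n>|^2 is at most
    \sum_n |A xi_n|^2 \sum_n |eta_n|^2; so a weak*-continuous functional is small
    along it. *)
Lemma normal_ultrastrongly_bounded (rho : 'B(H) -> R[i]) :
  linear (rho : 'B(H) -> R[i]^o) -> normal_functional dot rho ->
  ultrastrongly_bounded rho.
Proof.
move=> /linC0 rho0 rhoN.
have FF := ultrastrong_filter.
have h : (A : weak_star dot) @[A --> ultrastrong_nbhs] --> (0 : weak_star dot).
  apply: cvg_weak_star => -[[xi eta] [h1 h2]].
  have f1 := (square_summableP _).1 h1; have f2 := (square_summableP _).1 h2.
  have -> : predual_pairing dot 0 (exist _ (xi, eta) (conj h1 h2)) = 0.
    exact: pairing0l.
  apply/cvgrPdist_lt => e /gt0_realE[]; move: (complex.Re e) => r -> {e} r0.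
  have [M hM] := nsq_fin_ex f2.
  have M0 : 0 <= M by rewrite -lee_fin -hM nsq_ge0.
  (* c is large enough for the Cauchy-Schwarz bound; M + 1 makes it strict *)
  pose c := Num.sqrt ((M + 1) / r ^+ 2).
  have c2 : c ^+ 2 = (M + 1) / r ^+ 2.
    by rewrite sqr_sqrtr // divr_ge0 ?exprn_ge0 ?addr_ge0 // ltW.
  exists (fun n => c%:C *: xi n) => [|A]; first exact: nsqZ_fin.
  have fA := nsq_op inner A f1; have [q hq] := nsq_fin_ex fA.
  have -> : nsq (fun n => A (c%:C *: xi n)) = (c ^+ 2 * q)%:E.
    rewrite -normsq_real EFinM -hq -nsqZ; congr (nsq _).
    by apply/funext => n; rewrite opZ.
  rewrite c2 lee_fin => hle /=; rewrite sub0r normrN; apply: normr_lt_sq => //.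
  have := pairing_norm_le fA f2; rewrite hq hM -EFinM lee_fin => hp.
  apply: (le_lt_trans hp); have r2 := exprn_gt0 2 r0.
  move: hle; rewrite mulrAC ler_pdivrMr // mul1r.
  have q0 : 0 <= q by rewrite -lee_fin -hq nsq_ge0.
  have [->|qn] := eqVneq q 0; first by rewrite mul0r.
  have : 0 < q by rewrite lt_def qn q0.
  by nra.
have /cvgrPdist_lt/(_ 1 ltr01) : (rho A : R[i]^o) @[A --> ultrastrong_nbhs] --> (rho 0 : R[i]^o).
  exact: (@cvg_comp _ _ _ (fun A => A : weak_star dot) (rho : weak_star dot -> R[i]^o)
    _ _ _ h (rhoN 0)).
rewrite rho0 => -[zeta hz hA]; exists zeta => // A /hA.
rewrite sub0r normrN => /ltW; rewrite -[1]/(1%:C) => /normsq_le.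
by rewrite expr1n.
Qed.

End NormalFunctionals.

(** * Weyl operators *)

Section Phase.
Variable R : realType.

Lemma expi0 : expi (0 : R) = 1.
Proof. by rewrite /expi cos0 sin0. Qed.

Lemma expiD (a b : R) : expi (a + b) = expi a * expi b.
Proof. by rewrite /expi cosD sinD; apply: complex_eq; rewrite /= ?complexP /=; ring. Qed.

Lemma symplecticN (z : R * R) : symplectic z (- z) = 0.
Proof. by rewrite /symplectic /=; ring. Qed.

End Phase.

Section WeylOperators.
Variables (R : realType) (H : completeNormedModType R[i]) (dot : {dot H for Num.conj}).
Variable W : R * R -> 'B(H).
Hypothesis inner : inner_product_of dot.
Hypothesis weyl : weyl_system dot W.
Local Notation sq := (sqnorm dot).
Local Notation nsq := (sqnorm_sum dot).

Lemma weyl_isometry z x y : dot (W z x) (W z y) = dot x y.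
Proof. by have [V [adj VU _]] := weyl_unitary weyl z; rewrite adj VU. Qed.

Lemma weyl_sq z x : sq (W z x) = sq x.
Proof. by rewrite /sqnorm weyl_isometry. Qed.

Lemma weyl0 x : W 0 x = x.
Proof.
have [V [_ VU _]] := weyl_unitary weyl 0.
have := weyl_mul weyl 0 0 x.
have -> : symplectic (0 : R * R) 0 = 0 by rewrite /symplectic /=; ring.
rewrite addr0 expi0 scale1r => h.
by rewrite -[LHS]VU h VU.
Qed.

Lemma weylK z x : W z (W (- z) x) = x.
Proof. by rewrite (weyl_mul weyl) symplecticN expi0 scale1r subrr weyl0. Qed.

Lemma weyl_adj z x y : dot (W z x) y = dot x (W (- z) y).
Proof. by rewrite -{1}(weylK z y) weyl_isometry. Qed.

(** The canonical commutation relation: conjugation by W_u acts on W_z by a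
    character of u, which is what averaging over u exploits. *)
Lemma weyl_conj u z x :
  W u (W z (W (- u) x)) = expi (z.1 * u.2 - u.1 * z.2) *: W z x.
Proof.
rewrite (weyl_mul weyl z) opZ !(weyl_mul weyl u) scalerA.
rewrite -expiD (addrC u) subrK; congr (expi _ *: _).
by rewrite /symplectic /=; field.
Qed.

Definition weyl_span : set 'B(H) :=
  [set A | exists s : seq (R[i] * (R * R)), A = \sum_(p <- s) p.1 *: W p.2].

Lemma weyl_span1 z : weyl_span (W z).
Proof. by exists [:: (1, z)]; rewrite big_seq1 /= scale1r. Qed.

Lemma weyl_spanP a A B : weyl_span A -> weyl_span B -> weyl_span (a *: A + B).
Proof.
move=> [s ->] [t ->]; exists ([seq (a * p.1, p.2) | p <- s] ++ t).
rewrite big_cat big_map scaler_sumr /=; congr (_ + _).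
by apply: eq_bigr => p _; rewrite scalerA.
Qed.

Lemma weyl_span0 : weyl_span 0.
Proof. by exists [::]; rewrite big_nil. Qed.

Lemma weyl_span_sum (I : Type) (s : seq I) (c : I -> R[i]) (F : I -> 'B(H)) :
  (forall i, weyl_span (F i)) -> weyl_span (\sum_(i <- s) c i *: F i).
Proof.
move=> h; elim: s => [|i s IH]; first by rewrite big_nil; exact: weyl_span0.
by rewrite big_cons; exact: weyl_spanP.
Qed.

Lemma op_sumE (I : Type) (s : seq I) (c : I -> R[i]) (F : I -> 'B(H)) x :
  (\sum_(i <- s) c i *: F i) x = \sum_(i <- s) c i *: F i x.
Proof.
elim: s => [|i s IH]; first by rewrite !big_nil.
by rewrite !big_cons op_addE IH.
Qed.

Lemma weyl_spanM (A B C : 'B(H)) :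
  weyl_span A -> weyl_span B -> (forall x, C x = A (B x)) -> weyl_span C.
Proof.
move=> [s ->] [t ->] CE.
have -> : C = \sum_(p <- s) p.1 *: \sum_(q <- t)
    (q.1 * expi (symplectic p.2 q.2)) *: W (p.2 + q.2).
  apply: op_eq => x; rewrite CE !op_sumE; apply: eq_bigr => p _.
  rewrite !op_sumE op_sum; congr (_ *: _); apply: eq_bigr => q _.
  by rewrite opZ (weyl_mul weyl) scalerA.
apply: weyl_span_sum => p; apply: weyl_span_sum => q; exact: weyl_span1.
Qed.

Lemma weyl_span_adj A : weyl_span A ->
  exists2 A' : 'B(H), weyl_span A' & forall x y, dot (A x) y = dot x (A' y).
Proof.
move=> [s ->]; exists (\sum_(p <- s) Num.conj p.1 *: W (- p.2)).
  by apply: weyl_span_sum => p; exact: weyl_span1.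
move=> x y; rewrite !op_sumE; elim: s => [|p s IH].
  by rewrite !big_nil dot0l dot0r.
by rewrite !big_cons dotDl dotDr IH dotZl dotZr conjCK weyl_adj.
Qed.

Hypothesis irr : irreducible_family W.

(** Irreducibility says that the commutant of the self-adjoint algebra
    [weyl_span] is trivial. *)
Lemma weyl_density (zeta : nat -> H) (A : 'B(H)) (e : R) :
  (nsq zeta < +oo)%E -> 0 < e ->
  exists2 B, weyl_span B & (nsq (fun n => (B - A)%R (zeta n)) < e%:E)%E.
Proof.
move=> hz e0.
apply: (@ultrastrong_density R H dot inner weyl_span (l2_of hz)) => //.
- have -> : one_op = W 0 by apply: op_eq => x; rewrite weyl0.
  exact: weyl_span1.
- exact: weyl_spanP.
- exact: weyl_spanM.
- exact: weyl_span_adj.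
- by move=> T hT; apply: (irr.2) => z xi; apply: hT; exact: weyl_span1.
Qed.

(** As rho vanishes on the span, rho (A) = rho (A - B) for every B of the span;
    the ultrastrong bound on rho and density make the right-hand side small. *)
Theorem normal_functional_eq0 (rho : 'B(H) -> R[i]) :
  linear (rho : 'B(H) -> R[i]^o) -> normal_functional dot rho ->
  (forall z, rho (W z) = 0) -> forall A, rho A = 0.
Proof.
move=> rhoL rhoN rhoW A.
have [zeta hz hb] := normal_ultrastrongly_bounded inner rhoL rhoN.
have rho0 := linC0 rhoL.
have rhoS B : weyl_span B -> rho B = 0.
  move=> [s ->]; elim: s => [|p s IH]; first by rewrite big_nil.
  by rewrite big_cons (linC rhoL) IH rhoW mulr0 addr0.
apply: normsq_eq0; apply/eqP; rewrite eq_le normsq_ge0 andbT leNgt; apply/negP => n0.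
have [B SB hB] := weyl_density A hz n0.
have := ultrastrong_bound inner rhoL hz hb (B - A).
rewrite (linCB rhoL) rhoS // sub0r normsqN => /le_lt_trans/(_ hB).
by rewrite ltxx.
Qed.

Corollary normal_functional_ext (rho rho' : 'B(H) -> R[i]) :
  linear (rho : 'B(H) -> R[i]^o) -> normal_functional dot rho ->
  linear (rho' : 'B(H) -> R[i]^o) -> normal_functional dot rho' ->
  (forall z, rho (W z) = rho' (W z)) -> forall A, rho A = rho' A.
Proof.
move=> L N L' N' h A; apply/eqP; rewrite -subr_eq0; apply/eqP.
apply: (normal_functional_eq0 (rho := fun B => rho B - rho' B)).
- move=> a B C; rewrite (linC L) (linC L') -[RHS]/(a * _ + _); ring.
- by move=> B; exact: (@cvgB _ R[i]^o _ _ _ rho rho' _ _ (N B) (N' B)).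
- by move=> z; rewrite h subrr.
Qed.

Lemma weyl_near (z : R * R) (x : H) (e : R) : 0 < e ->
  \forall u \near z, sq (W u x - W z x) < e.
Proof.
move=> e0; have /(cvg_sqP inner)/cvgrPdist_lt/(_ e e0) := @weyl_continuous _ _ _ _ weyl x z.
by apply: filterS => u; rewrite sub0r normrN ger0_norm ?sq_ge0.
Qed.

(** Strong continuity at 0 is uniform on a square-summable sequence: finitely
    many terms are handled by continuity, the tail by unitarity. *)
Lemma weyl_near_one (zeta : nat -> H) (e : R) : (nsq zeta < +oo)%E -> 0 < e ->
  exists2 z, z != 0 & (nsq (fun n => (W z - W 0)%R (zeta n)) < e%:E)%E.
Proof.
move=> hz e0.
(* |W_z x - x|^2 <= 4 |x|^2 turns a tail of size e / 16 into e / 4 *)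
have [|N hN] := @tail_cvg R H dot (l2_of hz) (e / 16); first by rewrite divr_gt0.
have fin K (d : R) : 0 < d ->
    \forall u \near (0 : R * R), \sum_(0 <= n < K) sq (W u (zeta n) - W 0 (zeta n)) < d.
  elim: K => [|K IH] in d * => d0; first by near=> u; rewrite big_geq.
  have d2 : 0 < d / 2 by rewrite divr_gt0.
  have hK := weyl_near 0 (zeta K) d2; have {}IH := IH _ d2.
  near=> u; rewrite big_nat_recr //=.
  have h1 : sq (W u (zeta K) - W 0 (zeta K)) < d / 2 by near: u.
  have : \sum_(0 <= n < K) sq (W u (zeta n) - W 0 (zeta n)) < d / 2 by near: u.
  by lra.
have e4 : 0 < e / 4 by rewrite divr_gt0.
have /nbhs_ballP[r /= r0 hr] := fin N (e / 4) e4.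
have {}hr := hr (r / 2, 0) _.
exists (r / 2, 0).
  by apply/eqP => -[/eqP]; rewrite mulf_eq0 gt_eqF //= invr_eq0 pnatr_eq0.
apply: (@le_lt_trans _ _ (e / 2)%:E); last by rewrite lte_fin; lra.
apply/nsq_leP => K.
set a := fun n => sq ((W (r / 2, 0) - W 0)%R (zeta n)).
have a0 n : 0 <= a n by exact: sq_ge0.
apply: (@le_trans _ _ (\sum_(0 <= n < N + K) a n)).
  rewrite [leRHS](@big_cat_nat _ _ _ K) //= ?leq_addl // lerDl.
  by apply: sumr_ge0.
rewrite (@big_cat_nat _ _ _ N) //= ?leq_addr //.
have h1 : \sum_(0 <= n < N) a n < e / 4.
  by apply: hr; split; rewrite /= /ball /= ?sub0r ?subrr ?normrN ?normr0 // ger0_norm; lra.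
have h2 := (sq_l2_leP _ _).1 (ltW hN) (N + K)%N.
suff : \sum_(N <= n < N + K) a n <= 4 * \sum_(0 <= n < N + K) sq (tail N (l2_of hz) n) by lra.
rewrite [in leRHS](@big_cat_nat _ _ _ N) //= ?leq_addr // mulrDr.
apply: (@le_trans _ _ (4 * \sum_(N <= n < N + K) sq (if (n < N)%N then 0 else zeta n))).
  rewrite mulr_sumr big_nat [leRHS]big_nat; apply: ler_sum => n /andP[Nn _].
  rewrite ltnNge Nn /= /a op_subE; apply: le_trans (sqB_le _ _ _) _.
  by rewrite !weyl_sq; lra.
by rewrite lerDr mulr_ge0 // sumr_ge0 // => n _; exact: sq_ge0.
Unshelve. all: by end_near. Qed.

(** By [weyl_near_one], rho (W_0) is a limit of values rho (W_z) with z <> 0. *)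
Lemma normal_functional_eq0_punctured (rho : 'B(H) -> R[i]) :
  linear (rho : 'B(H) -> R[i]^o) -> normal_functional dot rho ->
  (forall z, z != 0 -> rho (W z) = 0) -> forall A, rho A = 0.
Proof.
move=> rhoL rhoN rhoW; apply: normal_functional_eq0 => // z.
have [->|] := eqVneq z 0; last exact: rhoW.
have [zeta hz hb] := normal_ultrastrongly_bounded inner rhoL rhoN.
apply: normsq_eq0; apply/eqP; rewrite eq_le normsq_ge0 andbT leNgt; apply/negP => n0.
have [u u0 hu] := weyl_near_one hz n0.
have := ultrastrong_bound inner rhoL hz hb (W u - W 0).
rewrite (linCB rhoL) rhoW // sub0r normsqN => /le_lt_trans/(_ hu).
by rewrite ltxx.
Qed.

(** Indexed by finite sequences of quadruples of rationals, a countable set. *)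
Let rat_weyl (v : H) (s : seq ((rat * rat) * (rat * rat))) : H :=
  \sum_(p <- s) ((ratr p.1.1 : R) +i* (ratr p.1.2 : R)) *: W (ratr p.2.1, ratr p.2.2) v.

Let rat_close (x : R) (e : R) : 0 < e -> exists q : rat, `|x - ratr q| < e.
Proof.
move=> e0; have /rat_in_itvoo[q] : x < x + e by rewrite ltrDl.
rewrite in_itv /= => /andP[h1 h2]; exists q.
by rewrite ltr0_norm; lra.
Qed.

Let rat_weyl_approx (v : H) (x : H) :=
  forall e : R, 0 < e -> exists s, sq (rat_weyl v s - x) < e.

Let rat_weyl_term (v : H) (c : R[i]) (z : R * R) : rat_weyl_approx v (c *: W z v).
Proof.
move=> e e0.
have v0 := sq_ge0 dot v.
pose d := Num.min 1 (e / (8 * (sq v + 1))).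
have d0 : 0 < d by rewrite lt_min ltr01 divr_gt0 // mulr_gt0 // ltr_wpDl.
have [q1 h1] := rat_close (complex.Re c) d0.
have [q2 h2] := rat_close (complex.Im c) d0.
pose c' : R[i] := (ratr q1 : R) +i* (ratr q2 : R).
have k0 : 0 < e / (4 * (normsq c' + 1)).
  by rewrite divr_gt0 // mulr_gt0 // ltr_wpDl // normsq_ge0.
have /nbhs_ballP[r /= r0 hr] := weyl_near z v k0.
have [q3 h3] := rat_close z.1 r0.
have [q4 h4] := rat_close z.2 r0.
have hz := hr (ratr q3, ratr q4) (conj h3 h4).
exists [:: ((q1, q2), (q3, q4))]; rewrite /rat_weyl big_seq1 /= -/c'.
have -> : c' *: W (ratr q3, ratr q4) v - c *: W z v =
    c' *: (W (ratr q3, ratr q4) v - W z v) + (c' - c) *: W z v.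
  by rewrite scalerBr scalerBl addrA subrK.
apply: le_lt_trans (sqD_le _ _ _) _; rewrite !sqZ weyl_sq.
have p1 : normsq c' * sq (W (ratr q3, ratr q4) v - W z v) <= e / 4.
  move: hz; rewrite ltr_pdivlMr; last by rewrite mulr_gt0 // ltr_wpDl // normsq_ge0.
  have := sq_ge0 dot (W (ratr q3, ratr q4) v - W z v); have := normsq_ge0 c'.
  by move: (normsq c') (sq _) => p q; nra.
have p2 : normsq (c' - c) * sq v < e / 4.
  have n1 : normsq (c' - c) <= 2 * d.
    have d1 : d <= 1 by rewrite /d ge_min lexx.
    have sqle (y : R) : `|y| < d -> y ^+ 2 <= d.
      move=> hy; rewrite -[y ^+ 2]ger0_norm ?sqr_ge0 // normrX expr2.
      by have := normr_ge0 y; nra.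
    rewrite /normsq !complexP /=.
    by have := sqle _ h1; have := sqle _ h2; rewrite !sqrrB; lra.
  have n2 : d * (8 * (sq v + 1)) <= e.
    by rewrite -ler_pdivlMr ?mulr_gt0 ?ltr_wpDl // /d ge_min lexx orbT.
  have := normsq_ge0 (c' - c); move: (normsq (c' - c)) n1 => y n1 y0.
  have : y * sq v <= 2 * d * sq v by rewrite ler_wpM2r.
  by lra.
by lra.
Qed.

Let rat_weyl_span (v : H) (B : 'B(H)) : weyl_span B -> rat_weyl_approx v (B v).
Proof.
move=> [s ->]; rewrite op_sumE; elim: s => [|p s IH] e e0.
  by exists [::]; rewrite /rat_weyl !big_nil subrr sq0.
have e4 : 0 < e / 4 by rewrite divr_gt0.
have [t ht] := IH _ e4; have [u hu] := rat_weyl_term v p.1 p.2 e4.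
exists (u ++ t); rewrite big_cons /rat_weyl big_cat /= opprD addrACA.
apply: le_lt_trans (sqD_le _ _ _) _; rewrite -!/(rat_weyl v _).
by lra.
Qed.

(** For v <> 0 every x is A v for some A of rank one, so the density of the span
    of the W_z makes the combinations of the W_z v dense; rational data are
    enough.  The chain of approximations in [discretisation] starts from the
    vector 0, put at index 0 for this purpose. *)
Lemma weyl_dense_seq : exists d : nat -> H, d 0%N = 0 /\
  forall (x : H) (e : R), 0 < e -> exists n, sq (x - d n) < e.
Proof.
have [v v0] := irr.1.
have sv : 0 < sq v.
  by rewrite lt_def sq_ge0 andbT; apply: contra_neq v0; exact: sq_eq0.
exists (fun n => if n is n'.+1 then
  (if unpickle n' is Some s then rat_weyl v s else 0) else 0); split=> // x e e0.
pose rank1 (y : H) := (dot y v / (sq v)%:C) *: x.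
have [A hA] : exists A : 'B(H), forall y, A y = rank1 y.
  apply: (op_of inner (M := sq x / sq v)) => [a y y'|y].
    by rewrite /rank1 dotDl dotZl mulrDl scalerDl scalerA mulrA.
  rewrite /rank1 sqZ normsqM -fmorphV normsq_real.
  have cs := cauchy_schwarz dot y v.
  rewrite -(ler_pM2r (exprn_gt0 2 sv)).
  have -> : normsq (dot y v) * (sq v)^-1 ^+ 2 * sq x * sq v ^+ 2
     = normsq (dot y v) * sq x by field; rewrite gt_eqF.
  have -> : sq x / sq v * sq y * sq v ^+ 2 = sq y * sq v * sq x.
    by field; rewrite gt_eqF.
  by rewrite ler_wpM2r ?sq_ge0.
have Av : A v = x.
  by rewrite hA /rank1 sqE divff ?scale1r // eq_complex /= eqxx andbT gt_eqF.
have e4 : 0 < e / 4 by rewrite divr_gt0.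
have hz : (nsq (fun n => if n is 0%N then v else 0%R) < +oo)%E.
  by rewrite nsq_single ltry.
have [B SB hB] := weyl_density A hz e4.
have {}hB : sq (B v - x) < e / 4.
  rewrite -Av -op_subE -lte_fin; apply: le_lt_trans hB.
  exact: (sq_le_nsq _ (fun n => (B - A) (if n is 0%N then v else 0)) 0%N).
have [s hs] := rat_weyl_span v SB e4.
exists (pickle s).+1; rewrite pickleK sqBC.
have -> : rat_weyl v s - x = (rat_weyl v s - B v) + (B v - x) by rewrite addrA subrK.
by apply: le_lt_trans (sqD_le _ _ _) _; lra.
Qed.

Lemma weyl_separable : separable H.
Proof.
have [d [_ hd]] := weyl_dense_seq; exists (range d); split.
  exact: sub_countable (card_image_le _ _) (countableP _).
move=> U [x Ux] oU; have : nbhs x U by apply: open_nbhs_nbhs.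
move=> /nbhs_ballP[e /gt0_realE[]]; move: (complex.Re e) => r -> {e} r0 hU.
have [n hn] := hd x (r ^+ 2) (exprn_gt0 2 r0).
exists (d n); split; last by exists n.
by apply: hU; rewrite -ball_normE /= (norm_lt_sq inner).
Qed.

End WeylOperators.

(** * Integration of complex-valued random variables *)

Section ComplexIntegral.
Context d (T : measurableType d) (R : realType) (P : probability T R).
Local Notation Re := (@complex.Re R).
Local Notation Im := (@complex.Im R).
Implicit Types f g : T -> R[i].

Definition cintegrable f : Prop :=
  P.-integrable setT (EFin \o (fun x => Re (f x))) /\
  P.-integrable setT (EFin \o (fun x => Im (f x))).

Definition cint f : R[i] :=
  (\int[P]_x (Re (f x)))%R +i* (\int[P]_x (Im (f x)))%R.

Lemma Rintegral_prob_cst (c : R) : \int[P]_x c = c.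
Proof.
rewrite Rintegral_cst // [fine _](_ : _ = 1) ?mulr1 //.
exact: (congr1 fine (probability_setT P)).
Qed.

Lemma bounded_integrable (h : T -> R) (M : R) :
  measurable_fun setT h -> (forall x, `|h x| <= M) -> P.-integrable setT (EFin \o h).
Proof.
move=> hc hM; apply: measurable_bounded_integrable => //.
  by rewrite [X in (X < _)%E](_ : _ = 1%E) ?ltry //; exact: probability_setT.
exists M; split; first exact: num_real.
by move=> y My x _ /=; apply: le_trans (hM x) (ltW My).
Qed.

Lemma Rint_norm_le (h : T -> R) (M : R) :
  P.-integrable setT (EFin \o h) -> (forall x, `|h x| <= M) ->
  `|\int[P]_x (h x)| <= M.
Proof.
move=> hi hM; apply: le_trans (le_normr_Rintegral _ hi) _ => //.
rewrite -[leRHS]Rintegral_prob_cst.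
apply: le_Rintegral => //.
- exact: (integrable_norm hi).
- by apply: (@bounded_integrable (fun=> M) `|M|).
Qed.

(** The factor 2 comes from bounding real and imaginary parts separately. *)
Lemma cint_normsq_le f (K : R) : cintegrable f -> 0 <= K ->
  (forall x, normsq (f x) <= K) -> normsq (cint f) <= 2 * K.
Proof.
move=> [fr fi] K0 hK.
have le2 (y : R) : y ^+ 2 <= K -> `|y| <= Num.sqrt K.
  by move=> h; rewrite -sqrtr_sqr ler_sqrt.
have le2' (y : R) : `|y| <= Num.sqrt K -> y ^+ 2 <= K.
  move=> h; rewrite -(sqr_sqrtr K0) -[y ^+ 2]ger0_norm ?sqr_ge0 // normrX.
  by rewrite ler_pXn2r // nnegrE ?sqrtr_ge0.
rewrite /normsq /= mulr2n mulrDl !mul1r; apply: lerD; apply: le2'.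
- apply: Rint_norm_le => // x; apply: le2; have := hK x.
  by rewrite /normsq; have := sqr_ge0 (Im (f x)); lra.
- apply: Rint_norm_le => // x; apply: le2; have := hK x.
  by rewrite /normsq; have := sqr_ge0 (Re (f x)); lra.
Qed.

Lemma cintegrableD f g : cintegrable f -> cintegrable g ->
  cintegrable (fun x => f x + g x).
Proof.
move=> [fr fi] [gr gi]; split.
  rewrite [X in integrable _ _ X](_ : _ = (EFin \o (Re \o f)) \+ (EFin \o (Re \o g)))%E.
    exact: integrableD.
  by apply/funext => x; rewrite /= cReD EFinD.
rewrite [X in integrable _ _ X](_ : _ = (EFin \o (Im \o f)) \+ (EFin \o (Im \o g)))%E.
  exact: integrableD.
by apply/funext => x; rewrite /= cImD EFinD.
Qed.

Lemma cintD f g : cintegrable f -> cintegrable g ->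
  cint (fun x => f x + g x) = cint f + cint g.
Proof.
move=> [fr fi] [gr gi]; apply: complex_eq; rewrite ?cReD ?cImD /=.
  by rewrite -RintegralD //; apply: eq_Rintegral => x _; rewrite cReD.
by rewrite -RintegralD //; apply: eq_Rintegral => x _; rewrite cImD.
Qed.

Let integrableZ (h : T -> R) (c : R) : P.-integrable setT (EFin \o h) ->
  P.-integrable setT (EFin \o (fun x => c * h x)).
Proof.
move=> hi; rewrite [X in integrable _ _ X](_ : _ = (fun x => c%:E * (EFin \o h) x)%E).
  exact: integrableZl.
by apply/funext => x; rewrite /= EFinM.
Qed.

Lemma cintegrableZ (c : R[i]) f : cintegrable f -> cintegrable (fun x => c * f x).
Proof.
move=> [fr fi]; split.
  rewrite [X in integrable _ _ X](_ : _ = (EFin \o (fun x => (Re c * Re (f x))%R))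
     \- (EFin \o (fun x => (Im c * Im (f x))%R)))%E.
    by apply: integrableB => //; exact: integrableZ.
  by apply/funext => x; rewrite /= cReM EFinB.
rewrite [X in integrable _ _ X](_ : _ = (EFin \o (fun x => (Re c * Im (f x))%R))
   \+ (EFin \o (fun x => (Im c * Re (f x))%R)))%E.
  by apply: integrableD => //; exact: integrableZ.
by apply/funext => x; rewrite /= cImM EFinD.
Qed.

Lemma cintZ (c : R[i]) f : cintegrable f -> cint (fun x => c * f x) = c * cint f.
Proof.
move=> [fr fi]; apply: complex_eq; rewrite ?cReM ?cImM /=.
  rewrite -!RintegralZl // -RintegralB //; try exact: integrableZ.
  by apply: eq_Rintegral => x _; rewrite cReM.
rewrite -!RintegralZl // -RintegralD //; try exact: integrableZ.
by apply: eq_Rintegral => x _; rewrite cImM.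
Qed.

Lemma eq_cint f g : (forall x, f x = g x) -> cint f = cint g.
Proof. by move=> h; congr (cint _); apply/funext. Qed.

Lemma cint_cst (c : R[i]) : cint (fun=> c) = c.
Proof.
by apply: complex_eq; exact: Rintegral_prob_cst.
Qed.

Lemma cintegrable0 : cintegrable (fun=> 0).
Proof. by split; apply: (@bounded_integrable (fun=> 0) 0) => // x; rewrite normr0. Qed.

Lemma cintegrable_sum (I : Type) (s : seq I) (F : I -> T -> R[i]) :
  (forall i, cintegrable (F i)) -> cintegrable (fun x => \sum_(i <- s) F i x).
Proof.
move=> h; elim: s => [|i s IH].
  rewrite [X in cintegrable X](_ : _ = fun=> 0); first exact: cintegrable0.
  by apply/funext => x; rewrite big_nil.
rewrite [X in cintegrable X](_ : _ = fun x => F i x + \sum_(j <- s) F j x).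
  exact: cintegrableD.
by apply/funext => x; rewrite big_cons.
Qed.

Lemma cint_sum (I : Type) (s : seq I) (F : I -> T -> R[i]) :
  (forall i, cintegrable (F i)) ->
  cint (fun x => \sum_(i <- s) F i x) = \sum_(i <- s) cint (F i).
Proof.
move=> h; elim: s => [|i s IH].
  rewrite big_nil -[RHS](cint_cst 0).
  by apply: eq_cint => x; rewrite big_nil.
rewrite big_cons -IH -cintD //; last exact: cintegrable_sum.
by apply: eq_cint => x; rewrite big_cons.
Qed.

Lemma cint_ge0 f : (forall x, 0 <= f x) -> 0 <= cint f.
Proof.
move=> h; rewrite lecE /=; apply/andP; split.
  have -> : (fun x => Im (f x)) = (fun=> 0) by apply/funext => x; rewrite ger0_Im.
  by rewrite Rintegral_prob_cst.
by apply: Rintegral_ge0 => x _; exact: cRe_ge0.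
Qed.

(** Dominated convergence of both parts, with a constant as dominating function. *)
Lemma cint_cvg (f_ : nat -> T -> R[i]) f (M : R) :
  (forall n, measurable_fun setT (fun x => Re (f_ n x))) ->
  (forall n, measurable_fun setT (fun x => Im (f_ n x))) ->
  (forall n x, normsq (f_ n x) <= M ^+ 2) ->
  (forall x, (f_ n x : R[i]^o) @[n --> \oo] --> (f x : R[i]^o)) -> 0 <= M ->
  (cint (f_ n) : R[i]^o) @[n --> \oo] --> (cint f : R[i]^o).
Proof.
move=> cr ci hM hf M0.
have rb n x : `|Re (f_ n x)| <= M.
  rewrite -(ler_pXn2r (n := 2)) ?nnegrE // real_normK ?num_real //.
  by have := hM n x; rewrite /normsq; have := sqr_ge0 (Im (f_ n x)); lra.
have ib n x : `|Im (f_ n x)| <= M.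
  rewrite -(ler_pXn2r (n := 2)) ?nnegrE // real_normK ?num_real //.
  by have := hM n x; rewrite /normsq; have := sqr_ge0 (Re (f_ n x)); lra.
have key (h_ : nat -> T -> R) (h : T -> R) : (forall n, measurable_fun setT (h_ n)) ->
    (forall n x, `|h_ n x| <= M) -> (forall x, h_ n x @[n --> \oo] --> h x) ->
    \int[P]_x (h_ n x) @[n --> \oo] --> \int[P]_x (h x).
  move=> hc hb hl.
  have iM : P.-integrable setT (EFin \o (fun=> M)).
    by apply: (@bounded_integrable (fun=> M) `|M|).
  have mh : measurable_fun setT h.
    by apply: (measurable_fun_cvg (h := h_)) => // x _; exact: hl.
  have [||||ih _ hcv] := @dominated_convergence _ _ _ P setT measurableT
    (fun n => EFin \o h_ n) (EFin \o h) (EFin \o (fun=> M)) _ _ _ iM _.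
  - by move=> n; apply/measurable_EFinP.
  - exact/measurable_EFinP.
  - by apply: aeW => x _; apply: cvg_EFin; [exact: nearW|exact: hl].
  - by apply: aeW => x n _; rewrite /= lee_fin.
  by apply: fine_cvg; rewrite fineK //; exact: integrable_fin_num.
apply: cvgC => /=; apply: key => // x.
  by have [] := cvgC_parts _ (hf x).
by have [] := cvgC_parts _ (hf x).
Qed.

End ComplexIntegral.

(** * Averages of an operator over random isometries *)

Section DotContinuity.
Variables (R : realType) (H : completeNormedModType R[i]) (dot : {dot H for Num.conj}).
Hypothesis inner : inner_product_of dot.
Local Notation Re := (@complex.Re R).
Local Notation sq := (sqnorm dot).
Variables (T : Type) (F : set_system T) (FF : Filter F).
Implicit Types f g : T -> H.

Lemma cvg_sq f l : f x @[x --> F] --> l -> sq (f x) @[x --> F] --> sq l.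
Proof.
move=> fl.
have : (`|f x| : R[i]^o) @[x --> F] --> (`|l| : R[i]^o) by exact: cvg_norm.
move=> /(cvgC_parts FF)[h _].
have E x : sq x = Re `|x| * Re `|x|.
  by rewrite (norm_sq inner) /= -expr2 sqr_sqrtr ?sq_ge0.
rewrite E; under eq_fun do rewrite E.
exact: cvgM.
Qed.

Lemma cvg_Re_dot f g l m : f x @[x --> F] --> l -> g x @[x --> F] --> m ->
  Re (dot (f x) (g x)) @[x --> F] --> Re (dot l m).
Proof.
move=> fl gm.
have E x y : Re (dot x y) = (sq (x + y) - sq (x - y)) * 4^-1.
  by rewrite sqB sqD; field.
rewrite E; under eq_fun do rewrite E.
apply: cvgM; last exact: cvg_cst.
by apply: cvgB; apply: cvg_sq; [exact: cvgD|exact: cvgB].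
Qed.

End DotContinuity.

Section Averages.
Variables (R : realType) (H : completeNormedModType R[i]) (dot : {dot H for Num.conj}).
Hypothesis inner : inner_product_of dot.
Local Notation Re := (@complex.Re R).
Local Notation Im := (@complex.Im R).
Local Notation sq := (sqnorm dot).
Context d (T : measurableType d) (P : probability T R).
Variable V : T -> 'B(H).
Hypothesis V_iso : forall x xi eta, dot (V x xi) (V x eta) = dot xi eta.
Hypothesis V_dot : forall (A : 'B(H)) xi eta,
  measurable_fun setT (fun x => Re (dot (A (V x xi)) (V x eta))).
Hypothesis V_sq : forall (A : 'B(H)) xi v,
  measurable_fun setT (fun x => sq (A (V x xi) - v)).

(** Phi A is the expectation of V* A V, tested on vectors so that no integral of
    operators is involved. *)
Definition is_average (Phi : 'B(H) -> 'B(H)) := forall A xi eta,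
  dot (Phi A xi) eta = cint P (fun x => dot (A (V x xi)) (V x eta)).

Let V_sqE x xi : sq (V x xi) = sq xi.
Proof. by rewrite /sqnorm V_iso. Qed.

Let bounded_dot (A : 'B(H)) (M : R) xi eta : (forall x, sq (A x) <= M * sq x) ->
  forall x, normsq (dot (A (V x xi)) (V x eta)) <= M * (sq xi * sq eta).
Proof.
move=> hM x; apply: le_trans (cauchy_schwarz _ _ _) _.
rewrite V_sqE mulrA ler_wpM2r ?sq_ge0 //.
by apply: le_trans (hM _) _; rewrite V_sqE.
Qed.

Lemma average_integrable (A : 'B(H)) xi eta :
  cintegrable P (fun x => dot (A (V x xi)) (V x eta)).
Proof.
have [M M0 hM] := op_bound inner A.
have b e x : `|Re (dot (A (V x xi)) (V x e))| <= (M * sq xi + sq e) / 2.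
  apply: le_trans (norm_Re_dot_le _ _ _) _.
  by have := hM (V x xi); rewrite !V_sqE; lra.
split; first exact: (bounded_integrable _ (V_dot _ _ _) (b eta)).
have E x : Im (dot (A (V x xi)) (V x eta)) = Re (dot (A (V x xi)) (V x ('i *: eta))).
  by rewrite Im_dotE opZ.
rewrite [X in EFin \o X](_ : _ = fun x => Re (dot (A (V x xi)) (V x ('i *: eta)))).
  exact: (bounded_integrable _ (V_dot _ _ _) (b ('i *: eta))).
exact/funext.
Qed.

Let integrable_dot := average_integrable.

(** The expectation is a bounded sesquilinear form, hence an operator. *)
Lemma average_ex : exists Phi, is_average Phi.
Proof.
suff /choice[Phi hPhi] (A : 'B(H)) : exists B : 'B(H), forall xi eta,
    dot (B xi) eta = cint P (fun x => dot (A (V x xi)) (V x eta)) by exists Phi.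
have [M M0 hM] := op_bound inner A.
apply: (op_of_form inner (K := 2 * M)) => [a x y z|a x y z|x y].
- rewrite -cintZ // -cintD //; last exact: cintegrableZ.
  by apply: eq_cint => t; rewrite op_linear op_linear dotDl dotZl.
- rewrite -cintZ // -cintD //; last exact: cintegrableZ.
  by apply: eq_cint => t; rewrite op_linear dotDr dotZr.
rewrite -mulrA; apply: cint_normsq_le => //.
  by rewrite !mulr_ge0 ?sq_ge0 // ltW.
exact: bounded_dot.
Qed.

Variable Phi : 'B(H) -> 'B(H).
Hypothesis PhiE : is_average Phi.

Lemma average_linear : linear Phi.
Proof.
move=> a A B; apply: op_eq => xi; apply: (dot_inj (dot := dot)) => eta.
rewrite dotC [RHS]dotC op_addE op_scaleE dotDl dotZl !PhiE; congr (Num.conj _).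
rewrite -cintZ // -cintD //; last exact: cintegrableZ.
by apply: eq_cint => t; rewrite op_addE op_scaleE dotDl dotZl.
Qed.

(** An operator multiplied by a random scalar under conjugation is an
    eigenvector, for the expectation of that scalar. *)
Lemma average_eigen (A : 'B(H)) (chi : T -> R[i]) (c : R[i]) : cintegrable P chi ->
  (forall x xi eta, dot (A (V x xi)) (V x eta) = chi x * dot (A xi) eta) ->
  cint P chi = c -> Phi A = c *: A.
Proof.
move=> chii h hc; apply: op_eq => xi; apply: (dot_inj (dot := dot)) => eta.
rewrite dotC [RHS]dotC op_scaleE dotZl PhiE; congr (Num.conj _).
rewrite -hc mulrC -cintZ //; apply: eq_cint => t.
by rewrite h mulrC.
Qed.

Lemma average1 : Phi one_op = one_op.
Proof.
rewrite (average_eigen (chi := fun=> 1) (c := 1)) ?scale1r ?cint_cst //.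
- by split; apply: (@bounded_integrable _ _ _ _ (fun=> _) 1) => //= _; rewrite ?normr1 ?normr0.
- by move=> x xi eta; rewrite mul1r V_iso.
Qed.

(** The positivity inequality for V* A V is that for A on the vectors V xi_i;
    it is then integrated. *)
Lemma average_cp : completely_positive dot Phi.
Proof.
move=> n A hA xi.
under eq_bigr => i _ do (under eq_bigr => j _ do rewrite mxE PhiE).
under eq_bigr => i _ do rewrite -cint_sum //.
rewrite -cint_sum; last by move=> i; exact: cintegrable_sum.
by apply: cint_ge0 => x; exact: (hA (fun i => V x (xi i))).
Qed.

Lemma average_bound (A : 'B(H)) (M : R) : 0 <= M -> (forall x, sq (A x) <= M * sq x) ->
  forall x, sq (Phi A x) <= 2 * M * sq x.
Proof.
move=> M0 hM x.
have : normsq (dot (Phi A x) (Phi A x)) <= 2 * (M * (sq x * sq (Phi A x))).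
  rewrite PhiE; apply: cint_normsq_le => //; last exact: bounded_dot.
  by rewrite !mulr_ge0 ?sq_ge0.
rewrite sqE normsq_real expr2.
have [->|n0] := eqVneq (sq (Phi A x)) 0; first by rewrite !mulr_ge0 ?sq_ge0.
by rewrite !mulrA ler_pM2r // lt_def n0 sq_ge0.
Qed.

End Averages.

(** * Domination of a random vector by a square-summable sequence *)

Section Discretisation.
Variables (R : realType) (H : completeNormedModType R[i]) (dot : {dot H for Num.conj}).
Hypothesis inner : inner_product_of dot.
Local Notation sq := (sqnorm dot).
Local Notation nsq := (sqnorm_sum dot).
Local Open Scope ereal_scope.

(** Iterating |a + b|^2 <= 2 |a|^2 + 2 |b|^2 costs a factor 2 for each term, which
    terms of squared norm 4^-k can afford. *)
Lemma weighted_sq (a : nat -> H) m :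
  (sq (\sum_(0 <= k < m) a k) <= \sum_(0 <= k < m) 2 ^+ k.+1 * sq (a k))%R.
Proof.
elim: m a => [|m IH] a; first by rewrite !big_geq // sq0.
rewrite !big_nat_recl //=; apply: le_trans (sqD_le _ _ _) _.
rewrite expr1 lerD2l.
apply: le_trans (_ : 2 * (\sum_(0 <= k < m) 2 ^+ k.+1 * sq (a k.+1)) <= _)%R.
  by rewrite ler_wpM2l.
rewrite mulr_sumr ler_sum // => k _.
by rewrite [in leRHS]exprS mulrA.
Qed.

Lemma weighted_sq_lim (a : nat -> H) (l : H) :
  dot_cvg dot (fun m => (\sum_(0 <= k < m) a k)%R) l ->
  (sq l)%:E <= \sum_(k <oo) (2 ^+ k.+1 * sq (a k))%:E.
Proof.
move=> hl; have t0 k : (0 <= 2 ^+ k.+1 * sq (a k))%R.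
  by rewrite mulr_ge0 ?exprn_ge0 ?sq_ge0.
have [|inf] := ltP (\sum_(k <oo) (2 ^+ k.+1 * sq (a k))%:E) +oo; last first.
  exact: le_trans (leey _) inf.
move=> /(nneseries_fin_ex t0)[M hM]; rewrite hM lee_fin.
have hp m : (sq (\sum_(0 <= k < m) a k) <= M)%R.
  apply: le_trans (weighted_sq _ _) _; apply: (nneseries_leP t0 M).1.
  by rewrite hM.
have c : (\sum_(0 <= k < m) a k)%R @[m --> \oo] --> l.
  apply/(cvg_sqP inner)/cvgrPdist_lt => e e0; have [N NP] := hl e e0.
  by exists N => // n Nn /=; rewrite sub0r normrN ger0_norm ?sq_ge0 //; exact: NP.
have {}c : sq (\sum_(0 <= k < m) a k)%R @[m --> \oo] --> sq l by exact: cvg_sq.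
rewrite -(cvg_lim _ c) //; apply: limr_le; first by apply/cvg_ex; exists (sq l).
exact: nearW.
Qed.

Context d (T : measurableType d) (P : probability T R).

Let PT1 : P setT = 1. Proof. exact: probability_setT. Qed.

Lemma integral_countable (q : T -> nat) (g : nat -> R) :
  (forall n, measurable (q @^-1` [set n])) -> (forall n, 0 <= g n)%R ->
  \int[P]_x (g (q x))%:E = \sum_(n <oo) (g n * fine (P (q @^-1` [set n])))%:E.
Proof.
move=> mq g0.
have E x : (g (q x))%:E = \sum_(n <oo) ((g n)%:E * (\1_(q @^-1` [set n]) x)%:E).
  rewrite (nneseriesD1 (n := q x)) //; last first.
    by move=> k _; rewrite -EFinM lee_fin mulr_ge0 // indicE ler0n.
  rewrite indicE mem_set //= mule1 eseries0 ?adde0 // => k _ kq.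
  by rewrite indicE memNset ?mule0 // => /= qk; rewrite qk eqxx in kq.
under eq_integral do rewrite E.
rewrite integral_nneseries //; last 2 first.
- move=> n; apply: emeasurable_funM => //.
  by apply/measurable_EFinP; exact: measurable_indic.
- by move=> n x _; rewrite -EFinM lee_fin mulr_ge0 // indicE ler0n.
apply: eq_eseriesr => n _.
rewrite ge0_integralZl //; last 2 first.
- by apply/measurable_EFinP; exact: measurable_indic.
- by rewrite lee_fin.
rewrite integral_indic // setIT EFinM fineK // fin_num_measure //.
Qed.

Lemma measurable_countable (q : T -> nat) (g : nat -> R) :
  (forall n, measurable (q @^-1` [set n])) -> measurable_fun setT (fun x => g (q x)).
Proof.
move=> mq _ Y mY; rewrite setTI.
rewrite (_ : _ @^-1` Y = \bigcup_(n in [set n | Y (g n)]) (q @^-1` [set n])).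
  by apply: bigcup_measurable => n _; exact: mq.
by apply/seteqP; split=> [x /= Yx|x [n /= Yn qn]]; [exists (q x)|rewrite /= qn].
Qed.

Variables (X : T -> H) (den : nat -> H).
Hypothesis den0 : den 0%N = 0%R.
Hypothesis denP : forall (x : H) (e : R), (0 < e)%R -> exists n, (sq (x - den n) < e)%R.
Hypothesis X_sq : forall (A : 'B(H)) v, measurable_fun setT (fun x => sq (A (X x) - v)).

(** Replace X by the first point of the dense sequence at squared distance less
    than 4^-k e.  The increments delta_k of these approximations add up to X and
    take countably many values, and E |A X|^2 <= \sum_k 2^(k+1) E |A delta_k|^2 by
    [weighted_sq_lim].  Each expectation on the right is a series of terms
    P(delta_k = v) |A v|^2, which is a sum of |A Z|^2 for vectors Z independent
    of A.  The bound of the total comes from |delta_k|^2 <= 4 * 4^-k (r + e). *)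
Theorem discretisation (r e : R) : (forall x, sq (X x) <= r)%R -> (0 < e)%R ->
  exists Z : nat -> H, nsq Z <= (16 * (r + e))%:E /\
    forall A : 'B(H), \int[P]_x (sq (A (X x)))%:E <= nsq (fun n => A (Z n)).
Proof.
move=> hr e0.
pose tau k : R := (4 ^- k * e)%R.
have tau0 k : (0 < tau k)%R by rewrite mulr_gt0 // invr_gt0 exprn_gt0.
(* index of the first point at squared distance less than tau k; the chain
   starts at index 0, that is, at the vector 0 *)
pose J k x : nat := if k is k'.+1 then ex_minn (denP (X x) (tau0 k)) else 0%N.
have JP k x : (sq (X x - den (J k.+1 x)) < tau k.+1)%R.
  by rewrite /J; case: ex_minnP.
have mlt k j : measurable [set x | (sq (X x - den j) < tau k)%R].
  have := X_sq one_op (den j) measurableT (measurable_itv `]-oo, tau k[).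
  by rewrite setTI; congr (measurable _); apply/seteqP; split=> x /=; rewrite in_itv.
have mJ k j : measurable [set x | J k x = j].
  case: k => [|k].
    have [->|j0] := eqVneq j 0%N.
      by rewrite [X in measurable X](_ : _ = setT) //; apply/seteqP.
    rewrite [X in measurable X](_ : _ = set0) //.
    by apply/seteqP; split=> x //= /esym/eqP; rewrite (negbTE j0).
  rewrite [X in measurable X](_ : _ = [set x | (sq (X x - den j) < tau k.+1)%R] `&`
      \bigcap_(i in `I_j) ~` [set x | (sq (X x - den i) < tau k.+1)%R]).
    apply: measurableI => //; apply: bigcap_measurableType => i _.
    exact: measurableC.
  apply/seteqP; split=> x /=.
    move=> <-; split; first exact: JP.
    move=> i /=; rewrite /J; case: ex_minnP => n _ hn ni hi.
    by have := hn _ hi; rewrite leqNgt ni.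
  case=> hj hi; rewrite /J; case: ex_minnP => n hn hmin.
  apply/eqP; rewrite eqn_leq hmin // andTb leqNgt; apply/negP => nj.
  exact: hi n nj hn.
have [en enP] := nneseries_flatten R.
(* the value of the k-th increment, encoded by the indices of its two ends *)
pose q k x : nat := pickle (J k x, J k.+1 x).
pose delta n : H := if unpickle n is Some p then (den p.2 - den p.1)%R else 0%R.
have deltaE k x : delta (q k x) = (den (J k.+1 x) - den (J k x))%R.
  by rewrite /delta /q pickleK.
have mq k n : measurable (q k @^-1` [set n]).
  have [[p hp]|hn] := pselect (exists p : nat * nat, pickle p = n).
    rewrite (_ : _ @^-1` _ = [set x | J k x = p.1] `&` [set x | J k.+1 x = p.2]).
      exact: measurableI.
    apply/seteqP; split=> [x hx|x [h1 h2]].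
      have <- : (J k x, J k.+1 x) = p by apply: (pcan_inj pickleK); rewrite hp.
      by [].
    by rewrite -hp; case: p {hp} h1 h2 => a b h1 h2; congr pickle; congr pair.
  rewrite (_ : _ @^-1` _ = set0) //; apply/seteqP; split=> x //= hx.
  by apply: hn; exists (J k x, J k.+1 x).
have mA (A : 'B(H)) k : measurable_fun setT (fun x => (sq (A (delta (q k x))))%:E).
  by apply/measurable_EFinP; apply: (measurable_countable (fun n => sq (A (delta n))) (mq k)).
pose Z2 k n : H := ((Num.sqrt (2 ^+ k.+1 * fine (P (q k @^-1` [set n]))))%:C *: delta n)%R.
have ZE (A : 'B(H)) : nsq (fun n => A (Z2 (en n).1 (en n).2)) =
    \sum_(k <oo) (2 ^+ k.+1)%:E * \int[P]_x (sq (A (delta (q k x))))%:E.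
  rewrite /sqnorm_sum (enP (fun k j => (sq (A (Z2 k j)))%:E)); last first.
    by move=> i j; rewrite lee_fin sq_ge0.
  apply: eq_eseriesr => k _.
  rewrite (integral_countable (q := q k) (g := fun n => sq (A (delta n)))) //; last first.
    by move=> n; exact: sq_ge0.
  rewrite -nneseriesZl; last first.
    by move=> n _; rewrite lee_fin mulr_ge0 ?sq_ge0 // fine_ge0.
  apply: eq_eseriesr => n _; rewrite -EFinM /Z2 opZ sqZ normsq_real sqr_sqrtr.
    by congr (_%:E); ring.
  by rewrite mulr_ge0 ?exprn_ge0 ?fine_ge0.
have mA2 (A : 'B(H)) k :
    measurable_fun setT (fun x => (2 ^+ k.+1 * sq (A (delta (q k x))))%:E).
  apply/measurable_EFinP.
  exact: (measurable_countable (fun n => 2 ^+ k.+1 * sq (A (delta n)))%R (mq k)).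
have re0 : (0 <= r + e)%R.
  have [[x _]|T0] := pselect (exists x : T, True); last first.
    have := probability_setT P; rewrite (_ : setT = set0) ?measure0.
      by move=> /eqP; rewrite lt_eqF ?lte01.
    by apply/seteqP; split=> // x _; apply: T0; exists x.
  have r0 : (0 <= r)%R by apply: le_trans (hr x); exact: sq_ge0.
  by rewrite addr_ge0 // ltW.
exists (fun n => Z2 (en n).1 (en n).2); split.
  have := ZE one_op; rewrite /= => ->.
  have dk k x : (sq (delta (q k x)) <= 4 * (4 ^- k * (r + e)))%R.
    rewrite deltaE; have r0 : (0 <= r)%R by apply: le_trans (hr x); exact: sq_ge0.
    case: k => [|k].
      have -> : (den (J 1%N x) - den (J 0%N x) = X x - (X x - den (J 1%N x)))%R.
        by rewrite /= den0 subr0 subKr.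
      apply: le_trans (sqB_le _ _ _) _; have := JP 0%N x; have := hr x.
      rewrite /tau expr0 invr1 expr1 => h1 h2; lra.
    have -> : (den (J k.+2 x) - den (J k.+1 x)
        = (X x - den (J k.+1 x)) - (X x - den (J k.+2 x)))%R.
      by rewrite opprB [RHS]addrC subrKA.
    apply: le_trans (sqB_le _ _ _) _; have := JP k x; have := JP k.+1 x.
    have : (tau k.+2 = tau k.+1 / 4)%R by rewrite /tau [in LHS]exprS invfM; ring.
    have := tau0 k.+1; have : (0 <= 4 ^- k.+1 * r)%R.
      by rewrite mulr_ge0 // invr_ge0 exprn_ge0.
    by rewrite mulrDr -/(tau k.+1); lra.
  apply: (@le_trans _ _ (\sum_(k <oo) (8 * (r + e) * 2 ^- k)%:E)).
    apply: lee_nneseries => k _.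
      rewrite mule_ge0 // ?lee_fin ?exprn_ge0 //.
      by apply: integral_ge0 => x _; rewrite lee_fin sq_ge0.
    have -> : (8 * (r + e) * 2 ^- k)%:E = (2 ^+ k.+1)%:E * (4 * (4 ^- k * (r + e)))%:E.
      rewrite -EFinM; congr (_%:E); rewrite exprS.
      have -> : (4 ^+ k = 2 ^+ k * 2 ^+ k :> R)%R by rewrite -exprMn; congr (_ ^+ _)%R; ring.
      by field; rewrite expf_neq0.
    apply: lee_wpmul2l; first by rewrite lee_fin exprn_ge0.
    apply: (@le_trans _ _ (\int[P]_x (4 * (4 ^- k * (r + e)))%:E)).
      apply: ge0_le_integral => //.
      + by move=> x _; rewrite lee_fin sq_ge0.
      + exact: (mA one_op k).
      + by move=> x _; rewrite lee_fin; exact: dk.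
    by rewrite integral_cst // [X in _ * X](_ : _ = 1) ?mule1.
  apply/(nneseries_leP (a := fun k => (8 * (r + e) * 2 ^- k)%R)) => [k|N].
    by rewrite mulr_ge0 ?mulr_ge0 ?re0 // invr_ge0 exprn_ge0.
  have -> : (\sum_(0 <= k < N) 8 * (r + e) * 2 ^- k = 16 * (r + e) * (1 - 2 ^- N))%R.
    elim: N => [|N IH]; first by rewrite big_geq // expr0 invr1 subrr mulr0.
    rewrite big_nat_recr //= IH [in RHS]exprS invfM; field.
    by rewrite expf_neq0.
  rewrite ler_piMr ?mulr_ge0 ?re0 // gerBl invr_ge0 exprn_ge0 //.
move=> A; rewrite ZE.
rewrite (_ : (\sum_(k <oo) _) = \int[P]_x (\sum_(k <oo) (2 ^+ k.+1 * sq (A (delta (q k x))))%:E)).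
  apply: ge0_le_integral => //.
  - by move=> x _; rewrite lee_fin sq_ge0.
  - apply/measurable_EFinP; have := X_sq A 0%R.
    by under eq_fun do rewrite subr0.
  - by apply: ge0_emeasurable_sum => [k x _ _|k _]; rewrite ?lee_fin ?mulr_ge0 ?exprn_ge0 ?sq_ge0.
  move=> x _; apply: weighted_sq_lim => d' d0.
  have [M M0 hM] := op_bound inner A.
  have : (e * (4^-1) ^+ n @[n --> \oo] --> 0)%R.
    by apply: cvg_geometric; rewrite ger0_norm // invf_lt1 // ltr1n.
  move=> /cvgrPdist_lt/(_ (d' / M)%R (divr_gt0 d0 M0))[N _ NP].
  exists N.+1 => -[//|n] Nn.
  have -> : (\sum_(0 <= k < n.+1) A (delta (q k x)))%R = A (den (J n.+1 x)).
    under eq_bigr do rewrite deltaE opB.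
    by rewrite telescope_sumr //= den0 op0 subr0.
  rewrite -opB; apply: le_lt_trans (hM _) _; rewrite mulrC -ltr_pdivlMr //.
  rewrite sqBC; apply: lt_trans (JP n x) _.
  have := NP n.+1 (ltnW Nn); rewrite sub0r normrN ger0_norm.
    by rewrite /tau exprVn mulrC.
  by rewrite mulr_ge0 ?ltW // exprn_ge0 // invr_ge0.
rewrite integral_nneseries //; last first.
  by move=> k x _; rewrite lee_fin mulr_ge0 ?sq_ge0 ?exprn_ge0.
apply: eq_eseriesr => k _; rewrite -ge0_integralZl //.
by move=> x _; rewrite lee_fin sq_ge0.
Qed.

End Discretisation.

(** * Normality of averages *)

Section AverageNormal.
Variables (R : realType) (H : completeNormedModType R[i]) (dot : {dot H for Num.conj}).
Hypothesis inner : inner_product_of dot.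
Local Notation Re := (@complex.Re R).
Local Notation Im := (@complex.Im R).
Local Notation sq := (sqnorm dot).
Local Notation nsq := (sqnorm_sum dot).
Context d (T : measurableType d) (P : probability T R).
Variable V : T -> 'B(H).
Hypothesis V_iso : forall x xi eta, dot (V x xi) (V x eta) = dot xi eta.
Hypothesis V_dot : forall (A : 'B(H)) xi eta,
  measurable_fun setT (fun x => Re (dot (A (V x xi)) (V x eta))).
Hypothesis V_sq : forall (A : 'B(H)) xi v,
  measurable_fun setT (fun x => sq (A (V x xi) - v)).
Variable den : nat -> H.
Hypothesis den0 : den 0%N = 0.
Hypothesis denP : forall (x : H) (e : R), 0 < e -> exists n, sq (x - den n) < e.
Variable Phi : 'B(H) -> 'B(H).
Hypothesis PhiE : is_average dot P V Phi.

Lemma cvgn_le_cst (u : nat -> R) (l K : R) :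
  u @ \oo --> l -> (forall n, u n <= K) -> l <= K.
Proof.
move=> ul uK; rewrite -(cvg_lim (@Rhausdorff R) ul).
by apply: limr_le; [apply/cvg_ex; exists l|exact: nearW].
Qed.

(** A bound on the unit ball other than 1 is absorbed by rescaling zeta. *)
Lemma ultrastrongly_boundedW (F : 'B(H) -> R[i]) (zeta : nat -> H) (K : R) :
  linear (F : 'B(H) -> R[i]^o) -> (nsq zeta < +oo)%E ->
  (forall A : 'B(H), (nsq (fun n => A (zeta n)) <= 1)%E -> normsq (F A) <= K) ->
  ultrastrongly_bounded dot F.
Proof.
move=> FL hz hK.
have F0 := linC0 FL.
have K0 : 0 <= K.
  have := hK 0; rewrite F0 normsq_real expr0n; apply.
  by rewrite [X in nsq X](_ : _ = fun=> 0) // nsq0.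
have K1 : 0 < K + 1 by rewrite ltr_wpDl.
pose c : R := Num.sqrt (K + 1).
have c2 : c ^+ 2 = K + 1 by rewrite sqr_sqrtr // ltW.
exists (fun n => c%:C *: zeta n) => [|A hA]; first exact: nsqZ_fin.
have := hK (c%:C *: A).
rewrite [X in nsq X](_ : _ = fun n => A (c%:C *: zeta n)); last first.
  by apply/funext => n; rewrite op_scaleE opZ.
move=> /(_ hA); rewrite -[_ *: A]addr0 (linC FL) F0 addr0 normsqM normsq_real c2.
by move=> h; rewrite -(ler_pM2l K1); lra.
Qed.

Let V_sqE x xi : sq (V x xi) = sq xi.
Proof. by rewrite /sqnorm V_iso. Qed.

Let V_sq0 (A : 'B(H)) xi : measurable_fun setT (fun x => sq (A (V x xi))).
Proof.
rewrite (_ : (fun x => _) = (fun x => sq (A (V x xi) - 0))) //.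
by apply/funext => x; rewrite subr0.
Qed.

Let sq_int (A : 'B(H)) xi : P.-integrable setT (EFin \o (fun x => sq (A (V x xi)))).
Proof.
have [M M0 hM] := op_bound inner A.
apply: (@bounded_integrable _ _ _ _ _ (M * sq xi)) => [|x].
  exact: V_sq0.
by rewrite ger0_norm ?sq_ge0 // -(V_sqE x xi); exact: hM.
Qed.

Let mean_sq_E (A : 'B(H)) xi eta :
  \int[P]_x ((sq (A (V x xi)) + sq eta) * 2^-1)
    = (\int[P]_x (sq (A (V x xi))) + sq eta) / 2.
Proof.
have ic : P.-integrable setT (EFin \o (fun=> sq eta)).
  by apply: (@bounded_integrable _ _ _ _ _ (sq eta)) => // x; rewrite ger0_norm ?sq_ge0.
rewrite -[X in (_ + X) / 2](@Rintegral_prob_cst _ _ _ P) -RintegralD // RintegralZr //.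
rewrite [X in integrable _ _ X](_ : _ = (EFin \o (fun x => sq (A (V x xi))))
  \+ (EFin \o (fun=> sq eta)))%E; first exact: integrableD.
exact/funext.
Qed.

Let mean_sq_int (A : 'B(H)) xi eta :
  P.-integrable setT (EFin \o (fun x => (sq (A (V x xi)) + sq eta) * 2^-1)).
Proof.
have [M M0 hM] := op_bound inner A.
apply: (@bounded_integrable _ _ _ _ _ ((M * sq xi + sq eta) * 2^-1)) => [|x].
  apply: measurable_funM => //; apply: measurable_funD => //.
rewrite ger0_norm; last by rewrite mulr_ge0 ?addr_ge0 ?sq_ge0 // invr_ge0.
by rewrite ler_wpM2r ?invr_ge0 // lerD2r -(V_sqE x xi); exact: hM.
Qed.

Let Rint_abs_le (h : T -> R) (A : 'B(H)) xi eta : P.-integrable setT (EFin \o h) ->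
  (forall x, `|h x| <= (sq (A (V x xi)) + sq (V x eta)) / 2) ->
  `|\int[P]_x (h x)| <= (\int[P]_x (sq (A (V x xi))) + sq eta) / 2.
Proof.
move=> hi hb; apply: le_trans (le_normr_Rintegral _ hi) _ => //.
rewrite -mean_sq_E; apply: le_Rintegral => //; first exact: (integrable_norm hi).
by move=> x _; have := hb x; rewrite V_sqE.
Qed.

(** The two factors of the pairing are separated by |<a,b>| <= (|a|^2 + |b|^2) / 2,
    applied inside the expectation. *)
Let average_le (A : 'B(H)) xi eta :
  `|Re (dot (Phi A xi) eta)| <= (\int[P]_x (sq (A (V x xi))) + sq eta) / 2 /\
  `|Im (dot (Phi A xi) eta)| <= (\int[P]_x (sq (A (V x xi))) + sq eta) / 2.
Proof.
have [ir ii] : cintegrable P (fun x => dot (A (V x xi)) (V x eta)).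
  exact: (average_integrable inner P V_iso V_dot).
rewrite PhiE /=; split; apply: Rint_abs_le => // x.
  exact: norm_Re_dot_le.
exact: norm_Im_dot_le.
Qed.

(** For square-summable xi and eta, \sum_n |<Phi A xi_n, eta_n>| is at most half of
    \sum_n E |A V xi_n|^2 + \sum_n |eta_n|^2.  Each term of the first series is
    dominated through [discretisation], with an error 2^-n that keeps the merged
    sequence square-summable. *)
Theorem average_normal : normal_map dot Phi.
Proof.
apply: (normal_mapP inner); first exact: (average_linear inner V_iso V_dot).
move=> [[xi eta] [h1 h2]].
have f1 := (square_summableP inner _).1 h1; have f2 := (square_summableP inner _).1 h2.
have /choice[Z hZ] n : exists Z : nat -> H, (nsq Z <= (16 * (sq (xi n) + 2 ^- n))%:E)%E /\
    forall A : 'B(H), (\int[P]_x (sq (A (V x (xi n))))%:E <= nsq (fun n => A (Z n)))%E.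
  apply: (discretisation inner P den0 denP) => [A v|x|]; first exact: V_sq.
    by rewrite V_sqE.
  by rewrite invr_gt0 exprn_gt0.
have [e he] := nsq_flatten dot.
have [Meta hMeta] := nsq_fin_ex f2.
have zfin : (nsq (fun n => Z (e n).1 (e n).2) < +oo)%E.
  rewrite he; apply: (@le_lt_trans _ _ (\sum_(n <oo) ((16%:E * (sq (xi n))%:E) +
      16%:E * (2 ^- n)%:E))%E).
    apply: lee_nneseries => [n _ _|n _]; first exact: nsq_ge0.
    by rewrite -!EFinM -EFinD -mulrDr; exact: (hZ n).1.
  have g0 n : (0 <= (2 ^- n)%:E :> \bar R)%E by rewrite lee_fin invr_ge0 exprn_ge0.
  have s0 n : (0 <= (sq (xi n))%:E)%E by rewrite lee_fin sq_ge0.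
  rewrite nneseriesD; [|by move=> n _ _; rewrite mule_ge0..].
  rewrite !nneseriesZl //; apply: lte_add_pinfty; rewrite lte_mul_pinfty //.
  apply: (@le_lt_trans _ _ 2%:E); last exact: ltry.
  apply/(nneseries_leP (a := fun n => 2 ^- n)) => [n|N].
    by rewrite invr_ge0 exprn_ge0.
  have -> : \sum_(0 <= n < N) 2 ^- n = 2 - 2 * 2 ^- N :> R.
    elim: N => [|N IH]; first by rewrite big_geq // expr0 invr1 mulr1 subrr.
    rewrite big_nat_recr //= IH exprS invfM; field.
    by rewrite expf_neq0.
  by rewrite gerBl mulr_ge0 // invr_ge0 exprn_ge0.
pose K : R := (1 + Meta) / 2.
apply: (@ultrastrongly_boundedW _ (fun n => Z (e n).1 (e n).2) (2 * K ^+ 2)) => //.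
  exact: (predual_linear inner _ (average_linear inner V_iso V_dot PhiE)).
move=> A hA.
have sumA N : \sum_(0 <= n < N) \int[P]_x (sq (A (V x (xi n)))) <= 1.
  rewrite -lee_fin; apply: le_trans hA; rewrite (he (fun k j => A (Z k j))).
  apply: le_trans (nneseries_lim_ge (m := 0%N) N _); last by move=> k _ _; exact: nsq_ge0.
  rewrite -sumEFin; apply: lee_sum => n _.
  apply: le_trans ((hZ n).2 A).
  by rewrite /Rintegral fineK //; apply: integrable_fin_num => //; exact: sq_int.
have partial N (h : nat -> R) :
    (forall n, `|h n| <= (\int[P]_x (sq (A (V x (xi n)))) + sq (eta n)) / 2) ->
    `|\sum_(0 <= n < N) h n| <= K.
  move=> hh; apply: le_trans (ler_norm_sum _ _ _) _.
  apply: (@le_trans _ _ (\sum_(0 <= n < N)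
      (\int[P]_x (sq (A (V x (xi n)))) + sq (eta n)) / 2)); first exact: ler_sum.
  rewrite -mulr_suml big_split /= /K ler_wpM2r ?invr_ge0 // lerD //.
  by apply: (nsq_leP dot eta Meta).1; rewrite hMeta.
have part N : `|Re (series (fun n => dot (Phi A (xi n)) (eta n)) N)| <= K.
  by rewrite series_re; apply: partial => n; case: (average_le A (xi n) (eta n)).
have partI N : `|Im (series (fun n => dot (Phi A (xi n)) (eta n)) N)| <= K.
  by rewrite series_im; apply: partial => n; case: (average_le A (xi n) (eta n)).
have [hr hi] := cvgC_parts _ (cvg_pairing (nsq_op inner (Phi A) f1) f2).
have lr : `|Re (predual_pairing dot (Phi A) (exist _ (xi, eta) (conj h1 h2)))| <= K.
  exact: (cvgn_le_cst (cvg_norm hr)).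
have li : `|Im (predual_pairing dot (Phi A) (exist _ (xi, eta) (conj h1 h2)))| <= K.
  exact: (cvgn_le_cst (cvg_norm hi)).
rewrite /normsq mulr2n mulrDl !mul1r.
have K0 : 0 <= K by apply: le_trans lr.
rewrite -(real_normK (num_real (Re _))) -(real_normK (num_real (Im _))).
by apply: lerD; rewrite ler_pXn2r ?nnegrE.
Qed.

End AverageNormal.

(** * The characteristic function of the standard normal law *)

Section GaussianCharacteristicFunction.
Variable R : realType.
Notation mu := (@lebesgue_measure R).
Local Notation gamma := (@normal_prob R 0 1).

Let c0 : R := normal_peak 1.
Let p (x : R) : R := c0 * expR (- x ^+ 2 / 2).

Let c0_gt0 : 0 < c0. Proof. by apply: normal_peak_gt0; rewrite oner_eq0. Qed.

Let pE : normal_pdf 0 1 = p.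
Proof.
apply/funext => x; rewrite normal_pdfE ?oner_eq0 // /p /normal_fun.
by rewrite subr0 expr1n.
Qed.

Let p_ge0 x : 0 <= p x. Proof. by rewrite mulr_ge0 ?expR_ge0 // ltW. Qed.

Let p_int : mu.-integrable setT (EFin \o p).
Proof. by rewrite -pE; exact: integrable_normal_pdf. Qed.

Let p_continuous : continuous p.
Proof. by rewrite -pE; apply: continuous_normal_pdf; exact: oner_neq0. Qed.

Let p_total : \int[mu]_x (p x) = 1.
Proof. by rewrite /Rintegral -pE integral_normal_pdf. Qed.

Let p_derive (x : R) : is_derive x 1 p (- x * p x).
Proof.
rewrite /p; apply: is_derive_eq; rewrite /GRing.scale /=.
by field.
Qed.

(** As |x| <= e^(x^2/4), the first moment is dominated by a Gaussian of
    variance 2. *)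
Let absxp_int : mu.-integrable setT (EFin \o (fun x : R => `|x| * p x)).
Proof.
pose s2 : R := Num.sqrt 2.
have s20 : s2 != 0 by rewrite gt_eqF // sqrtr_gt0.
have s2e : s2 ^+ 2 = 2 by rewrite sqr_sqrtr.
pose w : R := c0 / normal_peak s2.
have pk := normal_peak_gt0 s20.
have iw : mu.-integrable setT (EFin \o (fun x => w * normal_pdf 0 s2 x)).
  rewrite [X in integrable _ _ X](_ : _ = fun x => w%:E * (normal_pdf 0 s2 x)%:E)%E.
    by apply: integrableZl => //; exact: integrable_normal_pdf.
  by apply/funext => x; rewrite /= EFinM.
have cm : continuous (fun x : R => `|x| * p x).
  by move=> x; apply: cvgM; [exact: norm_continuous|exact: p_continuous].
apply: le_integrable iw => //.
  by apply/measurable_EFinP; exact: continuous_measurable_fun.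
move=> x _; rewrite /= lee_fin normrM normr_id (ger0_norm (p_ge0 x)).
rewrite [leRHS]ger0_norm; last first.
  by rewrite mulr_ge0 ?normal_pdf_ge0 // divr_ge0 // ltW.
rewrite normal_pdfE // /= /w [leRHS]mulrA divfK ?gt_eqF // /p mulrCA ler_wpM2l ?(ltW c0_gt0) //.
rewrite /normal_fun subr0 s2e.
have -> : - x ^+ 2 / (2 *+ 2) = - x ^+ 2 / 2 + x ^+ 2 / 4 :> R by rewrite -mulr_natr; field.
rewrite expRD mulrC ler_wpM2l ?expR_ge0 //.
apply: le_trans (expR_ge1Dx _).
rewrite -(real_normK (num_real x)); have := sqr_ge0 (`|x| - 2).
by rewrite sqrrB; lra.
Qed.

(** The angle th treats cosine (th = 0) and sine (th = - pi / 2) at once. *)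
Let h (th s : R) : R := \int[mu]_x (cos (s * x + th) * p x).

Let bounded_mul_int (g q : R -> R) : continuous g -> (forall x, `|g x| <= 1) ->
  mu.-integrable setT (EFin \o q) -> mu.-integrable setT (EFin \o (fun x => g x * q x)).
Proof.
move=> cg hg iq; have mq := measurable_int mu iq.
apply: le_integrable iq => //.
  apply/measurable_EFinP; apply: measurable_funM; first exact: continuous_measurable_fun.
  exact/measurable_EFinP.
by move=> x _; rewrite /= lee_fin normrM ler_piMl.
Qed.

Let cos_le1 (x : R) : `|cos x| <= 1.
Proof. by rewrite ler_norml cos_geN1 cos_le1. Qed.
Let sin_le1 (x : R) : `|sin x| <= 1.
Proof. by rewrite ler_norml sin_geN1 sin_le1. Qed.

Let affine_continuous (s th : R) : continuous (fun x : R => s * x + th).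
Proof.
move=> x; apply: cvgD; last exact: cvg_cst.
by apply: cvgM; [exact: cvg_cst|exact: cvg_id].
Qed.

Let cos_aff s th : continuous (fun x : R => cos (s * x + th)).
Proof. by move=> x; apply: continuous_comp; [exact: affine_continuous|exact: continuous_cos]. Qed.
Let sin_aff s th : continuous (fun x : R => sin (s * x + th)).
Proof. by move=> x; apply: continuous_comp; [exact: affine_continuous|exact: continuous_sin]. Qed.

Let xp_int th s : mu.-integrable setT (EFin \o (fun x => - x * sin (s * x + th) * p x)).
Proof.
apply: le_integrable absxp_int => //.
  apply/measurable_EFinP; apply: continuous_measurable_fun => x.
  apply: cvgM; last exact: p_continuous.
  by apply: cvgM; [exact: cvgN|exact: sin_aff].
move=> x _; rewrite /= lee_fin !normrM normrN normr_id.
by rewrite ler_wpM2r // ler_piMr.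
Qed.

Let cos_int th s : mu.-integrable setT (EFin \o (fun x => cos (s * x + th) * p x)).
Proof. by apply: bounded_mul_int. Qed.

(** A primitive of F' that vanishes at infinity, for integration by parts. *)
Let F th s (x : R) := sin (s * x + th) * p x.
Let F' th s (x : R) := - x * sin (s * x + th) * p x + s * (cos (s * x + th) * p x).

Let F_derive th s (x : R) : is_derive x 1 (F th s) (F' th s x).
Proof.
have pd := p_derive x; rewrite /F; apply: is_derive_eq; rewrite /GRing.scale /F' /=.
by ring.
Qed.

Let F'_continuous th s : continuous (F' th s).
Proof.
move=> x; apply: cvgD.
  apply: cvgM; last exact: p_continuous.
  by apply: cvgM; [exact: cvgN|exact: sin_aff].
apply: cvgM; first exact: cvg_cst.
by apply: cvgM; [exact: cos_aff|exact: p_continuous].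
Qed.

Let F_small th s (n : nat) (x : R) : `|x| = n.+1%:R -> `|F th s x| <= 2 * c0 * n.+1%:R^-1.
Proof.
move=> xn; rewrite normrM (ger0_norm (p_ge0 _)).
apply: (@le_trans _ _ (p x)); first by rewrite ler_piMl.
rewrite /p mulrC [leRHS]mulrAC ler_wpM2r ?(ltW c0_gt0) //.
rewrite mulNr expRN -(real_normK (num_real x)) xn.
have n1 : 1 <= n.+1%:R :> R by rewrite ler1n.
rewrite -[2]invrK -invfM lef_pV2 ?posrE ?expR_gt0 ?mulr_gt0 ?invr_gt0 //.
apply: le_trans (expR_ge1Dx _); rewrite expr2; move: n.+1%:R n1 => m m1; nra.
Qed.

Let F'_integral th s : \int[mu]_x (F' th s x) = 0.
Proof.
have iF' : mu.-integrable setT (EFin \o F' th s).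
  rewrite [X in integrable _ _ X](_ : _ =
    (EFin \o (fun x => (- x * sin (s * x + th) * p x)%R)) \+
    (fun x => s%:E * (cos (s * x + th) * p x)%R%:E))%E.
    by apply: integrableD => //; apply: integrableZl => //; exact: cos_int.
  by apply/funext => x; rewrite /= -EFinM -EFinD.
pose D (n : nat) : set R := `[- n.+1%:R, n.+1%:R]%classic.
have FTC n : (\int[mu]_(x in D n) (F' th s x)%:E
    = (F th s n.+1%:R)%:E - (F th s (- n.+1%:R))%:E)%E.
  apply: continuous_FTC2.
  - by rewrite gtrN // ltr0n.
  - by apply: continuous_subspaceT; exact: F'_continuous.
  - have cF : continuous (F th s).
      move=> x; apply: differentiable_continuous; apply/derivable1_diffP.
      by case: (F_derive th s x).
    split=> [x _||]; first by case: (F_derive th s x).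
      exact/cvg_at_right_filter/cF.
    exact/cvg_at_left_filter/cF.
  - by move=> x _; rewrite derive1E; exact: derive_val.
have lim : (\int[mu]_(x in D n) (F' th s x)%:E @[n --> \oo] --> \int[mu]_x (F' th s x)%:E)%E.
  under eq_fun do rewrite integral_mkcond.
  apply: (@dominated_cvg _ _ _ mu setT measurableT
    (fun n => (EFin \o F' th s) \_ (D n)) (EFin \o F' th s) (fun x => `|(F' th s x)%:E|%E)).
  - move=> n; apply/(measurable_restrictT _ _).1; first exact: measurable_itv.
    by apply: measurable_funTS; apply/measurable_EFinP; exact: continuous_measurable_fun.
  - move=> x _; apply: cvg_near_cst.
    near=> n; rewrite patchE mem_set // /D /= in_itv /= -ler_norml.
    by apply: ltW; apply: lt_trans (_ : n%:R < _); [near: n; exact: nbhs_infty_gtr|rewrite ltr_nat].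
  - by [].
  - exact: integrable_abse.
  - by move=> n x _; rewrite patchE; case: ifP => // _; rewrite abse0 abse_ge0.
have lim0 : (\int[mu]_(x in D n) (F' th s x)%:E @[n --> \oo] --> 0)%E.
  under eq_fun do rewrite FTC -EFinB.
  apply: cvg_EFin; first exact: nearW.
  have hh : 4 * c0 * n.+1%:R^-1 @[n --> \oo] --> (0 : R).
    by rewrite -[X in _ --> X](mulr0 (4 * c0)); apply: cvgM; [exact: cvg_cst|exact: cvg_harmonic].
  apply: norm_cvg0; apply: (@squeeze_cvgr _ _ _ _ (fun=> 0) (fun n => 4 * c0 * n.+1%:R^-1)) => //.
    apply: nearW => n; rewrite /= normr_ge0 /=; apply: le_trans (ler_normB _ _) _.
    have := @F_small th s n n.+1%:R (ger0_norm (ler0n _ _)).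
    have := @F_small th s n (- n.+1%:R) (etrans (normrN _) (ger0_norm (ler0n _ _))).
    by move: (n.+1%:R^-1) => v; lra.
  exact: cvg_cst.
by rewrite /Rintegral; have -> := cvg_unique _ lim lim0.
Unshelve. all: by end_near. Qed.

Let by_parts th s :
  \int[mu]_x (- x * sin (s * x + th) * p x) = - s * h th s.
Proof.
have := F'_integral th s; rewrite /F' RintegralD //; last first.
  rewrite [X in integrable _ _ X](_ : _ = fun x => s%:E * (cos (s * x + th) * p x)%R%:E)%E.
    by apply: integrableZl => //; exact: cos_int.
  by apply/funext => x; rewrite /= -EFinM.
rewrite RintegralZl //.
by rewrite -/(h th s) mulNr => /eqP; rewrite addr_eq0 => /eqP.
Qed.

Let h_derive (th s : R) : is_derive s 1 (h th) (- s * h th s).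
Proof.
have fd (x y : R) : is_derive x 1 (fun t : R => cos (t * y + th) * p y)
    (- y * sin (x * y + th) * p y).
  by apply: is_derive_eq; rewrite /GRing.scale /=; ring.
have I : `]s - 1, s + 1[%classic s by rewrite /= in_itv /=; lra.
have d1 (x y : R) : partial1of2 (fun t x0 => cos (t * x0 + th) * p x0) x y
    = - y * sin (x * y + th) * p y.
  by rewrite partial1of2E; have fdxy := fd x y; exact: derive_val.
have h1 (x : R) : `]s - 1, s + 1[%classic x -> mu.-integrable setT
    (EFin \o (fun y => cos (x * y + th) * p y)) by move=> _; exact: cos_int.
have h2 (x y : R) : `]s - 1, s + 1[%classic x -> setT y ->
    derivable (fun t : R => cos (t * y + th) * p y) x 1 by move=> _ _; case: (fd x y).
have h3 (y : R) : 0 <= `|y| * p y by rewrite mulr_ge0.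
have h4 (x y : R) : `]s - 1, s + 1[%classic x -> setT y ->
    `|partial1of2 (fun t x0 => cos (t * x0 + th) * p x0) x y| <= `|y| * p y.
  move=> _ _; rewrite d1 normrM (ger0_norm (p_ge0 y)) normrM normrN.
  by rewrite ler_wpM2r // ler_piMr.
apply: DeriveDef.
  exact: (derivable_under_integral measurableT I h1 h2 h3 absxp_int h4).
rewrite -derive1E (differentiation_under_integral measurableT I h1 h2 h3 absxp_int h4).
by rewrite -by_parts; apply: eq_Rintegral => y _; rewrite d1.
Qed.

(** Differentiation under the integral sign and integration by parts show that
    h' = - s h, so e^(s^2/2) h is constant in s. *)
Lemma gaussian_cos th s : h th s = cos th * expR (- (s ^+ 2 / 2)).
Proof.
have e_der (x : R) : is_derive x 1 (fun y => expR (y ^+ 2 / 2)) (x * expR (x ^+ 2 / 2)).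
  by apply: is_derive_eq; rewrite /GRing.scale /=; field.
pose k (y : R) := expR (y ^+ 2 / 2) * h th y.
have kd (x : R) : is_derive x 1 k 0.
  have h1 := h_derive th x; have h2 := e_der x.
  rewrite /k; apply: is_derive_eq; rewrite /GRing.scale /=; ring.
have := is_derive_0_is_cst s 0 kd.
rewrite /k expr0n mul0r expR0 mul1r => k0.
have h0 : h th 0 = cos th.
  rewrite /h; under eq_Rintegral => x _ do rewrite mul0r add0r.
  by rewrite RintegralZl // p_total mulr1.
rewrite -h0 -k0 mulrAC -expRD.
by rewrite addrN expR0 mul1r.
Qed.

(** The measure gamma is given by integrals of its density over sets.  The
    change of variables is available for the Radon-Nikodym derivative, and
    almost everywhere equality identifies this derivative with the density. *)
Let gamma_integral (f : R -> R) (M : R) : continuous f -> (forall x, `|f x| <= M) ->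
  \int[gamma]_x (f x) = \int[mu]_x (f x * p x).
Proof.
move=> cf fM; have dom := @normal_prob_dominates R 0 1.
have fi : gamma.-integrable setT (EFin \o f).
  by apply: (@bounded_integrable _ _ _ gamma f M) => //; exact: continuous_measurable_fun.
rewrite /Rintegral -(Radon_Nikodym_change_of_variables dom measurableT fi).
congr fine; under [RHS]eq_integral do rewrite EFinM.
apply: ae_eq_integral => //.
- apply: emeasurable_funM; first by apply/measurable_EFinP; exact: continuous_measurable_fun.
  by apply: (measurable_int mu); exact: Radon_Nikodym_integrable.
- by apply: emeasurable_funM; apply/measurable_EFinP; exact: continuous_measurable_fun.
apply: ae_eqe_mul2l => /=; apply: integral_ae_eq => //.
- exact: Radon_Nikodym_integrable.
- by apply/measurable_EFinP; exact: continuous_measurable_fun.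
- move=> E _ mE; rewrite -Radon_Nikodym_integral //.
  by rewrite /= /normal_prob pE.
Qed.

Lemma normal_prob_cos s : \int[gamma]_x (cos (s * x)) = expR (- (s ^+ 2 / 2)).
Proof.
rewrite (gamma_integral (M := 1)) => [|x|//]; last first.
  by apply: continuous_comp; [exact: mulrl_continuous|exact: continuous_cos].
by have := gaussian_cos 0 s; rewrite cos0 mul1r => <-; apply: eq_Rintegral => x _; rewrite addr0.
Qed.

Lemma normal_prob_sin s : \int[gamma]_x (sin (s * x)) = 0.
Proof.
rewrite (gamma_integral (M := 1)) => [|x|//]; last first.
  by apply: continuous_comp; [exact: mulrl_continuous|exact: continuous_sin].
have := gaussian_cos (- (pi / 2)) s; rewrite cosN cos_pihalf mul0r => <-.
apply: eq_Rintegral => x _; rewrite -[in RHS]cosN opprD opprK.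
by rewrite cosDpihalf sinN opprK.
Qed.

End GaussianCharacteristicFunction.

(** * Gaussian averages along one direction of the plane *)

Section WeakStrongLimits.
Variables (R : realType) (H : completeNormedModType R[i]) (dot : {dot H for Num.conj}).
Hypothesis inner : inner_product_of dot.
Local Notation sq := (sqnorm dot).

Lemma cvgC0 (f : nat -> R[i]) :
  normsq (f n) @[n --> \oo] --> (0 : R) -> (f n : R[i]^o) @[n --> \oo] --> (0 : R[i]^o).
Proof.
move=> /cvgrPdist_lt h; apply/cvgrPdist_lt => e /gt0_realE[].
move: (complex.Re e) => r -> {e} r0.
have := h (r ^+ 2) (exprn_gt0 2 r0); apply: filterS => n.
by rewrite !sub0r !normrN ger0_norm ?normsq_ge0 // => hn; exact: normr_lt_sq.
Qed.

(** Weak convergence of a uniformly bounded sequence of operators is enough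
    against strongly convergent vectors. *)
Lemma cvg_weak_strong (B_ : nat -> 'B(H)) (B : 'B(H)) (K : R) (a_ b_ : nat -> H) a b :
  (forall n x, sq (B_ n x) <= K * sq x) ->
  (forall x y, (dot (B_ n x) y : R[i]^o) @[n --> \oo] --> (dot (B x) y : R[i]^o)) ->
  a_ @ \oo --> a -> b_ @ \oo --> b ->
  (dot (B_ n (a_ n)) (b_ n) : R[i]^o) @[n --> \oo] --> (dot (B a) b : R[i]^o).
Proof.
move=> hK hB ha hb.
have sa : sq (a_ n - a) @[n --> \oo] --> (0 : R) by exact/(cvg_sqP inner).
have sb : sq (b_ n - b) @[n --> \oo] --> (0 : R) by exact/(cvg_sqP inner).
have sbb : sq (b_ n) @[n --> \oo] --> sq b by exact: (cvg_sq inner).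
have c1 : (dot (B_ n (a_ n - a)) (b_ n) : R[i]^o) @[n --> \oo] --> (0 : R[i]^o).
  apply: cvgC0; apply: (@squeeze_cvgr _ _ _ _ (fun=> 0)
    (fun n => K * sq (a_ n - a) * sq (b_ n))) => //.
  - apply: nearW => n; rewrite normsq_ge0 /=.
    by apply: le_trans (cauchy_schwarz _ _ _) _; rewrite ler_wpM2r ?sq_ge0.
  - exact: cvg_cst.
  - rewrite -[X in _ --> X](mul0r (sq b)); apply: cvgM => //.
    by rewrite -[X in _ --> X](mulr0 K); apply: cvgM => //; exact: cvg_cst.
have c2 : (dot (B_ n a) (b_ n - b) : R[i]^o) @[n --> \oo] --> (0 : R[i]^o).
  apply: cvgC0; apply: (@squeeze_cvgr _ _ _ _ (fun=> 0)
    (fun n => K * sq a * sq (b_ n - b))) => //.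
  - apply: nearW => n; rewrite normsq_ge0 /=.
    by apply: le_trans (cauchy_schwarz _ _ _) _; rewrite ler_wpM2r ?sq_ge0.
  - exact: cvg_cst.
  - by rewrite -[X in _ --> X](mulr0 (K * sq a)); apply: cvgM => //; exact: cvg_cst.
have E n : dot (B_ n (a_ n)) (b_ n) =
    dot (B_ n (a_ n - a)) (b_ n) + dot (B_ n a) (b_ n - b) + dot (B_ n a) b.
  by rewrite opB dotBl dotBr addrA subrK subrK.
have := cvgD (cvgD c1 c2) (hB a b) => /(_ _ _); rewrite !add0r => h.
apply: (cvg_trans _ h); apply: near_eq_cvg.
by apply: nearW => n; rewrite /= E.
Qed.

(** It is the predual pairing of sequences concentrated at index 0. *)
Lemma vector_functional_normal xi eta : normal_functional dot (fun A : 'B(H) => dot (A xi) eta).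
Proof.
pose at0 (v : H) (n : nat) : H := if n is 0%N then v else 0.
have fin v : (sqnorm_sum dot (at0 v) < +oo)%E by rewrite nsq_single ltry.
have -> : (fun A : 'B(H) => dot (A xi) eta) =
    (fun A => predual_pairing dot A (predual_pair inner (fin xi) (fin eta))).
  apply/funext => A; apply/esym; rewrite predual_pairE; apply: limC_eq.
  apply: cvg_near_cst; exists 1%N => // -[//|n] _.
  by rewrite /series /= big_nat_recl //= big1 ?addr0 // => k _; rewrite dot0r.
exact: predual_normal.
Qed.

Lemma vector_functional_linear (phi : 'B(H) -> 'B(H)) xi eta : linear phi ->
  linear ((fun A : 'B(H) => dot (phi A xi) eta) : 'B(H) -> R[i]^o).
Proof.
by move=> L a A B; rewrite L op_addE op_scaleE dotDl dotZl.
Qed.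

End WeakStrongLimits.

Section WeylAverages.
Variables (R : realType) (H : completeNormedModType R[i]) (dot : {dot H for Num.conj}).
Variable W : R * R -> 'B(H).
Hypothesis inner : inner_product_of dot.
Hypothesis weyl : weyl_system dot W.
Hypothesis irr : irreducible_family W.
Local Notation Re := (@complex.Re R).
Local Notation sq := (sqnorm dot).
Local Notation gamma := (@normal_prob R 0 1).

(** A random displacement D s x of the plane, with x standard normal and s a
    scale; V is the operator by which one conjugates. *)
Variable D : R -> R -> R * R.
Hypothesis D_continuous : forall s, continuous (D s).
Hypothesis D_continuous_s : forall x, continuous (D ^~ x).

Let V (s x : R) : 'B(H) := W (- D s x).

Let V_continuous s xi : continuous (fun x => V s x xi).
Proof.
move=> x; apply: (@cvg_comp _ _ _ (fun x => - D s x) (fun z => W z xi)).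
  by apply: cvgN; exact: D_continuous.
exact: (weyl_continuous weyl).
Qed.

Let V_continuous_s x xi : continuous (fun s => V s x xi).
Proof.
move=> s; apply: (@cvg_comp _ _ _ (fun s => - D s x) (fun z => W z xi)).
  by apply: cvgN; exact: D_continuous_s.
exact: (weyl_continuous weyl).
Qed.

Let V_iso s x xi eta : dot (V s x xi) (V s x eta) = dot xi eta.
Proof. exact: (weyl_isometry weyl). Qed.

Let V_dot s (A : 'B(H)) xi eta :
  measurable_fun setT (fun x => Re (dot (A (V s x xi)) (V s x eta))).
Proof.
apply: continuous_measurable_fun => x; apply: (cvg_Re_dot inner); last exact: V_continuous.
by apply: (@cvg_comp _ _ _ (fun x => V s x xi) A); [exact: V_continuous|exact: op_continuous].
Qed.

Let V_sq s (A : 'B(H)) xi v : measurable_fun setT (fun x => sq (A (V s x xi) - v)).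
Proof.
apply: continuous_measurable_fun => x; apply: (cvg_sq inner).
apply: cvgB; last exact: cvg_cst.
by apply: (@cvg_comp _ _ _ (fun x => V s x xi) A); [exact: V_continuous|exact: op_continuous].
Qed.

Lemma weyl_average_ex : exists Phi : R -> 'B(H) -> 'B(H),
  forall s, is_average dot gamma (V s) (Phi s).
Proof.
have /choice[Phi h] s : exists Phi, is_average dot gamma (V s) Phi.
  exact: (average_ex inner gamma (V_iso s) (V_dot s)).
by exists Phi.
Qed.

Variable Phi : R -> 'B(H) -> 'B(H).
Hypothesis PhiE : forall s, is_average dot gamma (V s) (Phi s).

Lemma weyl_average_linear s : linear (Phi s).
Proof. exact: (average_linear inner (P := gamma) (V_iso s) (V_dot s) (PhiE s)). Qed.

Lemma weyl_average_normal s : normal_map dot (Phi s).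
Proof.
have [d [d0 dP]] := weyl_dense_seq inner weyl irr.
exact: (average_normal inner (P := gamma) (V_iso s) (V_dot s) (V_sq s) d0 dP (PhiE s)).
Qed.

Lemma weyl_average_cp s : completely_positive dot (Phi s).
Proof. exact: (average_cp inner (P := gamma) (V_iso s) (V_dot s) (PhiE s)). Qed.

Lemma weyl_average1 s : Phi s one_op = one_op.
Proof. exact: (average1 (P := gamma) (V_iso s) (PhiE s)). Qed.

Lemma weyl_average_bound s (A : 'B(H)) (M : R) : 0 <= M ->
  (forall x, sq (A x) <= M * sq x) -> forall x, sq (Phi s A x) <= 2 * M * sq x.
Proof. exact: (average_bound inner (P := gamma) (V_iso s) (V_dot s) (PhiE s)). Qed.

Lemma weyl_average_id s (A : 'B(H)) : (forall x, D s x = 0) -> Phi s A = A.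
Proof.
move=> D0; apply: op_eq => xi; apply: (dot_inj (dot := dot)) => eta.
rewrite dotC [RHS]dotC PhiE; congr (Num.conj _).
rewrite -[RHS](cint_cst gamma); apply: eq_cint => x.
by rewrite /V D0 oppr0 !(weyl0 weyl).
Qed.

(** The phase in [weyl_conj] is the exponential of a multiple of a standard
    normal variable. *)
Lemma weyl_average_weyl s z (th : R) :
  (forall x, z.1 * (D s x).2 - (D s x).1 * z.2 = th * x) ->
  Phi s (W z) = (expR (- (th ^+ 2 / 2)))%:C *: W z.
Proof.
move=> hth; apply: (average_eigen (P := gamma) (PhiE s) (chi := fun x => expi (th * x))).
- have cont (f : R -> R) : continuous f -> measurable_fun setT (fun x => f (th * x)).
    move=> fc; apply: continuous_measurable_fun => x.
    by apply: (@cvg_comp _ _ _ ( *%R th) f); [exact: mulrl_continuous|exact: fc].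
  split; apply: (@bounded_integrable _ _ _ gamma _ 1) => /=.
  + exact: cont (@continuous_cos R).
  + by move=> x; rewrite ler_norml cos_geN1 cos_le1.
  + exact: cont (@continuous_sin R).
  + by move=> x; rewrite ler_norml sin_geN1 sin_le1.
- move=> x xi eta; rewrite -(weyl_adj weyl) (weyl_conj weyl) dotZl.
  by rewrite hth.
- by rewrite /cint /= normal_prob_cos normal_prob_sin.
Qed.

(** Joint continuity in the scale and in the operator, as needed to compose two
    averages at the same varying scale. *)
Lemma weyl_average_continuous (s_ : nat -> R) (s : R) (B_ : nat -> 'B(H)) (B : 'B(H)) (K : R) :
  0 <= K -> s_ @ \oo --> s -> (forall n x, sq (B_ n x) <= K * sq x) ->
  (forall x y, (dot (B_ n x) y : R[i]^o) @[n --> \oo] --> (dot (B x) y : R[i]^o)) ->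
  forall xi eta, (dot (Phi (s_ n) (B_ n) xi) eta : R[i]^o) @[n --> \oo]
    --> (dot (Phi s B xi) eta : R[i]^o).
Proof.
move=> K0 hs hK hB xi eta; rewrite PhiE.
under eq_fun do rewrite PhiE.
have K1 : 0 <= K * (sq xi * sq eta) by rewrite !mulr_ge0 ?sq_ge0.
apply: (@cint_cvg _ _ _ gamma _ _ (Num.sqrt (K * (sq xi * sq eta)))).
- by move=> n; exact: V_dot.
- move=> n.
  rewrite [X in measurable_fun _ X](_ : _ = fun x =>
      Re (dot (B_ n (V (s_ n) x xi)) (V (s_ n) x ('i *: eta)))); first exact: V_dot.
  by apply/funext => x; rewrite Im_dotE opZ.
- move=> n x; rewrite sqr_sqrtr //; apply: le_trans (cauchy_schwarz _ _ _) _.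
  rewrite (weyl_sq weyl) mulrA ler_wpM2r ?sq_ge0 //.
  by apply: le_trans (hK _ _) _; rewrite (weyl_sq weyl).
- move=> x; apply: (cvg_weak_strong inner hK hB).
    by apply: (@cvg_comp _ _ _ s_ (fun s => V s x xi)); [exact: hs|exact: V_continuous_s].
  by apply: (@cvg_comp _ _ _ s_ (fun s => V s x eta)); [exact: hs|exact: V_continuous_s].
- exact: sqrtr_ge0.
Qed.

End WeylAverages.

(** * The semigroup and its invariant functionals *)

Section HeatSemigroup.
Variables (R : realType) (H : completeNormedModType R[i]) (dot : {dot H for Num.conj}).
Variable W : R * R -> 'B(H).
Hypothesis inner : inner_product_of dot.
Hypothesis weyl : weyl_system dot W.
Hypothesis irr : irreducible_family W.

Lemma normal_map_ext (phi psi : 'B(H) -> 'B(H)) :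
  linear phi -> normal_map dot phi -> linear psi -> normal_map dot psi ->
  (forall z, phi (W z) = psi (W z)) -> phi = psi.
Proof.
move=> Lphi Nphi Lpsi Npsi h; apply/funext => A.
apply: op_eq => xi; apply: (dot_inj (dot := dot)) => eta.
rewrite dotC [RHS]dotC; congr (Num.conj _).
apply: (normal_functional_ext inner weyl irr
  (rho := fun A => dot (phi A xi) eta) (rho' := fun A => dot (psi A xi) eta)).
- exact: vector_functional_linear.
- exact: (@normal_comp _ _ _ (fun A : 'B(H) => dot (A xi) eta) phi
    (@vector_functional_normal _ _ _ inner xi eta) Nphi).
- exact: vector_functional_linear.
- exact: (@normal_comp _ _ _ (fun A : 'B(H) => dot (A xi) eta) psi
    (@vector_functional_normal _ _ _ inner xi eta) Npsi).
- by move=> z; rewrite h.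
Qed.

Definition translation1 (s x : R) : R * R := (s * x, 0).
Definition translation2 (s x : R) : R * R := (0, s * x).

Let translation1_continuous s : continuous (translation1 s).
Proof.
move=> x; apply: (@cvg_pair _ _ _ (nbhs x) (nbhs (s * x)) (nbhs (0 : R)) _ _ _
  ( *%R s) (fun=> 0)); [exact: mulrl_continuous|exact: cvg_cst].
Qed.

Let translation1_continuous_s x : continuous (translation1 ^~ x).
Proof.
move=> s; apply: (@cvg_pair _ _ _ (nbhs s) (nbhs (s * x)) (nbhs (0 : R)) _ _ _
  ( *%R^~ x) (fun=> 0)); [exact: mulrr_continuous|exact: cvg_cst].
Qed.

Let translation2_continuous s : continuous (translation2 s).
Proof.
move=> x; apply: (@cvg_pair _ _ _ (nbhs x) (nbhs (0 : R)) (nbhs (s * x)) _ _ _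
  (fun=> 0) ( *%R s)); [exact: cvg_cst|exact: mulrl_continuous].
Qed.

Let translation2_continuous_s x : continuous (translation2 ^~ x).
Proof.
move=> s; apply: (@cvg_pair _ _ _ (nbhs s) (nbhs (0 : R)) (nbhs (s * x)) _ _ _
  (fun=> 0) ( *%R^~ x)); [exact: cvg_cst|exact: mulrr_continuous].
Qed.

(** The composition of the averages along the two axes at scale sqrt (2t).  The
    semigroup law is checked on the W_z, where it says that
    e^(-(s+t)|z|^2) = e^(-s|z|^2) e^(-t|z|^2), and extends by [normal_map_ext];
    at t = 0 the scale is 0 and the averages are trivial. *)
Theorem heat_semigroup_ex : exists2 phi : R -> 'B(H) -> 'B(H), cp_semigroup dot phi &
  forall t z, 0 <= t -> phi t (W z) = (expR (- (t * sqnorm2 z)))%:C *: W z.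
Proof.
have [Phi1 E1] := weyl_average_ex inner weyl translation1_continuous.
have [Phi2 E2] := weyl_average_ex inner weyl translation2_continuous.
pose sc (t : R) := Num.sqrt (2 * t).
pose phi (t : R) (A : 'B(H)) := Phi1 (sc t) (Phi2 (sc t) A).
have L1 s := weyl_average_linear inner weyl translation1_continuous E1 s.
have L2 s := weyl_average_linear inner weyl translation2_continuous E2 s.
have N1 s := weyl_average_normal inner weyl irr translation1_continuous E1 s.
have N2 s := weyl_average_normal inner weyl irr translation2_continuous E2 s.
have L t : linear (phi t) by move=> a A B; rewrite /phi L2 L1.
have N t : normal_map dot (phi t).
  move=> A; apply: (@cvg_comp _ _ _ (Phi2 (sc t) : weak_star dot -> weak_star dot)
    (Phi1 (sc t) : weak_star dot -> weak_star dot)); last exact: N1.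
  exact: N2.
have eigen t z : 0 <= t -> phi t (W z) = (expR (- (t * sqnorm2 z)))%:C *: W z.
  move=> t0.
  have sc2 : sc t ^+ 2 = 2 * t by rewrite sqr_sqrtr // mulr_ge0.
  have e1 : Phi1 (sc t) (W z) = (expR (- (t * z.2 ^+ 2)))%:C *: W z.
    rewrite (weyl_average_weyl weyl E1 (th := - (sc t * z.2))).
      by rewrite sqrrN exprMn sc2; congr ((expR _)%:C *: _); field.
    by move=> x /=; ring.
  have e2 : Phi2 (sc t) (W z) = (expR (- (t * z.1 ^+ 2)))%:C *: W z.
    rewrite (weyl_average_weyl weyl E2 (th := sc t * z.1)).
      by rewrite exprMn sc2; congr ((expR _)%:C *: _); field.
    by move=> x /=; ring.
  have Z (c : R[i]) A : Phi1 (sc t) (c *: A) = c *: Phi1 (sc t) A.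
    exact: (GRing.scalable_linear (L1 (sc t))).
  rewrite /phi e2 Z e1 scalerA; congr (_ *: _).
  by rewrite -rmorphM /= -expRD /sqnorm2 mulrDr opprD.
exists phi => //; split.
- exact: (weyl_separable inner weyl irr).
- move=> A; have sc0 : sc 0 = 0 by rewrite /sc mulr0 sqrtr0.
  rewrite /phi sc0 (weyl_average_id weyl E1) ?(weyl_average_id weyl E2) //.
    by move=> x; rewrite /translation2 mul0r.
  by move=> x; rewrite /translation1 mul0r.
- move=> s t s0 t0 A.
  apply: (congr1 (fun f : 'B(H) -> 'B(H) => f A) (y := phi s \o phi t)).
  apply: normal_map_ext => //.
  + by move=> a B C /=; rewrite !L.
  + move=> B; apply: (@cvg_comp _ _ _ (phi t : weak_star dot -> weak_star dot)
      (phi s : weak_star dot -> weak_star dot)); [exact: N|exact: N].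
  move=> z; have Z (c : R[i]) B : phi s (c *: B) = c *: phi s B.
    exact: (GRing.scalable_linear (L s)).
  rewrite /= !eigen ?addr_ge0 // Z eigen // scalerA; congr (_ *: _).
  by rewrite -rmorphM /= -expRD; congr (expR _)%:C; ring.
- by move=> t _; exact: L.
- by move=> t _; exact: N.
- move=> t _ n A hA.
  have -> : map_mx (phi t) A = map_mx (Phi1 (sc t)) (map_mx (Phi2 (sc t)) A).
    by apply/matrixP => i j; rewrite !mxE.
  apply: (weyl_average_cp inner weyl translation1_continuous E1).
  exact: (weyl_average_cp inner weyl translation2_continuous E2).
- move=> t _; rewrite /phi (weyl_average1 weyl E2).
  exact: (weyl_average1 weyl E1).
- move=> A xi eta; apply: continuous_subspaceT => t.
  have [M M0 hM] := op_bound inner A.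
  have seq_cont (t_ : nat -> R) : t_ @ \oo --> t ->
      (dot (phi (t_ n) A xi) eta : R[i]^o) @[n --> \oo] --> (dot (phi t A xi) eta : R[i]^o).
    move=> ht.
    have hs : sc (t_ n) @[n --> \oo] --> sc t.
      apply: (@cvg_comp _ _ _ (fun n => 2 * t_ n) Num.sqrt); last exact: sqrt_continuous.
      by apply: cvgM => //; exact: cvg_cst.
    apply: (weyl_average_continuous inner weyl translation1_continuous
      translation1_continuous_s E1 (K := 2 * M) _ hs).
    + by rewrite mulr_ge0 // ltW.
    + move=> n x; apply: (weyl_average_bound inner weyl translation2_continuous E2) => //.
      exact: ltW.
    + move=> x y; apply: (weyl_average_continuous inner weyl translation2_continuous
        translation2_continuous_s E2 (ltW M0) hs (B_ := fun=> A)) => //.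
      by move=> x' y'; exact: cvg_cst.
  apply: cvgC.
    by apply/(@cvg_nbhsP _ R^o) => u /seq_cont/cvgC_parts[].
  by apply/(@cvg_nbhsP _ R^o) => u /seq_cont/cvgC_parts[].
Qed.

(** Invariance at time 1 forces rho (W_z) = 0 as soon as e^(-|z|^2) <> 1. *)
Lemma heat_invariant_functional_eq0 (phi : R -> 'B(H) -> 'B(H)) (rho : 'B(H) -> R[i]) :
  (forall t z, 0 <= t -> phi t (W z) = (expR (- (t * sqnorm2 z)))%:C *: W z) ->
  linear (rho : 'B(H) -> R[i]^o) -> normal_functional dot rho ->
  invariant_functional phi rho -> forall A, rho A = 0.
Proof.
move=> eigen rhoL rhoN rhoI; apply: (normal_functional_eq0_punctured inner weyl irr) => // z z0.
have rho0 := linC0 rhoL.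
have := rhoI 1 ler01 (W z); rewrite eigen // mul1r.
have := linC rhoL (expR (- sqnorm2 z))%:C (W z) 0; rewrite !addr0 rho0 addr0 => -> h.
have : ((expR (- sqnorm2 z))%:C - 1) * rho (W z) = 0 by rewrite mulrBl h mul1r subrr.
move/eqP; rewrite mulf_eq0 => /orP[|/eqP //].
rewrite subr_eq0 => /eqP[] /eqP; rewrite -expR0 (inj_eq (@expR_inj R)) oppr_eq0.
rewrite paddr_eq0 ?sqr_ge0 // !expf_eq0 /= => /andP[/eqP h1 /eqP h2].
by move: z0; rewrite [z]surjective_pairing h1 h2 eqxx.
Qed.

End HeatSemigroup.

Theorem theorem1p10 (R : realType) (H : completeNormedModType R[i])
    (dot : {dot H for Num.conj}) (W : R * R -> 'B(H)) :
  inner_product_of dot -> weyl_system dot W -> irreducible_family W ->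
  exists phi : R -> 'B(H) -> 'B(H),
    [/\ cp_semigroup dot phi,
        forall t z, 0 <= t -> phi t (W z) = (expR (- (t * sqnorm2 z)))%:C *: W z,
        forall psi : R -> 'B(H) -> 'B(H),
          cp_semigroup dot psi ->
          (forall t z, 0 <= t ->
            psi t (W z) = (expR (- (t * sqnorm2 z)))%:C *: W z) ->
          forall t, 0 <= t -> psi t = phi t,
        forall rho : 'B(H) -> R[i],
          linear (rho : 'B(H) -> R[i]^o) -> bounded_functional rho ->
          normal_functional dot rho -> invariant_functional phi rho ->
          forall A, rho A = 0
      & ~ exists rho : 'B(H) -> R[i], normal_state dot rho /\ invariant_functional phi rho].
Proof.
move=> inner weyl irr; have [phi cp eigen] := heat_semigroup_ex inner weyl irr.
exists phi; split=> //.
- move=> psi cp' eigen' t t0.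
  apply: (normal_map_ext inner weyl irr);
    [exact: (cp_semigroup_linear cp')|exact: (cp_semigroup_normal cp')
    |exact: (cp_semigroup_linear cp)|exact: (cp_semigroup_normal cp)|].
  by move=> z; rewrite eigen // eigen'.
- by move=> rho rhoL _; exact: (heat_invariant_functional_eq0 inner weyl irr eigen).
- move=> [rho [st inv]].
  have := heat_invariant_functional_eq0 inner weyl irr eigen
    (normal_state_linear st) (normal_state_normal st) inv one_op.
  by rewrite (normal_state1 st) => /eqP; rewrite oner_eq0.
Qed.
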